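(* Let $\Omega\subset\mathbb{R}^n$ be a bounded domain, $0<T<\infty$, $p>1$. Let $f:[0,\infty)\to[0,\infty)$ be of class $C^2$ and convex, with $\lim_{s\to\infty}s^{-p}f(s)=1$ and $|f'(s)|\le C(1+s^{p-1})$ for all $s\ge 0$ and some constant $C>0$. Let $V:\overline\Omega\to[0,\infty)$ be Hölder continuous and put $\mathcal V_0=\{x\in\overline\Omega:\ V(x)=0\}$. Let $x_0\in\Omega$ be such that $V(x_0)=0$ and the connected component of $\mathcal V_0$ containing $x_0$ does not intersect $\partial\Omega$. (i) Assume $p<p_S$ and let $u$ be a nonnegative classical solution of $$u_t=\Delta u+V(x)f(u),\qquad 0<t<T,\ x\in\Omega,$$ such that $u_t\ge 0$. Then $x_0$ is not a blowup point of $u$. (ii) Assertion (i) remains valid for any $p>1$ (without the assumption $p<p_S$) if one assumes in addition that $\Omega=B_R$ is a ball centered at the origin and that $u$ and $V$ are radially symmetric.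
   Context: $p_S=(n+2)/(n-2)_+$, i.e. $p_S=\infty$ if $n\le 2$ and $p_S=(n+2)/(n-2)$ if $n\ge3$. A point $x_0$ is a blowup point of $u$ if $\limsup_{t\to T,\ x\to x_0}u(t,x)=\infty$. A classical solution is a function that is $C^1$ in $t$ and $C^2$ in $x$ on $(0,T)\times\Omega$ and satisfies the equation pointwise; no boundary conditions are imposed. *)

(* Defs.v *)
From HB Require Import structures.
From mathcomp Require Import all_boot all_order all_algebra.
From mathcomp Require Import all_classical all_reals all_analysis.

Set Implicit Arguments.
Unset Strict Implicit.
Unset Printing Implicit Defensive.

Import Order.TTheory GRing.Theory Num.Theory.
Import numFieldNormedType.Exports.

Local Open Scope classical_set_scope.
Local Open Scope ring_scope.

(* The library norm on 'rV[R]_n is the sup norm; it induces the usual topology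
   and the usual bounded sets, but balls and radial symmetry need this one. *)
Definition enorm (R : realType) (n : nat) (x : 'rV[R]_n) : R :=
  Num.sqrt (\sum_(i < n) x 0 i ^+ 2).

Definition eball (R : realType) (n : nat) (r : R) : set 'rV[R]_n :=
  [set x | enorm x < r].

Definition radial_on (R : realType) (n : nat) (A : set 'rV[R]_n)
    (g : 'rV[R]_n -> R) : Prop :=
  forall x y, A x -> A y -> enorm x = enorm y -> g x = g y.

Definition domain (R : realType) (n : nat) (A : set 'rV[R]_n) : Prop :=
  [/\ open A, connected A & A !=set0].

Definition boundary (T : topologicalType) (A : set T) : set T :=
  closure A `\` A°.

Definition holder_continuous_on (R : realType) (n : nat) (A : set 'rV[R]_n)
    (g : 'rV[R]_n -> R) : Prop :=
  exists alpha K : R, [/\ 0 < alpha, alpha <= 1 &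
    forall x y, A x -> A y -> `|g x - g y| <= K * enorm (x - y) `^ alpha].

(* Functions on [0, +oo[ are represented by functions on R whose values at
   negative arguments are never used: the filter within [0, +oo[ below gives
   the ordinary derivative at s > 0 and the right derivative at s = 0. *)
Definition dquot (R : realType) (f : R -> R) (s y : R) : R :=
  (f y - f s) / (y - s).

Definition derivable_nneg (R : realType) (f : R -> R) (s : R) : Prop :=
  cvg (dquot f s y @[y --> within `[0, +oo[ s^']).

Definition derive_nneg (R : realType) (f : R -> R) (s : R) : R :=
  lim (dquot f s y @[y --> within `[0, +oo[ s^']).

Definition C2_nneg (R : realType) (f : R -> R) : Prop :=
  [/\ forall s : R, 0 <= s -> derivable_nneg f s,
      forall s : R, 0 <= s -> derivable_nneg (derive_nneg f) s &
      {within `[0, +oo[, continuous (derive_nneg (derive_nneg f))}].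

Definition partial (R : realType) (n : nat) (i : 'I_n) (g : 'rV[R]_n -> R)
    (x : 'rV[R]_n) : R :=
  'D_(delta_mx 0 i) g x.

Definition laplacian (R : realType) (n : nat) (g : 'rV[R]_n -> R)
    (x : 'rV[R]_n) : R :=
  \sum_(i < n) partial i (partial i g) x.

Definition time_deriv (R : realType) (n : nat) (u : R -> 'rV[R]_n -> R)
    (t : R) (x : 'rV[R]_n) : R :=
  derive1 (u ^~ x) t.

Definition continuous_cylinder (R : realType) (n : nat) (T : R)
    (Omega : set 'rV[R]_n) (w : R -> 'rV[R]_n -> R) : Prop :=
  {within `]0, T[ `*` Omega, continuous (fun z : R * 'rV[R]_n => w z.1 z.2)}.

(* C^1 in t and C^2 in x: the derivatives u_t, D_x u, D_x^2 u exist and are,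
   with u, jointly continuous in (t, x). *)
Definition C12 (R : realType) (n : nat) (T : R) (Omega : set 'rV[R]_n)
    (u : R -> 'rV[R]_n -> R) : Prop :=
  [/\ forall (t : R) x, 0 < t < T -> Omega x ->
        [/\ derivable (u ^~ x) t 1,
            forall i, derivable (u t) x (delta_mx 0 i) &
            forall i j, derivable (partial i (u t)) x (delta_mx 0 j)],
      continuous_cylinder T Omega u,
      continuous_cylinder T Omega (time_deriv u),
      forall i, continuous_cylinder T Omega (fun t => partial i (u t)) &
      forall i j,
        continuous_cylinder T Omega (fun t => partial j (partial i (u t)))].

Definition classical_solution (R : realType) (n : nat) (T : R)
    (Omega : set 'rV[R]_n) (V : 'rV[R]_n -> R) (f : R -> R)
    (u : R -> 'rV[R]_n -> R) : Prop :=
  C12 T Omega u /\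
  (forall (t : R) x, 0 < t < T -> Omega x ->
     time_deriv u t x = laplacian (u t) x + V x * f (u t x)).

Definition blowup_point (R : realType) (n : nat) (T : R)
    (Omega : set 'rV[R]_n) (u : R -> 'rV[R]_n -> R) (x0 : 'rV[R]_n) : Prop :=
  limf_esup (fun z : R * 'rV[R]_n => (u z.1 z.2)%:E)
    (filter_prod T^'- (within Omega (nbhs x0))) = +oo%E.

Definition pS (R : realType) (n : nat) : \bar R :=
  if (n <= 2)%N then +oo%E else ((n + 2)%:R / (n - 2)%:R)%:E.

(* Main.v *)
(** If u_t vanishes identically, u is stationary, hence locally bounded. Otherwise
    u_t is bounded below by a positive constant near t = T on compact sets, by a
    barrier argument for the difference quotients of u in time, which are
    supersolutions of w_t = Lap w + V f'(u) w because f is convex.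
    Components of a compact set are quasi-components, so the zeros of V near x0 are
    isolated by a compact set D around which V is positive. A localised
    Friedman-McLeod argument compares u_t with
    eps (theta^(m+1) (1 + f(u)) + theta^m (1+u)^q), 1 < q < p, theta a cut-off:
    the term V theta^m (1+u)^(q-1) ((1+u) f'(u) - q f(u)) absorbs the errors due to
    the cut-off wherever V is bounded below. This gives u_t >= eps f(u) on D.
    Close to x0, where V <= eps/2, the equation yields Lap u >= (eps/2) f(u), and the
    Keller-Osserman estimate bounds u uniformly in t. *)

Require Import Defs.
From HB Require Import structures.
From mathcomp Require Import all_boot all_order all_algebra.
From mathcomp Require Import all_classical all_reals all_analysis.
From mathcomp Require Import ring lra.

Set Implicit Arguments.
Unset Strict Implicit.
Unset Printing Implicit Defensive.

Import Order.TTheory GRing.Theory Num.Theory.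
Import numFieldNormedType.Exports.

Local Open Scope classical_set_scope.
Local Open Scope ring_scope.

(** Convexity gives no quantitative lower bound on f'', so the products of grad theta and grad u
    produced by theta^(m+1) f(u) cannot be absorbed by f(u) itself. The power (1+u)^q is added
    because q > 1 yields a positive multiple of |grad u|^2, while q < p keeps a gap of order (1+u)^p
    in (1+u) f' - q f. With q = (3p+1)/4 the powers that occur are integer powers of
    (1+u)^((p-1)/4), up to factors 1+u, and the absorption becomes polynomial algebra. As u may be
    unbounded near T, the final constants use only f' >= -C; an upper bound of f'(u) on a shorter
    time interval enters through a rate [lam] attached to a negative minimum and drops out of the
    conclusion. The compact set D need not have a smooth boundary: the cut-off is the maximum over
    centres y in D of 1 - |x-y|^2/sg, and y is one more variable of the minimisation. Each maximum
    principle is an extremum over a compact set followed by derivative tests along coordinate lines,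
    applied to minorants smooth enough for these tests. *)

(** * Components and quasi-components of compact sets *)

(** Encoded by two closed sets of the ambient space instead of the subspace topology; for closed [Z]
    these are the relatively clopen neighbourhoods of [x], whose intersection is the
    quasi-component. *)
Definition relclopen (T : topologicalType) (Z : set T) (x : T) (K : set T) :=
  [/\ closed K, closed (Z `\` K), K `<=` Z & K x].

(** The sets [K] are stable under intersection, so if every [K] left [O], the sets [K] minus [O]
    would generate a proper filter. By compactness it has a cluster point, which lies in every [K]
    and outside [O]: a point of the quasi-component missed by [O]. *)
Lemma relclopen_sub_open (T : topologicalType) (Z O : set T) (x : T) :
  compact Z -> closed Z -> Z x -> open O ->
  (forall y, (forall K, relclopen Z x K -> K y) -> O y) ->
  exists2 K, relclopen Z x K & K `<=` O.
Proof.
move=> cZ clZ Zx oO QO; apply: contrapT => noK.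
have rZ : relclopen Z x Z by split=> //; rewrite setDv; exact: closed0.
pose F := filter_from (relclopen Z x) (fun K => K `\` O).
have FF : ProperFilter F.
  apply: filter_from_proper.
    apply: filter_from_filter; first by exists Z.
    move=> K L [cK cZK KZ Kx] [cL cZL LZ Lx]; exists (K `&` L).
      split=> //; first exact: closedI.
        by rewrite setDIr; exact: closedU.
      by move=> y [/KZ].
    by move=> y [[Ky Ly] nOy]; split; split.
  move=> K rK; apply: contrapT => K0; apply: noK; exists K => // y Ky.
  by apply: contrapT => nOy; apply: K0; exists y.
have [z [Zz clz]] : Z `&` cluster F !=set0.
  by apply: cZ; exists Z => // y [].
have zK K : relclopen Z x K -> (K `\` O) z.
  move=> rK; have cl : closed (K `\` O).
    by case: rK => cK _ _ _; apply: closedI => //; exact: open_closedC.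
  by apply: cl => B Bz; apply: clz => //; exists K.
have [_] := zK _ rZ.
by apply; apply: QO => K /zK[].
Qed.

(* In a compact set, components and quasi-components coincide. *)
Lemma component_relclopen (R : realType) (T : pseudoMetricType R)
    (Z D : set T) (x : T) :
  compact Z -> closed Z -> closed D -> Z x ->
  connected_component Z x `&` D = set0 ->
  exists2 K, relclopen Z x K & K `&` D = set0.
Proof.
move=> cZ clZ clD Zx CD.
pose Q := [set y | forall K, relclopen Z x K -> K y].
have rZ : relclopen Z x Z by split=> //; rewrite setDv; exact: closed0.
have clQ : closed Q.
  rewrite (_ : Q = \bigcap_(K in relclopen Z x) K) //.
  by apply: closed_bigI => K [].
have Qx : Q x by move=> K [].
(* A closed splitting of the quasi-component [Q] leaves nothing on the side away from [x]: after
   separating [A] and [B] by open sets [U] and [W] and shrinking [K] into their union, [K] minus [W]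
   is again relatively clopen, because its complement in [Z] is [(Z \ K)] together with [K \ U]. *)
have key A B : closed A -> closed B -> Q `<=` A `|` B -> A `&` B = set0 ->
    A x -> B `&` Q = set0.
  move=> cA cB QAB AB0 Ax.
  have [U [W [oU oW AU BW UW0]]] :=
    (@normal_openP R T).1 pseudometric_normal _ _ cA cB AB0.
  have [|K rK KUW] := relclopen_sub_open cZ clZ Zx (openU oU oW).
    by move=> y Qy; have /QAB[/AU|/BW] : Q y by []; [left|right].
  have [cK cZK KZ Kx] := rK.
  have rKU : relclopen Z x (K `\` W).
    split; [| |by move=> y [/KZ]|].
    - by apply: closedI => //; exact: open_closedC.
    - rewrite (_ : _ `\` _ = (Z `\` K) `|` (K `\` U)).
        apply: closedU => //; apply: closedI => //; exact: open_closedC.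
      apply/seteqP; split=> y.
        move=> [Zy KWy]; have [Ky|nKy] := pselect (K y); last by left.
        right; split=> // Uy; have [|Wy] := pselect (W y).
          by move=> Wy; have : (U `&` W) y by []; rewrite UW0.
        exact: KWy.
      move=> [[Zy nKy]|[Ky nUy]]; first by split=> // -[].
      by split; [exact: KZ|move=> [_]; apply; case: (KUW y Ky)].
    - split=> // Wx; have : (U `&` W) x by split=> //; exact: AU.
      by rewrite UW0.
  apply/seteqP; split=> // y [By /(_ _ rKU)[_]]; apply; exact: BW.
have conQ : connected Q.
  move=> B B0 [C oC BC] [C' cC' BC'].
  have clB : closed B by rewrite BC'; exact: closedI.
  have clQB : closed (Q `\` B).
    rewrite (_ : _ `\` _ = Q `\` C); first by apply: closedI => //; exact: open_closedC.
    rewrite BC; apply/seteqP; split=> y [Qy nB]; split=> //.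
      by move=> Cy; apply: nB.
    by move=> [].
  have BQ : B `<=` Q by rewrite BC => y [].
  have QU A : Q `<=` A `|` (Q `\` A).
    by move=> y Qy; have [|] := pselect (A y); [left|right].
  have [Bx|nBx] := pselect (B x).
    have e := key _ _ clB clQB (QU B) (setDIK _ _) Bx.
    apply/seteqP; split=> // y Qy; apply: contrapT => nBy.
    by have : ((Q `\` B) `&` Q) y by []; rewrite e.
  have e : B `&` Q = set0.
    apply: (key _ _ clQB clB) => //.
    - by rewrite setUC; exact: QU.
    - by rewrite setIC setDIK.
  case: B0 => y By; have : (B `&` Q) y by split=> //; exact: BQ.
  by rewrite e.
(* [Q] is connected and contains [x], hence lies in the component; so the complement of [D] is an
   open neighbourhood of the quasi-component. *)
have QD : Q `<=` ~` D.
  move=> y Qy Dy; have : (connected_component Z x `&` D) y.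
    split=> //; apply: (connected_component_max Qx _ conQ) => //.
    by move=> z /(_ _ rZ).
  by rewrite CD.
have [K rK KD] := relclopen_sub_open cZ clZ Zx (closed_openC clD) QD.
exists K => //; apply/seteqP; split=> // y [/KD] //.
Qed.

(** * One-variable minimum tests and differentiation rules *)

Lemma is_derive1_cvg (R : realType) (phi : R -> R) (t d : R) :
  is_derive t 1 phi d -> h^-1 * (phi (h + t) - phi t) @[h --> 0^'] --> d.
Proof.
move=> [D <-]; move: D; rewrite /derivable /derive.
rewrite (_ : (fun h : R => h^-1 *: _) = fun h => h^-1 * (phi (h + t) - phi t)) //.
by apply/funext => h; rewrite /= [_%:A]mulr1.
Qed.

(** Only earlier times are compared, because a minimum over a time cylinder may sit at its final
    time. *)
Lemma left_min_derive_le0 (R : realType) (phi : R -> R) (t d e : R) :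
  is_derive t 1 phi d -> 0 < e ->
  (forall s, t - e < s -> s <= t -> phi t <= phi s) -> d <= 0.
Proof.
move=> phid e0 H; have [dphi <-] := phid.
rewrite ['D_1 phi t]cvg_at_leftE; last exact: dphi.
apply: limr_le.
  rewrite -(cvg_at_leftE (fun h => h^-1 *: ((phi \o shift t) _ - phi t))) //.
  apply: cvg_trans dphi; apply: cvg_app.
  move=> A [r r0 Ae]; exists r => // x xe xgt0; apply: Ae => //.
  exact/ltr0_neq0.
near=> h; apply: mulr_le0_ge0.
  by rewrite invr_le0; apply: ltW; near: h; exists 1 => /=.
have h0 : h < 0 by near: h; exists 1 => /=.
have he : `|h| < e.
  near: h; by exists e => //= y; rewrite /ball_ /= sub0r normrN.
rewrite subr_ge0 [_%:A]mulr1 /=; apply: H; first by move: he; rewrite ltr_norml; lra.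
by rewrite gerDr ltW.
Unshelve. all: by end_near. Qed.

(** If [d] were negative, [dphi] would be negative just to the right of 0, where it starts from the
    value 0, and the mean value theorem would put [phi] below [phi 0]. *)
Lemma second_derive_min (R : realType) (phi dphi : R -> R) (d : R) :
  (\forall s \near (0 : R), is_derive (s : R) 1 phi (dphi s)) ->
  is_derive (0 : R) 1 dphi d -> (\forall s \near (0 : R), phi 0 <= phi s) ->
  dphi 0 = 0 /\ 0 <= d.
Proof.
move=> D1 D2 M.
have [r r0 rH] : exists2 r : R, 0 < r & forall s : R, `|s| < r ->
    is_derive s 1 phi (dphi s) /\ phi 0 <= phi s.
  have [r r0 H] : nbhs (0 : R) [set s : R | is_derive s 1 phi (dphi s) /\ phi 0 <= phi s].
    by apply: filterI.
  by exists r => // s sr; apply: H; rewrite /ball_ /= sub0r normrN.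
have phi'0 : dphi 0 = 0.
  have := @derive1_at_min R phi (- (r/2)) (r/2) 0.
  have bd t : t \in `](- (r / 2)), (r / 2)[%R -> `|t| < r.
    by rewrite in_itv /= ltr_norml => /andP[? ?]; apply/andP; split; lra.
  case=> //.
  - lra.
  - by move=> t /bd /rH[[]].
  - by rewrite in_itv /=; apply/andP; split; lra.
  - by move=> t /bd /rH[].
  - move=> _ E; have [|[_ <-] _] := rH 0; first by rewrite normr0.
    exact: E.
split=> //; rewrite leNgt; apply/negP => d0.
have := is_derive1_cvg D2.
move=> /cvgr_lt/(_ 0 d0)[e /= e0 eH].
pose h := Num.min e r / 2.
have h0 : 0 < h by rewrite divr_gt0 // lt_min e0 r0.
have hle : h < e /\ h < r.
  have : Num.min e r <= e by rewrite ge_min lexx.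
  have : Num.min e r <= r by rewrite ge_min lexx orbT.
  rewrite /h; move: h0; rewrite /h; lra.
case: hle => he hr.
have cwt : {within `[0, h], continuous phi}.
  apply: derivable_within_continuous => s; rewrite in_itv /= => /andP[s0 sh].
  by have [|[? _] _] := rH s; rewrite // ger0_norm //; lra.
have [s|c] := @MVT R phi dphi 0 h h0 _ cwt.
  rewrite in_itv /= => /andP[s0 sh].
  by have [|] := rH s; rewrite // gtr0_norm //; lra.
rewrite in_itv /= => /andP[c0 ch] E.
have := eH c; rewrite /ball_ /= sub0r normrN gtr0_norm // addr0 phi'0 subr0.
move=> /(_ ltac:(lra) ltac:(by rewrite gt_eqF)).
rewrite pmulr_rlt0 ?invr_gt0 // => dc.
have [|_ phih] := rH h; first by rewrite gtr0_norm //; lra.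
have : dphi c * (h - 0) < 0 by rewrite subr0 nmulr_rlt0.
by rewrite -E subr_lt0 ltNge phih.
Unshelve. all: by end_near. Qed.

Section RealDerivatives.
Context {R : realType}.
Implicit Types (f g : R -> R) (x df dg : R).

Lemma is_derive1_add f g x df dg : is_derive x 1 f df -> is_derive x 1 g dg ->
  is_derive x 1 (fun s => f s + g s) (df + dg).
Proof. by move=> Df Dg; exact: is_deriveD. Qed.

Lemma is_derive1_sub f g x df dg : is_derive x 1 f df -> is_derive x 1 g dg ->
  is_derive x 1 (fun s => f s - g s) (df - dg).
Proof. by move=> Df Dg; exact: is_deriveB. Qed.

Lemma is_derive1_mul f g x df dg : is_derive x 1 f df -> is_derive x 1 g dg ->
  is_derive x 1 (fun s => f s * g s) (df * g x + f x * dg).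
Proof.
move=> Df Dg; have := is_deriveM Df Dg; rewrite /GRing.scale /=.
by rewrite addrC (mulrC (g x)).
Qed.

Lemma is_derive1_cmul (c : R) f x df : is_derive x 1 f df ->
  is_derive x 1 (fun s => c * f s) (c * df).
Proof.
move=> Df; have := is_derive1_mul (is_derive_cst c x 1) Df.
by rewrite mul0r add0r.
Qed.

Lemma is_derive1_quad (a b c x : R) :
  is_derive x 1 (fun s => a + b * s + c * s ^+ 2) (b + 2 * c * x).
Proof.
have D := is_derive1_add (is_derive1_add (is_derive_cst a x 1)
  (is_derive1_cmul b (is_derive_id x 1)))
  (is_derive1_cmul c (is_derive1_mul (is_derive_id x 1) (is_derive_id x 1))).
apply: is_derive_eq (D) _ => /=; ring.
Qed.

Lemma is_derive1_powR_comp (q : R) f x df : is_derive x 1 f df -> 0 < f x ->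
  is_derive x 1 (fun s => f s `^ q) (q * f x `^ (q - 1) * df).
Proof.
move=> Df f0; have Dp := is_derive1_powR q f0.
have Dfd : derivable f x 1 by case: Df.
pose g (y : R) : R := y `^ q.
have Dpd : derivable g (f x) 1 by case: Dp.
have dc : derivable (g \o f) x 1.
  by apply/derivable1_diffP; apply: differentiable_comp;
     exact/derivable1_diffP.
apply: DeriveDef => //.
have := derive1_comp Dfd Dpd; rewrite !derive1E => ->.
by case: Df => _ ->; case: Dp => _ ->.
Qed.

End RealDerivatives.

(** * Squared Euclidean distance and coordinate lines *)

(** The square of [enorm]: a polynomial in the coordinates, so barriers and cut-offs built from it
    are quadratic along coordinate lines. Every radius below is therefore a squared radius. *)
Definition esq (R : realType) (n : nat) (x : 'rV[R]_n) : R :=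
  \sum_(i < n) x 0 i ^+ 2.

Section CoordinateLines.
Context {R : realType} {n : nat}.
Implicit Types (x y : 'rV[R]_n) (i : 'I_n).

(** The laplacian is a sum of pure second partials, so second-derivative tests are run separately on
    each of these lines. *)
Definition line x i (s : R) : 'rV[R]_n := s *: delta_mx 0 i + x.

Lemma line0 x i : line x i 0 = x.
Proof. by rewrite /line scale0r add0r. Qed.

Lemma is_derive_line (g : 'rV[R]_n -> R) x i (s : R) :
  derivable g (line x i s) (delta_mx 0 i) ->
  is_derive s 1 (fun h => g (line x i h)) (partial i g (line x i s)).
Proof.
move=> D; rewrite /partial.
have E : (fun h : R => h^-1 *: (((fun h => g (line x i h)) \o shift s) (h *: 1)
     - g (line x i s))) =
   (fun h => h^-1 *: ((g \o shift (line x i s)) (h *: delta_mx 0 i)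
     - g (line x i s))).
  apply/funext => h /=; congr (_ *: (g _ - _)).
  by rewrite /line [_%:A]mulr1 scalerDl addrA.
by split; rewrite /derivable /derive E.
Qed.

Lemma cvg_line x i : line x i s @[s --> (0 : R)] --> x.
Proof.
rewrite -[X in _ --> X](line0 x i).
have : continuous (line x i).
  move=> s; apply: cvgD; last exact: cvg_cst.
  by apply: cvgZl; exact: cvg_id.
exact.
Qed.

Lemma near_line (P : set 'rV[R]_n) x i :
  nbhs x P -> \forall s \near (0 : R), P (line x i s).
Proof. by move=> /cvg_line; exact. Qed.

Lemma esq_ge0 x : 0 <= esq x.
Proof. by apply: sumr_ge0 => i _; exact: sqr_ge0. Qed.

Lemma esq_subrr x : esq (x - x) = 0.
Proof. by rewrite subrr /esq big1 // => i _; rewrite mxE expr0n. Qed.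

Lemma esq_line x y i (s : R) :
  esq (line x i s - y) = esq (x - y) + 2 * (x - y) 0 i * s + s ^+ 2.
Proof.
rewrite /esq (bigD1 i) //= [in RHS](bigD1 i) //=.
rewrite (eq_bigr (fun j => (x - y) 0 j ^+ 2)); last first.
  move=> j ji; rewrite /line !mxE eqxx /= (negbTE ji) mulr0 add0r //.
rewrite /line !mxE !eqxx /=; ring.
Qed.

Lemma coord_sq_le_esq x i : x 0 i ^+ 2 <= esq x.
Proof.
rewrite /esq (bigD1 i) //= lerDl; apply: sumr_ge0 => j _; exact: sqr_ge0.
Qed.

Lemma norm_sq_le_esq x : `|x| ^+ 2 <= esq x.
Proof.
have [e|/mx_norm_neq0 [[a i] /= e]] := eqVneq (mx_norm x) 0.
  by rewrite [`|x|]e expr0n esq_ge0.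
by rewrite [`|x|]e ord1 real_normK ?num_real // coord_sq_le_esq.
Qed.

Lemma norm_coord_le x i : `|x 0 i| <= `|x|.
Proof.
rewrite [leRHS]/Num.Def.normr /= mx_normrE.
exact: (le_bigmax _ (fun ij => `|x ij.1 ij.2|) (ord0, i)).
Qed.

Lemma esq_le_norm x : esq x <= n%:R * `|x| ^+ 2.
Proof.
apply: (@le_trans _ _ (\sum_(i < n) `|x| ^+ 2)).
  apply: ler_sum => i _; rewrite -real_normK ?num_real //.
  by rewrite lerXn2r ?nnegrE // norm_coord_le.
by rewrite sumr_const card_ord mulr_natl.
Qed.

Lemma continuous_esq : continuous (@esq R n).
Proof.
apply: continuous_big => [z|i _ x]; first exact: add_continuous.
have -> : (fun y : 'rV[R]_n => y 0 i ^+ 2) = (fun y => y 0 i * y 0 i).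
  by apply/funext => y; rewrite expr2.
have cx : {for x, continuous (fun y : 'rV[R]_n => y 0 i)}.
  exact: coord_continuous.
exact: (continuousM cx cx).
Qed.

End CoordinateLines.

Lemma open_prod (U V : topologicalType) (A : set U) (B : set V) :
  open A -> open B -> open (A `*` B).
Proof.
move=> oA oB; rewrite openE => -[a b] [/= Aa Bb].
by exists (A, B) => //; split; apply: open_nbhs_nbhs.
Qed.

(** * Derivatives and continuity of a classical solution *)

Section Solution.
Context {R : realType} {n : nat} {T : R} {Omega : set 'rV[R]_n}
  {u : R -> 'rV[R]_n -> R} (oO : open Omega) (uC : C12 T Omega u).
Implicit Types (t : R) (x : 'rV[R]_n) (i : 'I_n).

Lemma solution_dt t x : 0 < t < T -> Omega x ->
  is_derive t 1 (u ^~ x) (time_deriv u t x).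
Proof.
move=> tT Ox; case: uC => /(_ t x tT Ox)[D _ _] _ _ _ _.
by rewrite /time_deriv derive1E; exact: derivableP.
Qed.

Lemma solution_dx t x i : 0 < t < T -> Omega x ->
  \forall s \near (0 : R), is_derive (s : R) 1 (fun h => u t (line x i h))
    (partial i (u t) (line x i s)).
Proof.
move=> tT Ox; have : \forall s \near (0 : R), Omega (line x i s).
  by apply: near_line; exact: open_nbhs_nbhs.
apply: filterS => s Os; apply: is_derive_line.
by case: uC => /(_ t _ tT Os)[_ D _] _ _ _ _.
Qed.

Lemma solution_dxx t x i : 0 < t < T -> Omega x ->
  is_derive (0 : R) 1 (fun s => partial i (u t) (line x i s))
    (partial i (partial i (u t)) x).
Proof.
move=> tT Ox; rewrite -[X in partial i _ X](line0 x i).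
apply: is_derive_line; rewrite line0.
by case: uC => /(_ t _ tT Ox)[_ _ D] _ _ _ _.
Qed.

Lemma cylinder_continuous (w : R -> 'rV[R]_n -> R) t x :
  continuous_cylinder T Omega w -> 0 < t < T -> Omega x ->
  {for (t, x), continuous (fun z : R * 'rV[R]_n => w z.1 z.2)}.
Proof.
move=> wc tT Ox; move: wc; rewrite /continuous_cylinder.
rewrite continuous_open_subspace.
  by apply; rewrite inE; split=> //=; rewrite in_itv.
by apply: open_prod => //; exact: interval_open.
Qed.

Lemma solution_continuous t x : 0 < t < T -> Omega x ->
  {for (t, x), continuous (fun z : R * 'rV[R]_n => u z.1 z.2)}.
Proof. by case: uC => _ uc _ _ _; exact: cylinder_continuous. Qed.

Lemma solution_dt_continuous t x : 0 < t < T -> Omega x ->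
  {for (t, x), continuous (fun z : R * 'rV[R]_n => time_deriv u z.1 z.2)}.
Proof. by case: uC => _ _ uc _ _; exact: cylinder_continuous. Qed.

End Solution.

(** * Convexity, growth and superlinearity of the nonlinearity *)

(** The chord of x^p over [lam, 1] has slope at least p lam^(p-1), which exceeds q once lam^(p-1) >
    q/p; [mu] is the midpoint of q/p and 1. This bound for a fixed [lam] < 1 replaces asymptotics of
    f', on which only f itself gives information. *)
Lemma powR_chord_slope (R : realType) (p q : R) : 1 < p -> 0 < q < p ->
  exists2 lam : R, 0 < lam < 1 & q * (1 - lam) <= 1 - lam `^ p.
Proof.
move=> p1 /andP[q0 qp]; pose mu := (q / p + 1) / 2.
have qp1 : 0 < q / p < 1.
  by rewrite divr_gt0 /=; [rewrite ltr_pdivrMr; lra|lra|lra].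
have mu0 : 0 < mu < 1 by rewrite /mu; apply/andP; split; lra.
pose lam := mu `^ (p - 1)^-1.
have lE : lam `^ (p - 1) = mu.
  by rewrite /lam -powRrM mulVf ?powRr1 //; [lra|rewrite gt_eqF; lra].
have lam0 : 0 < lam by rewrite powR_gt0; case/andP: mu0.
have lam1 : lam < 1.
  rewrite ltNge; apply/negP => l1.
  have : 1 `^ (p - 1) <= lam `^ (p - 1).
    by apply: ge0_ler_powR; rewrite ?nnegrE; lra.
  by rewrite lE powR1; lra.
exists lam; first by rewrite lam0.
have cwt : {within `[lam, 1], continuous (fun x => x `^ p)}.
  apply: derivable_within_continuous => x; rewrite in_itv /= => /andP[x0 _].
  by apply: derivable_powR; rewrite in_itv /= andbT; lra.
have [|x] := @MVT R (fun x => x `^ p) (fun x => p * x `^ (p - 1)) lam 1 lam1 _ cwt.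
  by move=> x; rewrite in_itv /= => /andP[x0 _]; apply: is_derive1_powR; lra.
rewrite in_itv /= => /andP[lx x1]; rewrite powR1 => ->.
rewrite ler_wpM2r //; first lra.
have : lam `^ (p - 1) <= x `^ (p - 1).
  by apply: ge0_ler_powR; rewrite ?nnegrE; lra.
rewrite lE => mux; have : q / p < x `^ (p - 1) by rewrite /mu in mux; lra.
by rewrite ltr_pdivrMr; lra.
Qed.

(** Here [P], [L], [fs], [fls], [g] stand for s^p, lam^p, f(s), f(lam s), f'(s). The tangent at s,
    read at lam s, bounds (1 - lam) s f'(s) below by f(s) - f(lam s), and [eta] is tuned so that the
    asymptotic errors cost half of the gap q' - q. *)
Lemma superlinear_alg (R : realType) (lam L P q q' eta fs fls g s : R) :
  0 < lam < 1 -> 0 <= L -> 0 < P -> 0 < q < q' ->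
  q' * (1 - lam) <= 1 - L -> 0 < eta ->
  eta * (2 + q) = (1 - lam) * (q' - q) / 2 ->
  (1 - eta) * P <= fs -> fs <= (1 + eta) * P -> fls <= (1 + eta) * (L * P) ->
  fs + g * (lam * s - s) <= fls ->
  (q' - q) / 2 * P <= s * g - q * fs.
Proof.
move=> /andP[l0 l1] L0 P0 /andP[q0 qq'] lamH e0 eE B1 B2 B3 TL.
pose D := 1 - lam; have D0 : 0 < D by rewrite /D; lra.
have q'D : 0 < q' * D by apply: mulr_gt0; lra.
have L1 : L <= 1 by rewrite /D in q'D; lra.
have K1 : ((1 - eta) - (1 + eta) * L) * P <= D * (s * g) by rewrite /D; lra.
have K2 : D * (q * fs) <= D * q * (1 + eta) * P.
  by rewrite -!mulrA !ler_pM2l.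
have K3 : D * ((q' - q) / 2) * P <=
    ((1 - eta) - (1 + eta) * L - D * q * (1 + eta)) * P.
  rewrite ler_pM2r //.
  have : eta * L <= eta by rewrite ler_piMr // ltW.
  have : D * (q * eta) <= q * eta.
    by rewrite ler_piMl // ?mulr_ge0 ?ltW // /D; lra.
  move: lamH; rewrite -/D in eE *; lra.
rewrite -(ler_pM2l D0); lra.
Qed.

Section Nonlinearity.
Context {R : realType} {p : R} {f : R -> R}.
Hypotheses (p1 : 1 < p) (f_ge0 : forall s : R, 0 <= s -> 0 <= f s)
  (fD : forall s : R, 0 <= s -> derivable_nneg f s)
  (f_convex : @convex_function R R^o `[0, +oo[%classic f)
  (f_asymp : s `^ (- p) * f s @[s --> +oo] --> (1 : R))
  (f'_growth : exists C : R, 0 < C /\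
       forall s : R, 0 <= s -> `|derive_nneg f s| <= C * (1 + s `^ (p - 1))).
Implicit Types a b s : R.

Lemma convex_chord a b s : 0 <= a -> 0 <= b -> 0 <= s <= 1 ->
  f (a + s * (b - a)) <= f a + s * (f b - f a).
Proof.
move=> a0 b0 /andP[s0 s1].
have := @f_convex (Itv01 s0 s1) b a.
rewrite !inE /= !in_itv /= !andbT => /(_ b0 a0).
move=> H; have {H} : f (s * b + (1 - s) * a) <= s * f b + (1 - s) * f a.
  exact: H.
have -> : s * b + (1 - s) * a = a + s * (b - a) by ring.
by have -> : s * f b + (1 - s) * f a = f a + s * (f b - f a) by ring.
Qed.

Lemma dquot_near a (P : set R) : 0 <= a ->
  nbhs (derive_nneg f a) P ->
  exists2 e : R, 0 < e & forall y, 0 <= y -> y != a -> `|y - a| < e ->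
    P (dquot f a y).
Proof.
move=> a0 /(fD a0) [e /= e0 H]; exists e => // y y0 ya yae.
by apply: H => //=; rewrite ?in_itv /= ?andbT // distrC.
Qed.

(** Were the chord slope [m] on the wrong side of the derivative, so would [m] be for difference
    quotients at points of the segment close to [a], against convexity. The parameter [t] keeps the
    point on the segment and within [e / 2] of [a], so the right derivative at 0 is covered too. *)
Lemma tangent_le a b : 0 <= a -> 0 <= b ->
  f a + derive_nneg f a * (b - a) <= f b.
Proof.
move=> a0 b0; rewrite leNgt; apply/negP => H.
have ba : b - a != 0.
  by apply/eqP => ba0; move: H; rewrite ba0 mulr0 (subr0_eq ba0); lra.
pose m := (f b - f a) / (b - a).
have mE : f b - f a = m * (b - a) by rewrite /m divfK.
have [ba0|ab0] : (0 < b - a) \/ (b - a < 0).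
  by move: ba; rewrite neq_lt => /orP[]; [right|left].
- have fm : m < derive_nneg f a by rewrite -(ltr_pM2r ba0); lra.
  have [|e e0 eH] := @dquot_near a [set z | m < z] a0.
    exact: lt_nbhsr.
  pose t := Num.min 1 (e / 2 / (b - a)).
  have t0 : 0 < t by rewrite lt_min ltr01 !divr_gt0.
  have t1 : t <= 1 by rewrite ge_min lexx.
  have te : t * (b - a) <= e / 2.
    by rewrite -ler_pdivlMr // ge_min lexx orbT.
  have tba : 0 < t * (b - a) by exact: mulr_gt0.
  have := eH (a + t * (b - a)); rewrite /dquot /= addrAC subrr add0r.
  rewrite ltr_pdivlMr // ltNge => /(_ _ _ _)/negP; apply.
  + lra.
  + by rewrite gt_eqF //; lra.
  + by rewrite gtr0_norm //; lra.
  + have := convex_chord a0 b0 (_ : 0 <= t <= 1); rewrite mE ltW ?t1 // => /(_ isT).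
    by rewrite mulrCA; lra.
- have fm : derive_nneg f a < m by rewrite -(ltr_nM2r ab0); lra.
  have [|e e0 eH] := @dquot_near a [set z | z < m] a0.
    exact: lt_nbhsl.
  pose t := Num.min 1 (e / 2 / (a - b)).
  have ab0' : 0 < a - b by lra.
  have t0 : 0 < t by rewrite lt_min ltr01 !divr_gt0.
  have t1 : t <= 1 by rewrite ge_min lexx.
  have te : t * (a - b) <= e / 2.
    by rewrite -ler_pdivlMr // ge_min lexx orbT.
  have tba : 0 < t * (a - b) by exact: mulr_gt0.
  have tba' : t * (b - a) < 0 by rewrite pmulr_rlt0.
  have tab : t * (a - b) <= a - b by rewrite ler_piMl // ltW.
  have := eH (a + t * (b - a)); rewrite /dquot /= addrAC subrr add0r.
  rewrite ltr_ndivrMr // ltNge => /(_ _ _ _)/negP; apply.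
  + lra.
  + by rewrite lt_eqF //; lra.
  + by rewrite ltr0_norm //; lra.
  + have := convex_chord a0 b0 (_ : 0 <= t <= 1); rewrite mE ltW ?t1 // => /(_ isT).
    by rewrite mulrCA; lra.
Qed.

Lemma derive_nneg_mono a b : 0 <= a -> a <= b ->
  derive_nneg f a <= derive_nneg f b.
Proof.
move=> a0 ab; have [->//|neq] := eqVneq a b.
have {}ab : 0 < b - a by rewrite subr_gt0 lt_neqAle neq.
rewrite -(ler_pM2r ab).
have := tangent_le a0 (_ : 0 <= b); have := tangent_le (_ : 0 <= b) a0.
have b0 : 0 <= b by lra.
by move=> /(_ b0) + /(_ b0); lra.
Qed.

(** The lower bound on f' comes from its monotonicity and its value at 0; the bound on f from the
    tangent at s read at 0. Powers of 1 + s avoid degeneracy at s = 0. *)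
Lemma nonlinearity_growth : exists2 C : R, 0 < C & forall s, 0 <= s ->
  [/\ - C <= derive_nneg f s, `|derive_nneg f s| <= C * (1 + s) `^ (p - 1) &
      f s <= C * (1 + s) `^ p].
Proof.
have p1' := p1; have [C [C0 CH]] := f'_growth.
have v1 s : 0 <= s -> 1 <= (1 + s) `^ (p - 1).
  move=> s0; rewrite -[leLHS](powRr0 (1 + s)); apply: ler_powR.
    lra.
  lra.
have H s : 0 <= s -> `|derive_nneg f s| <= 2 * C * (1 + s) `^ (p - 1).
  move=> s0; apply: (le_trans (CH _ s0)).
  have : s `^ (p - 1) <= (1 + s) `^ (p - 1).
    by apply: ge0_ler_powR; rewrite ?nnegrE; lra.
  have := v1 _ s0.
  rewrite (mulrC 2) -mulrA ler_pM2l //; lra.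
exists (2 * C + f 0) => [|s s0]; first by have := f_ge0 (lexx 0); lra.
have f00 := f_ge0 (lexx 0).
split.
- have := derive_nneg_mono (lexx 0) s0; have := H 0 (lexx 0).
  by rewrite addr0 powR1 mulr1 ler_norml => /andP[]; lra.
- by apply: (le_trans (H _ s0)); rewrite ler_wpM2r ?powR_ge0 //; lra.
- rewrite -[_ `^ p]mulr_powRB1; [|lra|lra].
  have := tangent_le s0 (lexx 0).
  have := H _ s0; rewrite ler_norml => /andP[_ Hs].
  have w1 := v1 _ s0; move: (_ `^ _) w1 Hs => w w1 Hs.
  have : derive_nneg f s * s <= 2 * C * w * s by rewrite ler_wpM2r.
  have : f 0 * 1 <= f 0 * ((1 + s) * w) by rewrite ler_wpM2l //; nra.
  have : 0 <= C * w by nra.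
  nra.
Qed.

Lemma nonlinearity_asymp (eta : R) : 0 < eta -> exists2 S : R, 1 <= S &
  forall s, S <= s -> (1 - eta) * s `^ p <= f s <= (1 + eta) * s `^ p.
Proof.
move=> e0; have /cvgrPdist_le/(_ _ e0)[M [Mr MH]] := f_asymp.
exists (Num.max 1 (M + 1)); first by rewrite le_max lexx.
move=> s; rewrite ge_max => /andP[s1 Ms].
have := MH s ltac:(lra).
have sp : 0 < s `^ p by rewrite powR_gt0; lra.
rewrite powRN mulrC distrC ler_norml => /andP[h1 h2].
by apply/andP; split; [rewrite -ler_pdivlMr //|rewrite -ler_pdivrMr //]; lra.
Qed.

(** The quantitative form of superlinearity that pays for the cut-off. For large s it is
    [superlinear_alg] with q' midway between q and p; for bounded s all terms are bounded and go
    into [C]. *)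
Lemma nonlinearity_superlinear (q : R) : 0 < q < p ->
  exists c C : R, [/\ 0 < c, 0 <= C & forall s, 0 <= s ->
    c * (1 + s) `^ p - C <= (1 + s) * derive_nneg f s - q * f s].
Proof.
have p1' := p1; move=> /andP[q0 qp]; pose q' := (p + q) / 2.
have qq' : 0 < q < q' by rewrite /q'; lra.
have [|lam l01 lamH] := @powR_chord_slope R p q' p1.
  by rewrite /q'; lra.
have q'q : 0 < q' - q by lra.
move: q' qq' q'q lamH => q' qq' q'q lamH; case/andP: (l01) => l0 l1.
have [eta e0 eE] : exists2 eta, 0 < eta &
    eta * (2 + q) = (1 - lam) * (q' - q) / 2.
  exists ((1 - lam) * (q' - q) / (2 * (2 + q))).
    by rewrite divr_gt0 ?mulr_gt0 //; lra.
  by field; rewrite gt_eqF; lra.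
have [S S1 SH] := nonlinearity_asymp e0.
have [C C0 CH] := nonlinearity_growth.
have [S' SS' S'H] : exists2 S', S <= S' & forall s, S' < s -> S <= lam * s.
  exists (S / lam); first by rewrite ler_pdivlMr // ler_piMr; lra.
  by move=> s; rewrite ltr_pdivrMr // mulrC => /ltW.
have p2 : 0 < 2 `^ p :> R by rewrite powR_gt0.
(* The factor 2^p pays for replacing s by 1 + s, as 1 + s <= 2 s for s >= 1. *)
have [c c_gt0 cE] : exists2 c, 0 < c & c * 2 `^ p = (q' - q) / 2.
  exists ((q' - q) / 2 / 2 `^ p); first by rewrite !divr_gt0.
  by rewrite divfK // gt_eqF.
have [M M0 MH] : exists2 M, 0 <= M & forall s, 0 <= s -> s <= S' -> (1 + s) `^ p <= M.
  exists ((1 + S') `^ p); first exact: powR_ge0.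
  by move=> s s0 sS; apply: ge0_ler_powR; rewrite ?nnegrE; lra.
have CS : 0 <= C * (1 + S') by apply: mulr_ge0; lra.
have qCM : 0 <= q * (C * M) by apply: mulr_ge0; [lra|apply: mulr_ge0; lra].
have cM : 0 <= c * M by apply: mulr_ge0; lra.
exists c, (c * M + C * (1 + S') + q * (C * M)); split; [by []|lra|].
move=> s s0; have [CH1 _ CH3] := CH s s0.
have [sS'|S's] := leP s S'.
  have vM := MH s s0 sS'.
  have H1 : c * (1 + s) `^ p <= c * M by rewrite ler_pM2l.
  have H2 : q * f s <= q * (C * M).
    by rewrite ler_pM2l // (le_trans CH3) // ler_pM2l.
  have H3 : - (C * (1 + S')) <= (1 + s) * derive_nneg f s.
    apply: (@le_trans _ _ (- (C * (1 + s)))); first by rewrite lerN2 ler_pM2l // lerD2l.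
    by rewrite -mulNr mulrC; apply: ler_wpM2l => //; apply: addr_ge0.
  lra.
have s1 : 1 <= s by apply: (le_trans S1); apply: (le_trans SS'); exact: ltW.
have ls := S'H s S's.
have /andP[B1 B2] := SH s (le_trans SS' (ltW S's)).
have /andP[_ B3] := SH _ ls.
rewrite (powRM _ (ltW l0) s0) in B3.
have TL := tangent_le s0 (mulr_ge0 (ltW l0) s0).
have vs : (1 + s) `^ p <= 2 `^ p * s `^ p.
  rewrite -powRM //; apply: ge0_ler_powR; rewrite ?nnegrE.
  - exact: ltW (lt_trans ltr01 p1).
  - exact: addr_ge0.
  - exact: mulr_ge0.
  - by rewrite mulr_natl mulr2n lerD2r.
have E1 : c * (1 + s) `^ p <= (q' - q) / 2 * s `^ p.
  by rewrite -cE -mulrA ler_pM2l.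
have sp : 0 < s `^ p by apply: powR_gt0; exact: lt_le_trans s1.
have lp : 0 <= lam `^ p by exact: powR_ge0.
have := superlinear_alg l01 lp sp qq' lamH e0 eE B1 B2 B3 TL.
clear - E1 CS qCM cM CH1 s0 C0 S1 SS' S's; move=> K.
have : - C <= derive_nneg f s * 1 by rewrite mulr1.
have : C * 1 <= C * (1 + S') by rewrite ler_pM2l // lerDl; lra.
lra.
Qed.

(** The values of f at negative arguments are arbitrary, so f is first extended by f(0). Tangents at
    both points, with f' locally bounded, give a local Lipschitz estimate. *)
Lemma nonlinearity_continuous : continuous (fun s => f (Num.max s 0)).
Proof.
have p1' := p1; move=> s; have [C C0 CH] := nonlinearity_growth.
pose M := Num.max s 0 + 1; pose K := C * (1 + M) `^ (p - 1).
have m0 : 0 <= Num.max s 0 by rewrite le_max lexx orbT.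
have K0 : 0 < K by rewrite mulr_gt0 // powR_gt0 /M; lra.
have KH a : 0 <= a -> a <= M -> `|derive_nneg f a| <= K.
  move=> a0 aM; have [_ H _] := CH a a0; apply: (le_trans H).
  rewrite /K ler_pM2l //; apply: ge0_ler_powR; rewrite ?nnegrE; lra.
have lip a b : 0 <= a -> a <= M -> 0 <= b -> b <= M -> f b - f a <= K * `|b - a|.
  move=> a0 aM b0 bM; have := tangent_le b0 a0.
  have : derive_nneg f b * (b - a) <= K * `|b - a|.
    apply: (le_trans (ler_norm _)); rewrite normrM.
    by rewrite ler_wpM2r // KH.
  lra.
apply/cvgrPdist_le => /= e e0.
near=> y.
have ye : `|s - y| <= e / K by near: y; apply: cvgr_dist_le; rewrite ?divr_gt0.
have y1 : `|s - y| <= 1 by near: y; apply: cvgr_dist_le.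
have ym : `|Num.max s 0 - Num.max y 0| <= `|s - y|.
  have n1 := ler_norm (s - y); have n2 := ler_norm (- (s - y)).
  rewrite normrN in n2; move: n1 n2; clear; move: (`|_|) => d n1 n2.
  by rewrite ler_norml !maxEle; case: (leP s 0) => ?; case: (leP y 0) => ?;
    apply/andP; split; lra.
have y0 : 0 <= Num.max y 0 by rewrite le_max lexx orbT.
have yM : Num.max y 0 <= M by have := le_trans ym y1; rewrite ler_norml /M => /andP[]; lra.
have yK : K * `|Num.max s 0 - Num.max y 0| <= e.
  by rewrite mulrC -ler_pdivlMr // (le_trans ym).
have sM : Num.max s 0 <= M by rewrite /M; lra.
have L1 := lip _ _ y0 yM m0 sM; have L2 := lip _ _ m0 sM y0 yM.
rewrite distrC in L2; rewrite ler_norml; apply/andP; split; lra.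
Unshelve. all: by end_near. Qed.

End Nonlinearity.

Lemma is_derive1_shift (R : realType) (g : R -> R) (t tau d : R) :
  is_derive (t + tau) 1 g d -> is_derive t 1 (fun s => g (s + tau)) d.
Proof.
move=> [D E].
have e : (fun h : R => h^-1 *: (((fun s => g (s + tau)) \o shift t) (h *: 1)
    - g (t + tau))) =
  (fun h : R => h^-1 *: ((g \o shift (t + tau)) (h *: 1) - g (t + tau))).
  by apply/funext => h /=; rewrite addrA.
by split; rewrite /derivable /derive e.
Qed.

Section EuclideanBalls.
Context {R : realType} {n : nat}.
Implicit Types (x y : 'rV[R]_n) (b : R).

Lemma continuous_esq_sub x : continuous (fun y : 'rV[R]_n => esq (y - x)).
Proof.
move=> y; apply: (@continuous_comp _ _ _ (fun y => y - x) (@esq R n)).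
  by apply: (@continuousB R _ 'rV[R]_n id (cst x)); [exact: cvg_id|exact: cst_continuous].
exact: continuous_esq.
Qed.

Lemma compact_esq_ball x b : compact [set y : 'rV[R]_n | esq (y - x) <= b].
Proof.
apply: bounded_closed_compact.
  exists (`|x| + (1 + `|b|)); split=> [|M bM y /= yb]; first exact: num_real.
  apply: le_trans (ltW bM).
  rewrite -[y](subrK x) addrC (le_trans (ler_normD _ _)) // lerD2l.
  have := le_trans (norm_sq_le_esq (y - x)) (le_trans yb (ler_norm b)).
  have := normr_ge0 b; have := normr_ge0 (y - x).
  move: (`|_|) (`|_|) => d c d0 c0; rewrite expr2 => dc.
  by rewrite leNgt; apply/negP => H; nra.
rewrite (_ : mkset _ = (fun y => esq (y - x)) @^-1` [set z | z <= b]) //.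
apply: closed_comp => [y _|]; last exact: closed_le.
exact: continuous_esq_sub.
Qed.

Lemma nbhs_esq_ball x y b : esq (y - x) < b ->
  nbhs y [set z | esq (z - x) < b].
Proof.
by move=> yb; have /cvgr_lt := @continuous_esq_sub x y; exact.
Qed.

End EuclideanBalls.

(** * Time difference quotients as supersolutions *)

Definition tquot (R : realType) (n : nat) (u : R -> 'rV[R]_n -> R) (tau t : R)
    (x : 'rV[R]_n) : R :=
  (u (t + tau) x - u t x) / tau.

Section DifferenceQuotient.
Context {R : realType} {n : nat} {T : R} {Omega : set 'rV[R]_n}
  {V : 'rV[R]_n -> R} {f fp : R -> R} {u : R -> 'rV[R]_n -> R}.
Hypotheses (oO : open Omega) (V_ge0 : forall x, Omega x -> 0 <= V x)
  (f_tangent : forall a b, 0 <= a -> 0 <= b -> f a + fp a * (b - a) <= f b)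
  (u_sol : classical_solution T Omega V f u)
  (u_ge0 : forall (t : R) x, 0 < t < T -> Omega x -> 0 <= u t x)
  (ut_ge0 : forall (t : R) x, 0 < t < T -> Omega x -> 0 <= time_deriv u t x).
Implicit Types (t tau : R) (x : 'rV[R]_n) (i : 'I_n).

Let uC : C12 T Omega u. Proof. by case: u_sol. Qed.

Lemma solution_mvt t1 t2 x : 0 < t1 -> t1 < t2 -> t2 < T -> Omega x ->
  exists2 s, t1 < s < t2 & u t2 x - u t1 x = time_deriv u s x * (t2 - t1).
Proof.
move=> t10 t12 t2T Ox.
have D s : s \in `[t1, t2] -> is_derive s 1 (u ^~ x) (time_deriv u s x).
  rewrite in_itv /= => /andP[s1 s2]; apply: (solution_dt uC) => //.
  by apply/andP; split; lra.
have cwt : {within `[t1, t2], continuous (u ^~ x)}.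
  by apply: derivable_within_continuous => s /D[].
have D' s : s \in `]t1, t2[ -> is_derive s 1 (u ^~ x) (time_deriv u s x).
  by move=> st; apply: D; exact: subset_itv_oo_cc st.
have [s st E] := MVT t12 D' cwt.
by exists s => //; move: st; rewrite in_itv.
Qed.

Lemma solution_nondecreasing t1 t2 x : 0 < t1 -> t1 <= t2 -> t2 < T ->
  Omega x -> u t1 x <= u t2 x.
Proof.
move=> t10; rewrite le_eqVlt => /predU1P[->//|t12] t2T Ox.
have [s /andP[s1 s2] E] := solution_mvt t10 t12 t2T Ox.
rewrite -subr_ge0 E mulr_ge0 //; last by lra.
by apply: ut_ge0 => //; apply/andP; split; lra.
Qed.

Lemma quot_ge0 tau t x : 0 < tau -> 0 < t -> t + tau < T -> Omega x ->
  0 <= tquot u tau t x.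
Proof.
move=> tau0 t0 tT Ox; rewrite divr_ge0 ?subr_ge0 //; last exact: ltW.
by apply: solution_nondecreasing => //; lra.
Qed.

(* Convexity of f makes the difference quotient w a classical supersolution
   of w_t = Lap w + V f'(u) w, whereas u_t need not be twice differentiable. *)
Lemma quot_touching tau t x (Z1 : R -> R) (Zt : R) (Z2 dZ2 : 'I_n -> R -> R)
    (Zxx : 'I_n -> R) (e : R) :
  0 < tau -> 0 < t -> t + tau < T -> Omega x ->
  is_derive t 1 Z1 Zt -> Z1 t = tquot u tau t x -> 0 < e ->
  (forall s, t - e < s -> s <= t -> Z1 s <= tquot u tau s x) ->
  (forall i, \forall s \near (0 : R),
     is_derive (s : R) 1 (Z2 i) (dZ2 i s)) ->
  (forall i, is_derive (0 : R) 1 (dZ2 i) (Zxx i)) ->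
  (forall i, Z2 i 0 = tquot u tau t x) ->
  (forall i, \forall s \near (0 : R), Z2 i s <= tquot u tau t (line x i s)) ->
  V x * (fp (u t x) * tquot u tau t x) <= Zt - \sum_(i < n) Zxx i.
Proof.
move=> tau0 t0 tT Ox DZ1 Z1t e0 Z1le DZ2 DZxx Z20 Z2le.
have tT1 : 0 < t < T by apply/andP; split; lra.
have tT2 : 0 < t + tau < T by apply/andP; split; lra.
(* [Z1] and [Z2 i] are the restrictions, to the past of t and to the i-th coordinate line, of a
   minorant touching the quotient w at (t, x). Minimality gives w_t <= Zt here and [Zxx i] <= w_xx
   below. *)
have wt : (time_deriv u (t + tau) x - time_deriv u t x) / tau <= Zt.
  rewrite -subr_le0.
  apply: (@left_min_derive_le0 R (fun s => tquot u tau s x - Z1 s) t _ e _ e0).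
    apply: is_derive1_sub DZ1; rewrite mulrC.
    rewrite (_ : tquot u tau ^~ x =
      fun s => tau^-1 * (u (s + tau) x - u s x)); last first.
      by apply/funext => s; rewrite mulrC.
    apply: is_derive1_cmul; apply: is_derive1_sub; last exact: (solution_dt uC).
    apply: (@is_derive1_shift R (u ^~ x)); exact: (solution_dt uC).
  by move=> s st1 st2; rewrite Z1t subrr subr_ge0 Z1le.
have wxx i : Zxx i <= (partial i (partial i (u (t + tau))) x
    - partial i (partial i (u t)) x) / tau.
  have [|||_] := @second_derive_min R
    (fun s => tau^-1 * (u (t + tau) (line x i s) - u t (line x i s)) - Z2 i s)
    (fun s => tau^-1 * (partial i (u (t + tau)) (line x i s) -
       partial i (u t) (line x i s)) - dZ2 i s)
    (tau^-1 * (partial i (partial i (u (t + tau))) x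
      - partial i (partial i (u t)) x) - Zxx i).
  - apply: filterS3 (solution_dx oO uC i tT1 Ox) (solution_dx oO uC i tT2 Ox)
      (DZ2 i) => s d1 d2 d3.
    by apply: is_derive1_sub => //; apply: is_derive1_cmul; exact: is_derive1_sub.
  - apply: is_derive1_sub => //.
    by apply: is_derive1_cmul; apply: is_derive1_sub; exact: (solution_dxx uC).
  - have := Z2le i; apply: filterS => s.
    by rewrite line0 Z20 /tquot ![_ / tau]mulrC subrr subr_ge0.
  - by rewrite subr_ge0 mulrC.
have [_ eqn] := u_sol.
have E1 := eqn _ x tT1 Ox; have E2 := eqn _ x tT2 Ox.
have Sxx : \sum_(i < n) Zxx i <= (laplacian (u (t + tau)) x - laplacian (u t) x) / tau.
  by rewrite /laplacian -sumrB mulr_suml; apply: ler_sum => i _.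
have FT := f_tangent (u_ge0 tT1 Ox) (u_ge0 tT2 Ox).
have FV : V x * (fp (u t x) * tquot u tau t x) <=
    (V x * f (u (t + tau) x) - V x * f (u t x)) / tau.
  rewrite -mulrBr -mulrA; apply: ler_wpM2l; first exact: V_ge0.
  by rewrite /tquot mulrA ler_pM2r ?invr_gt0 // lerBrDl.
have : (time_deriv u (t + tau) x - time_deriv u t x) / tau =
   (laplacian (u (t + tau)) x - laplacian (u t) x) / tau +
    (V x * f (u (t + tau) x) - V x * f (u t x)) / tau.
  by rewrite E1 E2 -mulrDl opprD addrACA.
move=> E; rewrite E in wt; apply: (le_trans FV).
by rewrite lerBrDl; apply: le_trans wt; rewrite lerD2r.
Qed.

End DifferenceQuotient.

(** * Positivity of u_t near the final time *)

Lemma is_derive1_expR_lin (R : realType) (l t1 t : R) :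
  is_derive t 1 (fun s => expR (l * (s - t1))) (l * expR (l * (t - t1))).
Proof.
have D : is_derive t 1 (fun s => l * (s - t1)) (l * (1 - 0)).
  by apply: is_derive1_cmul; apply: is_derive1_sub.
have := @is_derive1_comp R expR (fun s => l * (s - t1)) t _ _ (is_derive_expR _) D.
by rewrite subr0 mulr1 mulrC.
Qed.

(* Discriminant of the quadratic in g. *)
Lemma barrier_alg (R : realType) (a s nu M K g q : R) :
  0 < a -> 0 < g -> a - g <= q ->
  (M - 1) * (32 * a) = (2 * s + 4 * nu + 8) ^+ 2 ->
  - (K + M) * g ^+ 2 + 2 * g * s - 8 * q + 4 * nu * g < - K * g ^+ 2.
Proof.
move=> a0 g0 agq ME.
have : 0 < 32 * a * g ^+ 2 + ((2 * s + 4 * nu + 8) * g - 16 * a) ^+ 2.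
  by apply: ltr_wpDr; [exact: sqr_ge0|rewrite !mulr_gt0 // exprn_gt0].
rewrite sqrrB exprMn -ME => H.
suff : 0 < 32 * a * (M * g ^+ 2 - (2 * s + 4 * nu + 8) * g + 8 * a).
  rewrite pmulr_rgt0; last by lra.
  lra.
lra.
Qed.

Section Positivity.
Context {R : realType} {n : nat} {T : R} {Omega : set 'rV[R]_n}
  {V : 'rV[R]_n -> R} {f fp : R -> R} {u : R -> 'rV[R]_n -> R}.
Hypotheses (oO : open Omega) (V_ge0 : forall x, Omega x -> 0 <= V x)
  (f_tangent : forall a b, 0 <= a -> 0 <= b -> f a + fp a * (b - a) <= f b)
  (u_sol : classical_solution T Omega V f u)
  (u_ge0 : forall (t : R) x, 0 < t < T -> Omega x -> 0 <= u t x)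
  (ut_ge0 : forall (t : R) x, 0 < t < T -> Omega x -> 0 <= time_deriv u t x).
Implicit Types (t tau : R) (x : 'rV[R]_n) (i : 'I_n).

Let uC : C12 T Omega u. Proof. by case: u_sol. Qed.

Lemma quot_continuous tau t x : 0 < tau -> 0 < t -> t + tau < T -> Omega x ->
  {for (t, x), continuous (fun z : R * 'rV[R]_n => tquot u tau z.1 z.2)}.
Proof.
move=> tau0 t0 tT Ox.
have c1 := @solution_continuous R n T Omega u oO uC t x.
have c2 := @solution_continuous R n T Omega u oO uC (t + tau) x.
apply: cvgMl; apply: cvgB; last first.
  by apply: c1 => //; apply/andP; split; lra.
apply: (@continuous_comp _ _ _ (fun z : R * 'rV[R]_n => (z.1 + tau, z.2))
  (fun z : R * 'rV[R]_n => u z.1 z.2)); last first.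
  by apply: c2 => //; apply/andP; split; lra.
have a1 : (fun z : R * 'rV[R]_n => z.1 + tau) @ (t, x) --> t + tau.
  by apply: cvgD; [exact: cvg_fst|exact: cvg_cst].
have a2 : (fun z : R * 'rV[R]_n => z.2) @ (t, x) --> x by exact: cvg_snd.
exact: (cvg_pair a1 a2).
Qed.

Lemma time_deriv_ge_quot t x (c tau0 : R) : 0 < t < T -> Omega x -> 0 < tau0 ->
  (forall tau, 0 < tau -> tau < tau0 -> c <= tquot u tau t x) ->
  c <= time_deriv u t x.
Proof.
move=> tT Ox t0 H; rewrite leNgt; apply/negP => dc.
have /is_derive1_cvg/cvgr_lt/(_ _ dc)[e /= e0 eH] := solution_dt uC tT Ox.
pose tau := Num.min e tau0 / 2.
have m0 : 0 < Num.min e tau0 by rewrite lt_min e0.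
have me : Num.min e tau0 <= e by rewrite ge_min lexx.
have mt : Num.min e tau0 <= tau0 by rewrite ge_min lexx orbT.
have taue : 0 < tau < e by rewrite /tau; lra.
have taut : tau < tau0 by rewrite /tau; lra.
case/andP: taue => tau0' taue.
have := eH tau; rewrite /ball_ /= sub0r normrN gtr0_norm // => /(_ taue).
by rewrite gt_eqF // ltNge mulrC [tau + t]addrC => /(_ isT)/negP; apply; exact: H.
Qed.

Lemma solution_stationary : (forall t x, 0 < t < T -> Omega x ->
    time_deriv u t x = 0) ->
  forall t1 t2 x, 0 < t1 -> t1 <= t2 -> t2 < T -> Omega x -> u t1 x = u t2 x.
Proof.
move=> ut0 t1 t2 x t10; rewrite le_eqVlt => /predU1P[->//|t12] t2T Ox.
have [s /andP[s1 s2] E] := solution_mvt u_sol t10 t12 t2T Ox.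
apply/eqP; rewrite eq_sym -subr_eq0 E ut0 ?mul0r //.
by rewrite (lt_trans t10 s1) (lt_trans s2 t2T).
Qed.

(** The barrier is kap exp(-lam (t - t1)) g^2 with g = a + s (t - t1) - |x - x1|^2, supported in a
    growing ball. Near its edge the term 8 |x - x1|^2 in the laplacian of g^2 dominates; where g is
    larger, the decay rate does. The resulting radius exceeds b/4 however small [a] is, which makes
    the propagation argument close. *)
Lemma positivity_spread x1 (a b t1 c delta K : R) : 0 < a < b -> 0 < t1 ->
  (forall x, esq (x - x1) <= b -> Omega x) -> 0 <= K ->
  (forall x s, Omega x -> 0 <= s -> - K <= V x * fp s) ->
  0 < c -> 0 < delta -> t1 + delta < T ->
  (forall t x, t1 <= t -> t <= t1 + delta -> esq (x - x1) <= a ->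
     c <= time_deriv u t x) ->
  exists2 c' : R, 0 < c' & forall t x, (t1 + T) / 2 <= t -> t < T ->
    esq (x - x1) <= (3 * a + b) / 4 -> c' <= time_deriv u t x.
Proof.
move=> /andP[a0 ab] t10 bO K0 VK c0 d0 dT utc.
pose nu : R := n%:R.
(* The squared radius a + s (t - t1) reaches b exactly at t = T. At half time it is (a + b)/2, which
   leaves g >= (b - a)/4 on the ball of squared radius (3a + b)/4. *)
have [s s0 sE] : exists2 s, 0 < s & s * (T - t1) = b - a.
  exists ((b - a) / (T - t1)); first by rewrite divr_gt0; lra.
  by rewrite divfK // gt_eqF; lra.
have [M ME] : exists M, (M - 1) * (32 * a) = (2 * s + 4 * nu + 8) ^+ 2.
  exists ((2 * s + 4 * nu + 8) ^+ 2 / (32 * a) + 1).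
  by rewrite addrK divfK // gt_eqF; lra.
(* [K] pays for the zeroth-order coefficient V f'(u) >= -K, and [M] for the motion and diffusion of
   g^2, through [barrier_alg]. *)
pose lam := K + M.
pose kap := c / a ^+ 2; have kap0 : 0 < kap by rewrite divr_gt0 ?exprn_gt0.
pose E t := expR (- lam * (t - t1)).
pose g t x := a + s * (t - t1) - esq (x - x1).
pose B t x := kap * E t * (g t x * g t x).
have DE t : is_derive t 1 E (- lam * E t) by exact: is_derive1_expR_lin.
have E0 t : 0 < E t by exact: expR_gt0.
have gC (z : R * 'rV[R]_n) : {for z, continuous (fun z : R * 'rV[R]_n => g z.1 z.2)}.
  apply: cvgB; last first.
    apply: (@continuous_comp _ _ _ snd (fun x : 'rV[R]_n => esq (x - x1))).
      exact: cvg_snd.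
    exact: continuous_esq_sub.
  apply: cvgD; first exact: cvg_cst.
  apply: cvgMr; apply: cvgB; [exact: cvg_fst|exact: cvg_cst].
have BC (z : R * 'rV[R]_n) : {for z, continuous (fun z : R * 'rV[R]_n => B z.1 z.2)}.
  apply: cvgM; last by apply: cvgM; exact: gC.
  apply: cvgMr; apply: (@continuous_comp _ _ _ fst E).
    exact: cvg_fst.
  by have [/derivable1_diffP/differentiable_continuous] := DE z.1.
have g_b t x : t < T -> 0 <= g t x -> esq (x - x1) < b.
  move=> tT; rewrite /g => g0.
  have : s * (t - t1) < s * (T - t1) by rewrite ltr_pM2l // ltrD2r.
  by rewrite sE; lra.
(* A negative minimum of w - B cannot lie on g = 0, where B vanishes and w >= 0, nor at t1, where B
   <= c while w is a value of u_t in [t1, t1 + delta] by the mean value theorem; this is why tau <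
   delta. Elsewhere B plus the minimum touches w from below. *)
have main tau T1 t x : 0 < tau -> tau < delta -> t1 <= T1 -> T1 + tau < T ->
    t1 <= t -> t <= T1 -> 0 <= g t x -> B t x <= tquot u tau t x.
  move=> tau0 taud t1T1 T1T tt1 tT1 g0.
  pose S : set (R * 'rV[R]_n) := (`[t1, T1]%classic `*` [set x | esq (x - x1) <= b])
    `&` [set z | 0 <= g z.1 z.2].
  have cS : compact S.
    apply: compact_closedI.
      by apply: compact_setX; [exact: segment_compact|exact: compact_esq_ball].
    apply: (@preimage_closed _ _ (fun z : R * 'rV[R]_n => g z.1 z.2) [set y | 0 <= y]).
      by move=> z _; exact: gC.
    exact: closed_ge.
  have T1T' : T1 < T by apply: le_lt_trans T1T; rewrite lerDl ltW.
  have SP t' x' : t1 <= t' -> t' <= T1 -> 0 <= g t' x' -> S (t', x').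
    move=> h1 h2 h3; split=> //; split=> /=; first by rewrite in_itv /= h1.
    by apply: ltW; apply: g_b h3; exact: le_lt_trans T1T'.
  pose F (z : R * 'rV[R]_n) := tquot u tau z.1 z.2 - B z.1 z.2.
  have SO z : S z -> [/\ t1 <= z.1, z.1 <= T1, Omega z.2 & 0 <= g z.1 z.2].
    move=> [[/=]]; rewrite in_itv /= => /andP[h1 h2] h3 h4; split=> //.
    exact: bO.
  have FC : {within S, continuous F}.
    apply: continuous_in_subspaceT => -[t' x'] /set_mem/SO[/= h1 h2 h3 h4].
    apply: cvgB; last exact: BC.
    apply: quot_continuous => //; first exact: lt_le_trans h1.
    by apply: le_lt_trans T1T; rewrite lerD2r.
  have [|[t' x']] := @compact_EVT_min _ _ F S _ cS FC.
    by exists (t, x); exact: SP.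
  move=> /set_mem/[dup] Sz /SO[/= h1 h2 h3 h4] min.
  have {}min t2 x2 : t1 <= t2 -> t2 <= T1 -> 0 <= g t2 x2 ->
      F (t', x') <= F (t2, x2).
    by move=> ? ? ?; apply: min; apply/mem_set; exact: SP.
  rewrite -subr_ge0; apply: le_trans (min t x tt1 tT1 g0).
  rewrite leNgt; apply/negP => Fneg.
  have t'0 : 0 < t' by exact: lt_le_trans h1.
  have t'T : t' + tau < T by apply: le_lt_trans T1T; rewrite lerD2r.
  have w0 : 0 <= tquot u tau t' x' by exact: (quot_ge0 u_sol ut_ge0).
  have gpos : 0 < g t' x'.
    rewrite lt_neqAle h4 andbT; apply: contraTneq w0 => g0'.
    by move: Fneg; rewrite /F /B /= -g0' mul0r mulr0 subr0 -ltNge.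
  have Fm : tquot u tau t' x' = B t' x' + F (t', x') by rewrite /F addrC subrK.
  have t1t' : t1 < t'.
    rewrite lt_neqAle h1 andbT; apply/eqP => tt; move: Fneg.
    apply/negP; rewrite -leNgt /F subr_ge0 /= -tt.
    have gt1 : g t1 x' = a - esq (x' - x1) by rewrite /g subrr mulr0 addr0.
    rewrite -tt in gpos h4.
    have Bc : B t1 x' <= c.
      rewrite /B /E subrr mulr0 expR0 mulr1 /kap -mulrA ger_pMr //.
      rewrite mulrC ler_pdivrMr ?exprn_gt0 // mul1r expr2.
      by apply: ler_pM => //; rewrite gt1 gerBl esq_ge0.
    apply: (le_trans Bc).
    have [] // := @solution_mvt R n T Omega V f u u_sol t1 (t1 + tau) x'.
      by rewrite ltrDl.
      by rewrite tt.
    move=> r /andP[r1 r2] E1; rewrite /tquot E1 addrAC subrr add0r.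
    rewrite mulfK ?gt_eqF //; apply: utc; first exact: ltW.
      by apply: (le_trans (ltW r2)); rewrite lerD2l ltW.
    by move: gpos; rewrite gt1 subr_gt0 => /ltW.
  pose xi i := (x' - x1) 0 i; pose ga := g t' x'; pose k := kap * E t'.
  have k0 : 0 < k by rewrite mulr_gt0.
  pose P i (h : R) := ga + (- 2 * xi i) * h + (- 1) * h ^+ 2.
  have gP i h : g t' (line x' i h) = P i h.
    by rewrite /P /ga /g esq_line -/(xi i); ring.
  have min0 : 0 < Num.min (t' - t1) (ga / s).
    by rewrite lt_min subr_gt0 t1t' divr_gt0.
  have Dg : is_derive t' 1 (g ^~ x') s.
    have D1 := is_derive1_cmul s (is_derive1_sub (is_derive_id t' 1) (is_derive_cst t1 t' 1)).
    have D2 := is_derive1_sub (is_derive1_add (is_derive_cst a t' 1) D1) (is_derive_cst (esq (x' - x1)) t' 1).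
    by apply: (is_derive_eq D2); rewrite !subr0 add0r mulr1.
  have D1 := is_derive1_add (is_derive1_cmul kap (is_derive1_mul (DE t')
    (is_derive1_mul Dg Dg))) (is_derive_cst (F (t', x')) t' 1).
  have DP i (h : R) : is_derive h 1 (P i) (- 2 * xi i + 2 * (- 1) * h).
    exact: is_derive1_quad.
  pose dP i (h : R) := - 2 * xi i + 2 * (- 1) * h.
  have DdP i (h : R) : is_derive h 1 (dP i) (2 * (- 1)).
    have D2 := is_derive1_quad (- 2 * xi i) (2 * (- 1)) 0 h.
    apply: (is_derive_eq _ (_ : 2 * (- 1) + 2 * 0 * h = _)); last by rewrite mulr0 mul0r addr0.
    rewrite (_ : dP i = fun s => - 2 * xi i + 2 * (- 1) * s + 0 * s ^+ 2) //.
    by apply/funext => y; rewrite mul0r addr0.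
  have P0 i : P i 0 = ga by rewrite -gP line0.
  have e1 : kap * (E t' * (g t' x' * g t' x')) + F (t', x') = tquot u tau t' x'.
    by rewrite Fm /B -!mulrA.
  have e2 r : t' - Num.min (t' - t1) (ga / s) < r -> r <= t' ->
      kap * (E r * (g r x' * g r x')) + F (t', x') <= tquot u tau r x'.
    move=> rm rt.
    have r1 : t1 <= r.
      have : Num.min (t' - t1) (ga / s) <= t' - t1 by rewrite ge_min lexx.
      by move=> mt; apply/ltW/(le_lt_trans _ rm); rewrite lerBrDr addrC -lerBrDr.
    have r2 : 0 <= g r x'.
      have : Num.min (t' - t1) (ga / s) <= ga / s by rewrite ge_min lexx orbT.
      move=> mg; have : t' - r < ga / s.
        by apply: lt_le_trans mg; rewrite ltrBlDr addrC -ltrBlDr.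
      rewrite ltr_pdivlMr // => rg.
      have -> : g r x' = ga - (t' - r) * s by rewrite /ga /g; ring.
      by rewrite subr_ge0 ltW.
    have := min r x' r1 (le_trans rt h2) r2.
    by rewrite {2}/F /= /B -!mulrA lerBrDr addrC.
  have e3 i : k * (P i 0 * P i 0) + F (t', x') = tquot u tau t' x'.
    by rewrite P0 Fm.
  have e4 i : \forall h \near (0 : R), k * (P i h * P i h) + F (t', x') <=
      tquot u tau t' (line x' i h).
    have : \forall h \near (0 : R), 0 < g t' (line x' i h).
      apply: (@near_line R n [set y | 0 < g t' y] x' i).
      have : esq (x' - x1) < a + s * (t' - t1) by rewrite -subr_gt0.
      by move=> /nbhs_esq_ball; apply: filterS => y; rewrite /= /g subr_gt0.
    apply: filterS => h gh.
    have := min t' (line x' i h) h1 h2 (ltW gh).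
    by rewrite {2}/F /= /B gP lerBrDr addrC.
  have D2 i : \forall h \near (0 : R), is_derive (h : R) 1
      (fun h => k * (P i h * P i h) + F (t', x'))
      (k * (dP i h * P i h + P i h * dP i h) + 0).
    apply: (@filterS _ _ _ setT) => [h _|]; last exact: filterT.
    apply: is_derive1_add (is_derive_cst _ _ _).
    by apply: is_derive1_cmul; exact: is_derive1_mul.
  have D3 i : is_derive (0 : R) 1
      (fun h => k * (dP i h * P i h + P i h * dP i h) + 0)
      (k * ((2 * (- 1)) * P i 0 + dP i 0 * dP i 0 +
            (dP i 0 * dP i 0 + P i 0 * (2 * (- 1)))) + 0).
    apply: is_derive1_add (is_derive_cst _ _ _).
    by apply: is_derive1_cmul; apply: is_derive1_add; exact: is_derive1_mul.
  have := quot_touching oO V_ge0 f_tangent u_sol u_ge0 tau0 t'0 t'T h3 D1 e1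
    min0 e2 D2 D3 e3 e4.
  have -> : \sum_(i < n) (k * (2 * -1 * P i 0 + dP i 0 * dP i 0 +
      (dP i 0 * dP i 0 + P i 0 * (2 * -1))) + 0) =
      k * (8 * esq (x' - x1) - 4 * nu * ga).
    rewrite (eq_bigr (fun i => k * (8 * xi i ^+ 2 - 4 * ga))); last first.
      by move=> i _; rewrite P0 /dP; ring.
    rewrite -mulr_sumr sumrB -mulr_sumr sumr_const card_ord.
    by rewrite -[_ *+ n]mulr_natr -/nu; congr (_ * (_ - _)); ring.
  (* A negative minimum puts w below B, so -K w may be replaced by -K B in the differential
     inequality. *)
  have w_lt : tquot u tau t' x' <= k * (ga * ga) by rewrite Fm gerDl ltW.
  apply/negP; rewrite -ltNge.
  apply: (@lt_le_trans _ _ (- K * tquot u tau t' x')); last first.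
    by rewrite mulrA ler_wpM2r // VK // u_ge0 // t'0 (le_lt_trans h2 T1T').
  apply: (@lt_le_trans _ _ (- K * (k * (ga * ga)))); last first.
    by rewrite !mulNr lerN2 ler_wpM2l.
  have agq : a - ga <= esq (x' - x1).
    rewrite /ga /g lerBlDr addrC subrK lerDl.
    by apply: mulr_ge0; [exact: ltW|rewrite subr_ge0].
  have := barrier_alg K a0 gpos agq ME; rewrite -(ltr_pM2l k0) -/lam -/ga.
  rewrite /k -!mulrA; congr (_ < _); ring.
have M0 : 0 <= M.
  have : 0 <= (M - 1) * (32 * a) by rewrite ME sqr_ge0.
  by rewrite pmulr_lge0; lra.
have lam0 : 0 <= lam by exact: addr_ge0.
pose d := (b - a) / 4; have d0' : 0 < d by rewrite /d; lra.
exists (kap * E T * (d * d)); first by apply: mulr_gt0; apply: mulr_gt0.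
move=> t x t1T tT xab.
have t1t : t1 <= t by apply: le_trans t1T; lra.
have t0 : 0 < t by exact: lt_le_trans t1t.
have gd : d <= g t x.
  rewrite /d /g.
  have : s * (T - t1) / 2 <= s * (t - t1) by rewrite -mulrA ler_pM2l //; lra.
  by rewrite sE; lra.
have ET : E T <= E t.
  rewrite ler_expR !mulNr lerN2 ler_wpM2l // lerD2r; exact: ltW.
have Bc : kap * E T * (d * d) <= B t x.
  rewrite /B -[kap * E T * _]mulrA -[kap * E t * _]mulrA ler_pM2l //.
  apply: ler_pM => //.
  - exact: ltW.
  - by rewrite mulr_ge0 // ltW.
  - by apply: ler_pM => //; exact: ltW.
apply: (@time_deriv_ge_quot t x _ (Num.min delta (T - t))).
- by rewrite t0.
- by apply/bO/ltW/(g_b _ _ tT)/(le_trans (ltW d0')).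
- by rewrite lt_min d0 subr_gt0.
move=> tau tau0; rewrite lt_min => /andP[td tT'].
apply: (le_trans Bc); apply: (main tau t) => //.
- by rewrite addrC -ltrBrDr.
- exact: le_trans (ltW d0') gd.
Qed.

End Positivity.

Lemma esq_add_le (R : realType) (n : nat) (x y : 'rV[R]_n) :
  esq (x + y) <= 2 * esq x + 2 * esq y.
Proof.
rewrite /esq !mulr_sumr -big_split /=; apply: ler_sum => i _; rewrite mxE.
by have := sqr_ge0 (x 0 i - y 0 i); nra.
Qed.

Lemma esq_opp (R : realType) (n : nat) (x y : 'rV[R]_n) :
  esq (x - y) = esq (y - x).
Proof. by apply: eq_bigr => i _; rewrite !mxE; ring. Qed.

Lemma esq_triangle (R : realType) (n : nat) (x y z : 'rV[R]_n) :
  esq (x - z) <= 2 * esq (x - y) + 2 * esq (y - z).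
Proof. by rewrite -[x - z](subrKA y) esq_add_le. Qed.

Lemma nbhs_esqP (R : realType) (n : nat) (x : 'rV[R]_n) (Q : set 'rV[R]_n) :
  nbhs x Q -> exists2 b : R, 0 < b & forall y, esq (y - x) <= b -> Q y.
Proof.
move=> /nbhs_ballP[e /= e0 eQ]; exists (e ^+ 2 / 2).
  by rewrite divr_gt0 ?exprn_gt0.
move=> y yb; apply: eQ; rewrite -ball_normE /ball_ /= distrC.
rewrite -(@ltr_pXn2r _ 2) ?nnegrE //; last exact: ltW.
apply: (le_lt_trans (norm_sq_le_esq _)); apply: (le_lt_trans yb).
by rewrite ltr_pdivrMr // ltr_pMr ?exprn_gt0 // ltr1n.
Qed.

Section CompactPositivity.
Context {R : realType} {n : nat} {T K : R} {Omega : set 'rV[R]_n}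
  {V : 'rV[R]_n -> R} {f fp : R -> R} {u : R -> 'rV[R]_n -> R}.
Hypotheses (oO : open Omega) (conO : connected Omega)
  (V_ge0 : forall x, Omega x -> 0 <= V x)
  (f_tangent : forall a b, 0 <= a -> 0 <= b -> f a + fp a * (b - a) <= f b)
  (K0 : 0 <= K)
  (VK : forall x s, Omega x -> 0 <= s -> - K <= V x * fp s)
  (u_sol : classical_solution T Omega V f u)
  (u_ge0 : forall (t : R) x, 0 < t < T -> Omega x -> 0 <= u t x)
  (ut_ge0 : forall (t : R) x, 0 < t < T -> Omega x -> 0 <= time_deriv u t x).

(** The points near which u_t has a positive lower bound up to time T form a nonempty, open and
    relatively closed subset of the connected set [Omega]; compactness of [D] then makes the bound
    uniform. *)
Lemma time_deriv_pos_compact t1 x1 (D : set 'rV[R]_n) :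
  0 < t1 < T -> Omega x1 -> 0 < time_deriv u t1 x1 ->
  compact D -> D `<=` Omega ->
  exists2 e : R, 0 < e < T & forall t y, T - e <= t -> t < T -> D y ->
    e <= time_deriv u t y.
Proof.
move=> t1T Ox1 ut1 cD DO.
case/andP: (t1T) => t10 t1lt.
pose A := [set x | Omega x /\ exists c t0 r : R,
  [/\ 0 < c, 0 < t0 < T, 0 < r & forall t y, t0 <= t -> t < T ->
    esq (y - x) <= r -> c <= time_deriv u t y]].
have half t : t < T -> t < (t + T) / 2 < T by move=> tT; apply/andP; split; lra.
have spread x (a b t0 c d : R) : Omega x -> 0 < a < b -> 0 < t0 -> 0 < c ->
    0 < d -> t0 + d < T -> (forall y, esq (y - x) <= b -> Omega y) ->
    (forall t y, t0 <= t -> t <= t0 + d -> esq (y - x) <= a ->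
      c <= time_deriv u t y) ->
    forall y r, 0 < r -> (forall z, esq (z - y) <= r -> esq (z - x) <= (3 * a + b) / 4) ->
    A y.
  move=> Ox ab t00 c0 d0 dT bO H y r r0 ry.
  have [c' c'0 H'] := positivity_spread oO V_ge0 f_tangent u_sol u_ge0 ut_ge0 ab t00
    bO K0 VK c0 d0 dT H.
  split.
    apply: bO; apply: (le_trans (ry y _)); last by move: ab; lra.
    by rewrite esq_subrr ?ltW.
  exists c', ((t0 + T) / 2), r; split=> //; last first.
    by move=> t z h1 h2 zr; apply: H' => //; exact: ry.
  have t0T : t0 < T by apply: lt_trans dT; rewrite ltrDl.
  by have /andP[h1 ->] := half _ t0T; rewrite andbT (lt_trans t00).
have AO : A = Omega.
  apply: conO.
  - exists x1.
    have utc := @solution_dt_continuous R n T Omega u oO u_sol.1 t1 x1 t1T Ox1.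
    have [[P Q] /= [Pt Qx] PQ] : nbhs (t1, x1)
        [set z : R * 'rV[R]_n | time_deriv u t1 x1 / 2 < time_deriv u z.1 z.2].
      by have /cvgr_gt := utc; apply; rewrite ltr_pdivrMr // ltr_pMr // ltr1n.
    have [b b0 bQ] : exists2 b : R, 0 < b & forall y, esq (y - x1) <= b -> (Q `&` Omega) y.
      by apply: nbhs_esqP; apply: filterI => //; exact: open_nbhs_nbhs.
    have [d [d0 dT dP]] : exists d : R, [/\ 0 < d, t1 + d < T &
        forall t, t1 <= t -> t <= t1 + d -> P t].
      have [r /= r0 rP] := Pt; pose m := Num.min r (T - t1).
      have m0 : 0 < m by rewrite lt_min r0 subr_gt0.
      have mr : m <= r by rewrite ge_min lexx.
      have mT : m <= T - t1 by rewrite ge_min lexx orbT.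
      exists (m / 2); split; [by rewrite divr_gt0|by lra|].
      move=> t h1 h2; apply: rP; rewrite /ball_ /= distrC ger0_norm ?subr_ge0 //.
      by lra.
    apply: (spread x1 (b / 2) b t1 (time_deriv u t1 x1 / 2) d Ox1 _ t10 _ d0 dT _ _ x1 (b / 2)).
    + by rewrite divr_gt0 //= ltr_pdivrMr // ltr_pMr // ltr1n.
    + by rewrite divr_gt0.
    + by move=> y /bQ[].
    + move=> t y h1 h2 h3; apply/ltW/(PQ (t, y)); split; first exact: dP.
      by have [] := bQ y; first by apply: (le_trans h3); rewrite ler_pdivrMr // ler_pMr // ler1n.
    + by rewrite divr_gt0.
    + by move=> z zb; apply: (le_trans zb); move: b0; lra.
  - exists A; last by rewrite setIC; apply/esym/setIidl => x [].
    rewrite openE => x [Ox [c [t0 [r [c0 t0T r0 H]]]]].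
    have : nbhs x ([set y | esq (y - x) < r / 4] `&` Omega).
      apply: filterI; last exact: open_nbhs_nbhs.
      by apply: nbhs_esq_ball; rewrite esq_subrr ?divr_gt0.
    apply: filterS => y [/= yx Oy]; split=> //.
    exists c, t0, (r / 4); split; [by []|by []|by rewrite divr_gt0|].
    move=> t z h1 h2 h3; apply: H => //; apply: (le_trans (esq_triangle z y x)).
    by move: yx h3; lra.
  - exists (closure A); first exact: closed_closure.
    apply/seteqP; split=> [x Ax|y [Oy clA]].
      by split; [case: Ax|exact: subset_closure].
    have [b b0 bO] := nbhs_esqP (open_nbhs_nbhs (conj oO Oy)).
    have [x [[Ox [c [t0 [r [c0 /andP[t00 t0T] r0 H]]]]] /= xy]] :
        A `&` [set x | esq (x - y) < b / 64] !=set0.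
      by apply: clA; apply: nbhs_esq_ball; rewrite esq_subrr ?divr_gt0.
    (* [esq] obeys the triangle inequality with factors 2: the ball of squared radius b/4 about x
       stays within b of y, and the ball of squared radius b/64 about y within b/16 of x, which is
       below (3a + b/4)/4. *)
    pose a := Num.min r (b / 8).
    have a0 : 0 < a by rewrite lt_min r0 divr_gt0.
    have ar : a <= r by rewrite ge_min lexx.
    have ab : a <= b / 8 by rewrite ge_min lexx orbT.
    have /andP[hT1 hT2] := half _ t0T.
    apply: (spread x a (b / 4) t0 c ((T - t0) / 2) Ox _ t00 c0 _ _ _ _ y (b / 64)).
    + by rewrite a0 /=; lra.
    + by rewrite divr_gt0 // subr_gt0.
    + by lra.
    + move=> z zx; apply: bO; apply: (le_trans (esq_triangle z x y)).
      by move: zx xy b0; lra.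
    + move=> t z h1 h2 h3; apply: H => //; last exact: le_trans ar.
      by apply: (le_lt_trans h2); lra.
    + by rewrite divr_gt0.
    + move=> z zy; apply: (le_trans (esq_triangle z y x)); rewrite esq_opp in xy.
      by move: zy xy b0 a0; lra.
have /compact_near_coveringP cov := cD.
(* One parameter serves as time threshold and as lower bound, so that the property holds for all
   small e. *)
pose P (e : R) y := forall t, T - e <= t -> t < T -> e <= time_deriv u t y.
have covP : forall x, D x -> \forall x' \near x & e \near 0^'+, P e x'.
  move=> x /DO; rewrite -AO => -[Ox [c [t0 [r [c0 /andP[t00 t0T] r0 H]]]]].
  exists ([set y | esq (y - x) < r], [set e | e < Num.min c (T - t0)]).
    split=> /=.
      by apply: nbhs_esq_ball; rewrite esq_subrr.
    by apply: nbhs_right_lt; rewrite lt_min c0 subr_gt0.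
  move=> [y e] /= [yr]; rewrite lt_min => /andP[ec eT] t tT1 tT2.
  apply: (le_trans (ltW ec)); apply: H => //; last exact: ltW.
  by apply: le_trans tT1; rewrite lerBrDr addrC -lerBrDr ltW.
have DP : \forall e \near 0^'+, D `<=` P e by exact: (cov R 0^'+ P).
have : \forall e \near (0 : R)^'+, [/\ D `<=` P e, 0 < e & e < T].
  near=> e; split.
  - by near: e.
  - by near: e; exact: nbhs_right_gt.
  - by near: e; apply: nbhs_right_lt; exact: lt_trans t1lt.
move=> H; have [e] := @filter_ex R (0^'+) _ _ H; move=> /= [eP e0 eT].
exists e; first by rewrite e0.
by move=> t y h1 h2 Dy; exact: eP.
Unshelve. all: by end_near. Qed.

End CompactPositivity.

(** * Algebra absorbing the errors of the cut-off *)

(** Replaces powers of the cut-off, and the weight in the Keller-Osserman estimate, by minorants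
    quadratic along coordinate lines with the same value at the touching point. *)
Lemma tangent_pow (R : realDomainType) (a x : R) (m : nat) : 0 <= a -> 0 <= x ->
  a ^+ m.+1 + m.+1%:R * a ^+ m * (x - a) <= x ^+ m.+1.
Proof.
move=> a0 x0; elim: m => [|m IH]; first by rewrite expr0 !expr1; lra.
have := ler_wpM2l x0 IH; rewrite -exprS; apply: le_trans.
have : 0 <= m.+1%:R * a ^+ m * (x - a) ^+ 2.
  apply: mulr_ge0; last exact: sqr_ge0.
  by apply: mulr_ge0 => //; exact: exprn_ge0.
move=> H; rewrite -subr_ge0; move: H; congr (0 <= _).
rewrite (exprS a m.+1) (exprS a m) -[m.+2%:R]natr1; ring.
Qed.

(* Young-type absorption: the weight th^k pays for the region where v is of
   size th^(-2/(p-1)), in which the good term does not dominate. *)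
Lemma absorb_powers (R : realFieldType) (A c : R) (N : nat) : 0 <= A -> 0 < c ->
  exists2 M : R, 0 <= M & forall th Y v : R, 0 <= th <= 1 -> 1 <= Y -> 1 <= v ->
    v <= Y ^+ N ->
    A * (v * th ^+ (2 * N.+1 + 2) * Y ^+ 5) + A * (v * th ^+ (2 * N.+1) * Y ^+ 3)
      <= c * (v * th ^+ (2 * N.+1 + 2) * Y ^+ 7) + M.
Proof.
move=> A0 c0; pose M1 := 2 * A / c + 1.
have Ac0 : 0 <= 2 * A / c by rewrite divr_ge0 ?mulr_ge0 // ltW.
have M10 : 0 <= M1 by rewrite /M1; lra.
exists (A * M1 ^+ (N + 5) + A * M1 ^+ N.+1).
  by rewrite addr_ge0 // mulr_ge0 // exprn_ge0.
move=> th Y v /andP[th0 th1] Y1 v1 vY.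
have Y0 : 0 <= Y by lra.
have v0 : 0 <= v by lra.
set k := (2 * N.+1)%N.
have tk : 0 <= th ^+ k by exact: exprn_ge0.
have tk2 : 0 <= th ^+ (k + 2) by exact: exprn_ge0.
have P1 : A * (v * th ^+ (k + 2) * Y ^+ 5) <=
    c / 2 * (v * th ^+ (k + 2) * Y ^+ 7) + A * M1 ^+ (N + 5).
  have [AY|YA] := leP A (c / 2 * Y ^+ 2).
    rewrite -[leLHS]addr0 lerD ?mulr_ge0 ?exprn_ge0 //.
    have -> : c / 2 * (v * th ^+ (k + 2) * Y ^+ 7) =
      c / 2 * Y ^+ 2 * (v * th ^+ (k + 2) * Y ^+ 5) by ring.
    by rewrite ler_wpM2r // !mulr_ge0 ?exprn_ge0.
  rewrite -[leLHS]add0r lerD ?mulr_ge0 ?exprn_ge0 ?divr_ge0 //; first exact: ltW.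
  rewrite ler_wpM2l //.
  have YM : Y <= M1.
    have : Y ^+ 2 < 2 * A / c by rewrite ltr_pdivlMr //; lra.
    by rewrite expr2 /M1; nra.
  apply: (@le_trans _ _ (Y ^+ (N + 5))); last by rewrite lerXn2r ?nnegrE.
  rewrite [leRHS]exprD; apply: ler_wpM2r; first exact: exprn_ge0.
  by apply: le_trans vY; rewrite ler_piMr //; exact: exprn_ile1.
(* If th Y^2 is large, the good term wins. Otherwise k = 2(N+1) makes th^k Y^(4(N+1)) a power of the
   bounded quantity (th Y^2)^2, and it majorises v th^k Y^3 since N + 3 <= 4(N+1). *)
have P2 : A * (v * th ^+ k * Y ^+ 3) <=
    c / 2 * (v * th ^+ (k + 2) * Y ^+ 7) + A * M1 ^+ N.+1.
  have [AY|YA] := leP A (c / 2 * (th * Y ^+ 2) ^+ 2).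
    rewrite -[leLHS]addr0 lerD ?mulr_ge0 ?exprn_ge0 //.
    have -> : c / 2 * (v * th ^+ (k + 2) * Y ^+ 7) =
      c / 2 * (th * Y ^+ 2) ^+ 2 * (v * th ^+ k * Y ^+ 3) by rewrite exprD; ring.
    by rewrite ler_wpM2r // !mulr_ge0 ?exprn_ge0.
  rewrite -[leLHS]add0r lerD ?mulr_ge0 ?exprn_ge0 ?divr_ge0 //; first exact: ltW.
  rewrite ler_wpM2l //.
  have YM : (th * Y ^+ 2) ^+ 2 <= M1.
    have : (th * Y ^+ 2) ^+ 2 < 2 * A / c by rewrite ltr_pdivlMr //; lra.
    by rewrite /M1; lra.
  apply: (@le_trans _ _ (((th * Y ^+ 2) ^+ 2) ^+ N.+1)); last first.
    by rewrite lerXn2r ?nnegrE ?sqr_ge0.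
  have -> : ((th * Y ^+ 2) ^+ 2) ^+ N.+1 = th ^+ k * Y ^+ (4 * N.+1).
    by rewrite -exprM exprMn -exprM mulnA.
  rewrite [v * _]mulrC -mulrA ler_wpM2l //.
  apply: (@le_trans _ _ (Y ^+ 3 * Y ^+ N)); first by rewrite mulrC ler_wpM2l ?exprn_ge0.
  rewrite -exprD; apply: ler_weXn2l => //.
  by rewrite mulnS leq_add // leq_pmull.
lra.
Qed.

(* Here th, v, Y, fv, dfv stand for the cut-off theta, 1 + u, v^((p-1)/4), f(u),
   f'(u); g1, g2 are the derivatives of theta^(m+1), theta^m with m = 2 N + 4,
   and the last term is what completing the square leaves of the gradients. *)
Lemma absorb_terms (R : realFieldType) (N : nat) (C cs C2 Vm c0 nu sg q : R) :
  0 <= C -> 0 < cs -> 0 <= C2 -> 0 <= Vm -> 0 < c0 -> 0 <= nu -> 0 < sg ->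
  1 < q ->
  exists2 M : R, 0 <= M & forall th v Y fv dfv Vx b1 b2 g1 g2 : R,
    0 < th <= 1 -> 1 <= Y -> 1 <= v -> v <= Y ^+ N ->
    - C <= dfv -> `|dfv| <= C * Y ^+ 4 -> 0 <= fv -> fv <= C * (v * Y ^+ 4) ->
    cs * (v * Y ^+ 4) - C2 <= v * dfv - q * fv -> c0 <= Vx -> Vx <= Vm ->
    b1 = th ^+ (2 * N.+1 + 3) -> b2 = th ^+ (2 * N.+1 + 2) ->
    g1 = (2 * N.+1 + 3)%:R * th ^+ (2 * N.+1 + 2) ->
    g2 = (2 * N.+1 + 2)%:R * th ^+ (2 * N.+1 + 1) ->
    Vx * (- b1 * dfv + b2 * (Y ^+ 3 * (q * fv - v * dfv))) +
    2 * nu / sg * (g1 * (1 + fv) + g2 * (v * Y ^+ 3)) +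
    4 / sg * (g1 * dfv + g2 * (q * Y ^+ 3)) ^+ 2 /
      (b2 * (q * (q - 1) * Y ^+ 3 / v)) <= M.
Proof.
move=> C0 cs0 C20 Vm0 c00 nu0 sg0 q1.
set k := (2 * N.+1)%N.
pose K3 : R := (k + 3)%:R; pose K2 : R := (k + 2)%:R.
have K30 : 0 <= K3 by exact: ler0n.
have K20 : 0 <= K2 by exact: ler0n.
have q0 : 0 < q by lra.
have qq : 0 < q * (q - 1) by rewrite mulr_gt0 //; lra.
(* [A1] and [A2] collect the coefficients of the only two error monomials, v b2 Y^5 and v th^k Y^3,
   to which [absorb_powers] applies. *)
pose A1 := 2 * nu / sg * (K3 * (1 + C)) + 8 / sg * (K3 ^+ 2 * C ^+ 2) / (q * (q - 1)).
pose A2 := Vm * C2 + 2 * nu / sg * K2 + 8 / sg * (K2 ^+ 2 * q ^+ 2) / (q * (q - 1)).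
have s1 : 0 <= 2 * nu / sg by rewrite divr_ge0 ?mulr_ge0 // ltW.
have s2 : 0 <= 8 / sg by rewrite divr_ge0 // ltW.
have s3 a b : 0 <= 8 / sg * (a ^+ 2 * b ^+ 2) / (q * (q - 1)).
  apply: divr_ge0; last exact: ltW.
  by apply: mulr_ge0 => //; apply: mulr_ge0; exact: sqr_ge0.
have A10 : 0 <= A1.
  by apply: addr_ge0 => //; rewrite !mulr_ge0 //; lra.
have A20 : 0 <= A2 by rewrite !addr_ge0 // mulr_ge0.
have A0 : 0 <= A1 + A2 by exact: addr_ge0.
have [M M0 MH] := absorb_powers N A0 (mulr_gt0 c00 cs0).
exists (Vm * C + M); first by rewrite addr_ge0 // mulr_ge0.
move=> th v Y fv dfv Vx b1 b2 g1 g2 /andP[th0 th1] Y1 v1 vY dC dY fv0 fC sup cV VV.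
rewrite -/k -/K3 -/K2 => b1E b2E g1E g2E; rewrite -b2E in g1E.
have Y0 : 0 < Y by exact: lt_le_trans Y1.
have v0 : 0 < v by exact: lt_le_trans v1.
have {}MH := MH th Y v (introT andP (conj (ltW th0) th1)) Y1 v1 vY.
rewrite -/k -b2E in MH.
have Vx0 : 0 < Vx by exact: lt_le_trans cV.
have b10 : 0 < b1 by rewrite b1E exprn_gt0.
have b20 : 0 < b2 by rewrite b2E exprn_gt0.
have b11 : b1 <= 1 by rewrite b1E exprn_ile1 // ltW.
have tk0 : 0 <= th ^+ k by rewrite exprn_ge0 // ltW.
have Yn m : 1 <= Y ^+ m by exact: exprn_ege1.
have E1 : Vx * (- b1 * dfv) <= Vm * C.
  apply: (@le_trans _ _ (Vx * C)); last by rewrite ler_wpM2r.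
  rewrite ler_pM2l // mulNr -mulrN.
  have [d0|d0] := leP 0 (- dfv).
    by apply: (@le_trans _ _ (- dfv)); [rewrite ler_piMl|lra].
  by apply: (le_trans _ C0); rewrite pmulr_rle0 // ltW.
have b2k : b2 = th ^+ k * th ^+ 2 by rewrite b2E exprD.
have b2tk : b2 <= th ^+ k by rewrite b2k ler_piMr // exprn_ile1 // ltW.
have Y30 : 0 < Y ^+ 3 by exact: exprn_gt0.
have E2 : Vx * (b2 * (Y ^+ 3 * (q * fv - v * dfv))) <=
    Vm * C2 * (v * th ^+ k * Y ^+ 3) - c0 * cs * (v * b2 * Y ^+ 7).
  apply: (@le_trans _ _ (Vx * (b2 * (Y ^+ 3 * (C2 - cs * (v * Y ^+ 4)))))).
    by rewrite !ler_pM2l //; lra.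
  have -> : Vx * (b2 * (Y ^+ 3 * (C2 - cs * (v * Y ^+ 4)))) =
     Vx * C2 * (b2 * Y ^+ 3) - Vx * (cs * (v * b2 * Y ^+ 7)) by ring.
  apply: lerB; last first.
    rewrite -mulrA ler_wpM2r // !mulr_ge0 ?exprn_ge0 // ltW //.
  apply: ler_pM; [by rewrite mulr_ge0 // ltW|by rewrite mulr_ge0 ?exprn_ge0 // ltW|by rewrite ler_wpM2r|].
  rewrite ler_pM2r //; apply: (le_trans b2tk); rewrite mulrC; exact: ler_peMr.
have E3 : 2 * nu / sg * (g1 * (1 + fv) + g2 * (v * Y ^+ 3)) <=
   2 * nu / sg * (K3 * (1 + C)) * (v * b2 * Y ^+ 5) +
   2 * nu / sg * K2 * (v * th ^+ k * Y ^+ 3).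
  rewrite -[_ * (K3 * _) * _]mulrA -[_ * K2 * _]mulrA -mulrDr.
  apply: ler_wpM2l => //; apply: lerD.
    have f1 : 1 + fv <= (1 + C) * (v * Y ^+ 5).
      have Yv : 1 <= v * Y ^+ 4 by rewrite -[leLHS]mulr1; apply: ler_pM.
      have : (1 + C) * (v * Y ^+ 4) <= (1 + C) * (v * Y ^+ 5).
        rewrite ler_wpM2l //; first lra.
        by rewrite ler_pM2l // ler_weXn2l.
      lra.
    have -> : K3 * (1 + C) * (v * b2 * Y ^+ 5) = g1 * ((1 + C) * (v * Y ^+ 5)).
      by rewrite g1E; ring.
    by rewrite ler_wpM2l // g1E mulr_ge0 // ltW.
  have -> : g2 * (v * Y ^+ 3) = K2 * (v * th ^+ k * Y ^+ 3) * th.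
    by rewrite g2E exprD expr1; ring.
  by rewrite ler_piMr // !mulr_ge0 ?exprn_ge0 // ltW.
have E4 : 4 / sg * (g1 * dfv + g2 * (q * Y ^+ 3)) ^+ 2 /
      (b2 * (q * (q - 1) * Y ^+ 3 / v)) <=
   8 / sg * (K3 ^+ 2 * C ^+ 2) / (q * (q - 1)) * (v * b2 * Y ^+ 5) +
   8 / sg * (K2 ^+ 2 * q ^+ 2) / (q * (q - 1)) * (v * th ^+ k * Y ^+ 3).
  have den : 0 < b2 * (q * (q - 1) * Y ^+ 3 / v).
    by rewrite mulr_gt0 // divr_gt0 // mulr_gt0.
  rewrite ler_pdivrMr //.
  have -> : (8 / sg * (K3 ^+ 2 * C ^+ 2) / (q * (q - 1)) * (v * b2 * Y ^+ 5) +
     8 / sg * (K2 ^+ 2 * q ^+ 2) / (q * (q - 1)) * (v * th ^+ k * Y ^+ 3)) *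
     (b2 * (q * (q - 1) * Y ^+ 3 / v)) =
     4 / sg * (2 * (K3 * b2 * (C * Y ^+ 4)) ^+ 2 +
        2 * (K2 ^+ 2 * (th ^+ k * b2) * (q * Y ^+ 3) ^+ 2)).
    field; rewrite !gt_eqF //; lra.
  have s4 : 0 <= 4 / sg by rewrite divr_ge0 // ltW.
  apply: ler_wpM2l => //.
  (* The exponents balance: the square of th^(k+1) is th^k b2, so division by b2 leaves the weight
     th^k. *)
  have g22 : g2 ^+ 2 = K2 ^+ 2 * (th ^+ k * b2).
    by rewrite g2E b2k exprD expr1; ring.
  apply: (@le_trans _ _ (2 * (g1 * dfv) ^+ 2 + 2 * (g2 * (q * Y ^+ 3)) ^+ 2)).
    by have := sqr_ge0 (g1 * dfv - g2 * (q * Y ^+ 3)); lra.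
  rewrite [(g2 * _) ^+ 2]exprMn g22 lerD2r ler_pM2l //.
  rewrite g1E -[leLHS]real_normK ?num_real // lerXn2r ?nnegrE //.
    by rewrite !mulr_ge0 ?exprn_ge0 // ltW.
  rewrite normrM ger0_norm; last by rewrite mulr_ge0 // ltW.
  by rewrite ler_wpM2l // mulr_ge0 // ltW.
have X1 : 0 <= v * b2 * Y ^+ 5 by rewrite !mulr_ge0 ?exprn_ge0 // ltW.
have X2 : 0 <= v * th ^+ k * Y ^+ 3 by rewrite !mulr_ge0 ?exprn_ge0 // ltW.
have Z1 : A1 * (v * b2 * Y ^+ 5) <= (A1 + A2) * (v * b2 * Y ^+ 5).
  by rewrite ler_wpM2r // lerDl.
have Z2 : A2 * (v * th ^+ k * Y ^+ 3) <= (A1 + A2) * (v * th ^+ k * Y ^+ 3).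
  by rewrite ler_wpM2r // lerDr.
rewrite mulrDr.
apply: le_trans (lerD (lerD (lerD E1 E2) E3) E4) _.
rewrite [leLHS](_ : _ = Vm * C + (A1 * (v * b2 * Y ^+ 5) +
    A2 * (v * th ^+ k * Y ^+ 3) - c0 * cs * (v * b2 * Y ^+ 7))); last first.
  by rewrite /A1 /A2; ring.
rewrite lerD2l lerBlDl; exact: le_trans (lerD Z1 Z2) MH.
Qed.

(** The second derivative along a line of the minorant used in the comparison: quadratics stand for
    the powers of the cut-off, and an affine function of [U] stands for 1 + f. *)
Lemma is_derive_cutoff (R : realType) (U U1 : R -> R)
    (U2 B1 a1 c1 B2 a2 c2 F0 g q k e u : R) :
  (\forall h \near (0 : R), is_derive (h : R) 1 U (U1 h)) ->
  is_derive (0 : R) 1 U1 U2 -> (\forall h \near (0 : R), 0 <= U h) ->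
  U 0 = u ->
  exists dZ : R -> R,
    (\forall h \near (0 : R), is_derive (h : R) 1 (fun h : R =>
       k + e * ((B1 + a1 * h + c1 * h ^+ 2) * (F0 + g * (U h - u)) +
                (B2 + a2 * h + c2 * h ^+ 2) * (1 + U h) `^ q)) (dZ h)) /\
    is_derive (0 : R) 1 dZ (e * (2 * c1 * F0 + 2 * a1 * (g * U1 0) + B1 * (g * U2)
      + 2 * c2 * (1 + u) `^ q + 2 * a2 * (q * (1 + u) `^ (q - 1) * U1 0)
      + B2 * (q * (q - 1) * (1 + u) `^ (q - 2) * U1 0 ^+ 2
              + q * (1 + u) `^ (q - 1) * U2))).
Proof.
move=> DU DU1 U_ge0 U0u.
pose b1 h : R := B1 + a1 * h + c1 * h ^+ 2.
pose b2 h : R := B2 + a2 * h + c2 * h ^+ 2.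
pose db1 h : R := a1 + 2 * c1 * h.
pose db2 h : R := a2 + 2 * c2 * h.
have Db1 (h : R) : is_derive h 1 b1 (db1 h) by exact: is_derive1_quad.
have Db2 (h : R) : is_derive h 1 b2 (db2 h) by exact: is_derive1_quad.
have Dl (a c : R) : is_derive (0 : R) 1 (fun h : R => a + 2 * c * h) (2 * c).
  have D := is_derive1_quad a (2 * c) 0 0.
  rewrite (_ : (fun h : R => _) = fun s => a + 2 * c * s + 0 * s ^+ 2); last first.
    by apply/funext => y; rewrite mul0r addr0.
  by apply: (is_derive_eq D); rewrite mulr0 addr0.
have Dv (h : R) : is_derive h 1 U (U1 h) -> is_derive h 1 (fun h => 1 + U h) (U1 h).
  by move=> D; have := is_derive1_add (is_derive_cst (1 : R) h 1) D; rewrite add0r.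
have DF (h : R) : is_derive h 1 U (U1 h) ->
    is_derive h 1 (fun h => F0 + g * (U h - u)) (g * U1 h).
  move=> D; have D1 := is_derive1_sub D (is_derive_cst u h 1).
  have D2 := is_derive1_add (is_derive_cst F0 h 1) (is_derive1_cmul g D1).
  by apply: (is_derive_eq D2); rewrite subr0 add0r.
exists (fun h => e * (db1 h * (F0 + g * (U h - u)) + b1 h * (g * U1 h) +
   (db2 h * (1 + U h) `^ q + b2 h * (q * (1 + U h) `^ (q - 1) * U1 h)))).
split.
  apply: filterS2 DU U_ge0 => h D Uh.
  have v0 : 0 < 1 + U h by rewrite ltr_pwDl.
  rewrite -[e * (_ + _)]add0r; apply: (is_derive1_add (is_derive_cst k h 1)).
  apply: is_derive1_cmul; apply: is_derive1_add.
    by apply: is_derive1_mul => //; exact: DF.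
  by apply: is_derive1_mul => //; apply: is_derive1_powR_comp => //; exact: Dv.
have D0 := nbhs_singleton DU; have Uh := nbhs_singleton U_ge0.
have v0 : 0 < 1 + U 0 by rewrite ltr_pwDl.
have E1 := is_derive1_mul (Dl a1 c1) (DF 0 D0).
have E2 := is_derive1_mul (Db1 0) (is_derive1_cmul g DU1).
have E3 := is_derive1_mul (Dl a2 c2) (is_derive1_powR_comp q (Dv 0 D0) v0).
have E4 := is_derive1_mul (Db2 0) (is_derive1_mul
  (is_derive1_cmul q (is_derive1_powR_comp (q - 1) (Dv 0 D0) v0)) DU1).
have E := is_derive1_cmul e (is_derive1_add (is_derive1_add E1 E2) (is_derive1_add E3 E4)).
apply: (is_derive_eq E).
rewrite /db1 /db2 /b1 /b2 U0u (_ : q - 1 - 1 = q - 2); last by ring.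
ring.
Qed.

Lemma complete_square (R : realFieldType) (a c x U : R) : 0 < c ->
  a * x * U - c * U ^+ 2 <= a ^+ 2 / (4 * c) * x ^+ 2.
Proof.
move=> c0; rewrite -subr_ge0.
have -> : a ^+ 2 / (4 * c) * x ^+ 2 - (a * x * U - c * U ^+ 2) =
  (a * x - 2 * c * U) ^+ 2 / (4 * c) by field; rewrite gt_eqF.
by rewrite divr_ge0 ?sqr_ge0 // mulr_ge0 // ltW.
Qed.

(** * The differential inequality at a touching point *)

Section CutoffTouching.
Context {R : realType} {n : nat} {T : R} {Omega : set 'rV[R]_n}
  {V : 'rV[R]_n -> R} {f fp : R -> R} {u : R -> 'rV[R]_n -> R}.
Hypotheses (oO : open Omega) (V_ge0 : forall x, Omega x -> 0 <= V x)
  (f_tangent : forall a b, 0 <= a -> 0 <= b -> f a + fp a * (b - a) <= f b)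
  (u_sol : classical_solution T Omega V f u)
  (u_ge0 : forall (t : R) x, 0 < t < T -> Omega x -> 0 <= u t x)
  (ut_ge0 : forall (t : R) x, 0 < t < T -> Omega x -> 0 <= time_deriv u t x).

(* At the touching point (t, x) the comparison function is replaced by a minorant
   that is affine in f(u), so that f'' never appears, and quadratic in space
   (Bernoulli's inequality for the powers of the cut-off centred at y). *)
Lemma cutoff_touching (tau t : R) (x y : 'rV[R]_n)
    (B1 G1 B2 G2 sg q eps C' K lam t0 m e : R) :
  0 < tau -> 0 < t -> t + tau < T -> Omega x ->
  m + eps * C' * expR (- (K + 1) * (t - t0)) +
    eps * (B1 * (1 + f (u t x)) + B2 * (1 + u t x) `^ q) = tquot u tau t x ->
  0 < e ->
  (forall s, t - e < s -> s <= t ->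
    m * expR (lam * (s - t)) + eps * C' * expR (- (K + 1) * (s - t0)) +
    eps * (B1 * ((1 + f (u t x)) + fp (u t x) * (u s x - u t x)) +
           B2 * (1 + u s x) `^ q) <= tquot u tau s x) ->
  (forall i, \forall h \near (0 : R),
    m + eps * C' * expR (- (K + 1) * (t - t0)) +
    eps * ((B1 + (- (2 * G1 * (x - y) 0 i / sg)) * h + (- (G1 / sg)) * h ^+ 2) *
             ((1 + f (u t x)) + fp (u t x) * (u t (line x i h) - u t x)) +
           (B2 + (- (2 * G2 * (x - y) 0 i / sg)) * h + (- (G2 / sg)) * h ^+ 2) *
             (1 + u t (line x i h)) `^ q) <= tquot u tau t (line x i h)) ->
  0 < sg -> esq (x - y) <= sg -> 0 < B2 -> 1 < q ->
  0 < eps -> 0 <= C' -> m < 0 -> V x * fp (u t x) < lam ->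
  - K <= V x * fp (u t x) ->
  0 < V x * (- B1 * fp (u t x) + B2 * (q * (1 + u t x) `^ (q - 1) * f (u t x)
        - fp (u t x) * (1 + u t x) `^ q)) +
    2 * n%:R / sg * (G1 * (1 + f (u t x)) + G2 * (1 + u t x) `^ q) +
    4 / sg * (G1 * fp (u t x) + G2 * (q * (1 + u t x) `^ (q - 1))) ^+ 2 /
      (B2 * (q * (q - 1) * (1 + u t x) `^ (q - 2))) -
    C' * expR (- (K + 1) * (t - t0)).
Proof.
move=> tau0 tpos tT Ox.
set U := u t x; set v := 1 + U; set F0 := 1 + f U; set g := fp U.
set k := eps * C' * _ => H0 e0 H1 H2 sg0 xy B20 q1 eps0 C'0 m0 lamV KV.
have tT1 : 0 < t < T.
  by rewrite tpos; apply: lt_trans tT; rewrite ltrDl.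
have U0 : 0 <= U by exact: u_ge0.
have v0 : 0 < v by rewrite ltr_pwDl.
have [uC ueq] := u_sol.
pose a1 i := - (2 * G1 * (x - y) 0 i / sg).
pose a2 i := - (2 * G2 * (x - y) 0 i / sg).
pose Ui i := partial i (u t) x; pose Uii i := partial i (partial i (u t)) x.
pose Zxx i := eps * (2 * (- (G1 / sg)) * F0 + 2 * a1 i * (g * Ui i) + B1 * (g * Uii i)
      + 2 * (- (G2 / sg)) * v `^ q + 2 * a2 i * (q * v `^ (q - 1) * Ui i)
      + B2 * (q * (q - 1) * v `^ (q - 2) * Ui i ^+ 2 + q * v `^ (q - 1) * Uii i)).
have sp i : exists dZ : R -> R,
    (\forall h \near (0 : R), is_derive (h : R) 1 (fun h : R => m + k +
      eps * ((B1 + a1 i * h + (- (G1 / sg)) * h ^+ 2) * (F0 + g * (u t (line x i h) - U)) +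
             (B2 + a2 i * h + (- (G2 / sg)) * h ^+ 2) * (1 + u t (line x i h)) `^ q))
      (dZ h)) /\ is_derive (0 : R) 1 dZ (Zxx i).
  have [||||dZ D] := @is_derive_cutoff R (fun h => u t (line x i h))
    (fun h => partial i (u t) (line x i h)) (Uii i) B1 (a1 i) (- (G1 / sg))
    B2 (a2 i) (- (G2 / sg)) F0 g q (m + k) eps U.
  - exact: (solution_dx oO uC i tT1 Ox).
  - exact: (solution_dxx uC).
  - have : \forall h \near (0 : R), Omega (line x i h).
      by apply: near_line; exact: open_nbhs_nbhs.
    by apply: filterS => h; exact: u_ge0.
  - by rewrite line0.
  by exists dZ; move: D; rewrite line0.
have [dZ DZ] := choice sp.
have Dt : is_derive t 1 (u ^~ x) (time_deriv u t x) by exact: (solution_dt uC).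
have DE (l t1 : R) : is_derive t 1 (fun s => expR (l * (s - t1))) (l * expR (l * (t - t1))).
  exact: is_derive1_expR_lin.
have DF : is_derive t 1 (fun s => F0 + g * (u s x - U)) (g * time_deriv u t x).
  have D1 := is_derive1_sub Dt (is_derive_cst U t 1).
  have D2 := is_derive1_add (is_derive_cst F0 t 1) (is_derive1_cmul g D1).
  by apply: (is_derive_eq D2); rewrite subr0 add0r.
have Dv : is_derive t 1 (fun s => 1 + u s x) (time_deriv u t x).
  by have := is_derive1_add (is_derive_cst (1 : R) t 1) Dt; rewrite add0r.
have DZ1 := is_derive1_add (is_derive1_add (is_derive1_cmul m (DE lam t))
   (is_derive1_cmul (eps * C') (DE (- (K + 1)) t0)))
  (is_derive1_cmul eps (is_derive1_add (is_derive1_cmul B1 DF)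
     (is_derive1_cmul B2 (is_derive1_powR_comp q Dv v0)))).
have e1 : m * expR (lam * (t - t)) + eps * C' * expR (- (K + 1) * (t - t0)) +
    eps * (B1 * (F0 + g * (u t x - U)) + B2 * (1 + u t x) `^ q) = tquot u tau t x.
  by rewrite -H0 !subrr !mulr0 expR0 mulr1 addr0.
have e3 i : m + k + eps * ((B1 + a1 i * 0 + (- (G1 / sg)) * 0 ^+ 2) *
       (F0 + g * (u t (line x i 0) - U)) +
     (B2 + a2 i * 0 + (- (G2 / sg)) * 0 ^+ 2) * (1 + u t (line x i 0)) `^ q) = tquot u tau t x.
  by rewrite -H0 line0 !subrr !expr0n /= !mulr0 !addr0.
have Q := quot_touching oO V_ge0 f_tangent u_sol u_ge0 tau0 tpos tT Ox DZ1 e1 e0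
  H1 (fun i => (DZ i).1) (fun i => (DZ i).2) e3 H2.
rewrite subrr mulr0 expR0 mulr1 in Q.
pose W := G1 * g + G2 * (q * v `^ (q - 1)).
pose c := B2 * (q * (q - 1) * v `^ (q - 2)).
have c0 : 0 < c.
  by rewrite /c !mulr_gt0 ?powR_gt0 // ?subr_gt0 //; apply: lt_trans q1.
(* [c] > 0 is the coefficient of |grad u|^2 supplied by the convexity of (1+u)^q, which needs q > 1;
   the cross terms with the gradient of the cut-off are absorbed by completing the square. *)
pose S := \sum_(i < n) (4 / sg * W * (x - y) 0 i * Ui i - c * Ui i ^+ 2).
have SZ : \sum_(i < n) Zxx i = eps * (- (2 * n%:R / sg * (G1 * F0 + G2 * v `^ q)) +
    (B1 * g + B2 * (q * v `^ (q - 1))) * laplacian (u t) x - S).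
  rewrite /laplacian /S /Zxx -mulr_sumr; congr (_ * _).
  rewrite [(B1 * g + _) * _]mulr_sumr.
  have -> : - (2 * n%:R / sg * (G1 * F0 + G2 * v `^ q)) =
      \sum_(i < n) - (2 / sg * (G1 * F0 + G2 * v `^ q)).
    rewrite sumr_const card_ord -[RHS]mulr_natr; ring.
  rewrite -big_split -sumrB /=; apply: eq_bigr => i _.
  rewrite /W /c /Ui /Uii /a1 /a2; by field; rewrite gt_eqF.
have SW : S <= 4 / sg * W ^+ 2 / c.
  apply: (@le_trans _ _ ((4 / sg * W) ^+ 2 / (4 * c) * esq (x - y))).
    rewrite /esq mulr_sumr; apply: ler_sum => i _.
    by rewrite complete_square.
  have -> : 4 / sg * W ^+ 2 / c = (4 / sg * W) ^+ 2 / (4 * c) * sg.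
    by field; rewrite !gt_eqF.
  by rewrite ler_wpM2l // divr_ge0 ?sqr_ge0 // mulr_ge0 // ltW.
have ut := ueq t x tT1 Ox.
rewrite SZ ut -H0 -/g -/v in Q.
set P := 2 * n%:R / sg * (G1 * F0 + G2 * v `^ q) in Q *.
rewrite /k in Q; move: Q; set E := expR _; set L := laplacian _ _.
set Gq := v `^ q; set G' := q * v `^ (q - 1) => Q.
have E0 : 0 <= C' * E by rewrite mulr_ge0 // expR_ge0.
(* u_t and the laplacian carry the same coefficient, so the equation turns their difference into V
   f(u). Strictness comes from m < 0 and V f'(u) < lam. *)
have X0 : 0 < eps * (V x * (- B1 * g + B2 * (G' * f U - g * Gq)) + P + S
    - C' * ((K + 1 + V x * g) * E)).
  have : 0 < m * (V x * g - lam) by rewrite nmulr_rgt0 // subr_lt0.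
  move/lt_le_trans; apply; rewrite -subr_ge0; rewrite -subr_ge0 in Q.
  by move: Q; congr (0 <= _); rewrite /F0 -/U; ring.
rewrite pmulr_rgt0 // in X0; apply: (lt_le_trans X0).
apply: lerB; first by rewrite lerD2l.
have : 0 <= (K + V x * g) * (C' * E) by rewrite mulr_ge0 // -lerBlDl sub0r.
by rewrite -subr_ge0 => H; rewrite -subr_ge0; move: H; congr (0 <= _); ring.
Qed.

End CutoffTouching.

(** Since q - 1 = 3(p - 1)/4, every power in the comparison is an integer power of [Y], times 1, v
    or 1/v. *)
Lemma powR_quarter (R : realType) (p v : R) : 1 < p -> 1 <= v ->
  let q := (3 * p + 1) / 4 in let Y := v `^ ((p - 1) / 4) in
  [/\ 1 <= Y, v `^ (p - 1) = Y ^+ 4, v `^ p = v * Y ^+ 4, v `^ (q - 1) = Y ^+ 3 &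
      v `^ q = v * Y ^+ 3 /\ v `^ (q - 2) = Y ^+ 3 / v].
Proof.
move=> p1 v1 q Y; have v0 : 0 < v by exact: lt_le_trans v1.
have YX m : Y ^+ m = v `^ ((p - 1) / 4 * m%:R) by rewrite powRrM powR_mulrn ?powR_ge0.
have E1 : v `^ (q - 1) = Y ^+ 3 by rewrite YX; congr (_ `^ _); rewrite /q; field.
have E2 : v `^ (p - 1) = Y ^+ 4 by rewrite YX; congr (_ `^ _); field.
split=> //.
- by rewrite -(powRr0 v); apply: ler_powR => //; rewrite divr_ge0 // subr_ge0 ltW.
- by rewrite -E2 mulr_powRB1 ?ltW //; exact: lt_trans p1.
split.
  by rewrite -E1 mulr_powRB1 ?ltW // /q divr_gt0 // addr_gt0 // mulr_gt0 // (lt_trans ltr01).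
rewrite -E1 (_ : q - 2 = q - 1 - 1); last by ring.
by rewrite [LHS]powRB ?powRr1 ?(gt_eqF v0) ?implybT // ltW.
Qed.

(** v is the power 4/(p-1) of v^((p-1)/4), and any integer above 4/(p-1) serves. *)
Lemma powR_quarter_bound (R : realType) (p : R) : 1 < p ->
  exists N : nat, forall v : R, 1 <= v -> v <= (v `^ ((p - 1) / 4)) ^+ N.
Proof.
move=> p1; have a0 : 0 < (p - 1) / 4 by rewrite divr_gt0 // subr_gt0.
exists (Num.bound ((p - 1) / 4)^-1) => v v1.
have v0 : 0 <= v by rewrite (le_trans _ v1).
rewrite -powR_mulrn ?powR_ge0 // -powRrM -[leLHS]powRr1 //.
apply: ler_powR => //; rewrite mulrC -ler_pdivrMr // div1r.
by apply/ltW/archi_boundP; rewrite invr_ge0 ltW.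
Qed.

(** If C2 - cs v Y^4 is positive, then Y^3 <= C2/cs, so the product is bounded; otherwise it is
    nonpositive. *)
Lemma plateau_alg (R : realFieldType) (cs C2 Y v g F q : R) :
  0 < cs -> 0 <= C2 -> 1 <= Y -> 1 <= v ->
  cs * (v * Y ^+ 4) - C2 <= v * g - q * F ->
  q * Y ^+ 3 * F - g * (v * Y ^+ 3) <= C2 * (C2 / cs).
Proof.
move=> cs0 C20 Y1 v1 h4.
have r0 : 0 <= C2 * (C2 / cs) by rewrite mulr_ge0 // divr_ge0 // ltW.
have Y0 : 0 < Y by exact: lt_le_trans Y1.
have v0 : 0 < v by exact: lt_le_trans v1.
have Y30 : 0 < Y ^+ 3 by exact: exprn_gt0.
have -> : q * Y ^+ 3 * F - g * (v * Y ^+ 3) = Y ^+ 3 * (q * F - v * g) by ring.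
have H : q * F - v * g <= C2 - cs * (v * Y ^+ 4) by lra.
apply: (@le_trans _ _ (Y ^+ 3 * (C2 - cs * (v * Y ^+ 4)))).
  by rewrite ler_pM2l.
have [neg|pos] := leP (C2 - cs * (v * Y ^+ 4)) 0.
  by apply: le_trans r0; rewrite pmulr_rle0.
have Y3 : Y ^+ 3 <= C2 / cs.
  rewrite ler_pdivlMr // mulrC; apply: ltW; rewrite subr_gt0 in pos.
  apply: le_lt_trans pos; rewrite ler_pM2l // [Y ^+ 4]exprS mulrA.
  apply: ler_peMl; first exact: ltW.
  by rewrite -[leLHS]mulr1; apply: ler_pM.
rewrite mulrC; apply: ler_pM => //; [exact: ltW|exact: ltW|].
rewrite gerBl; apply: mulr_ge0; first exact: ltW.
by apply: mulr_ge0; [exact: ltW|apply: exprn_ge0; exact: ltW].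
Qed.

Section CutoffBound.
Context {R : realType} {p C cs C2 : R} {f fp : R -> R}.
Hypotheses (p1 : 1 < p) (C0 : 0 <= C) (cs0 : 0 < cs) (C20 : 0 <= C2)
  (f_ge0 : forall s, 0 <= s -> 0 <= f s)
  (f_growth : forall s, 0 <= s -> [/\ - C <= fp s,
     `|fp s| <= C * (1 + s) `^ (p - 1) & f s <= C * (1 + s) `^ p])
  (f_super : forall s, 0 <= s ->
     cs * (1 + s) `^ p - C2 <= (1 + s) * fp s - (3 * p + 1) / 4 * f s).
Local Notation q := ((3 * p + 1) / 4).

Lemma cutoff_bound (c0 Vm nu sg : R) : 0 <= Vm -> 0 < c0 -> 0 <= nu -> 0 < sg ->
  exists N : nat, exists2 M : R, 0 <= M & forall th s Vx b1 b2 g1 g2 : R,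
    0 < th <= 1 -> 0 <= s -> c0 <= Vx -> Vx <= Vm ->
    b1 = th ^+ (2 * N.+1 + 3) -> b2 = th ^+ (2 * N.+1 + 2) ->
    g1 = (2 * N.+1 + 3)%:R * th ^+ (2 * N.+1 + 2) ->
    g2 = (2 * N.+1 + 2)%:R * th ^+ (2 * N.+1 + 1) ->
    Vx * (- b1 * fp s + b2 * (q * (1 + s) `^ (q - 1) * f s
        - fp s * (1 + s) `^ q)) +
    2 * nu / sg * (g1 * (1 + f s) + g2 * (1 + s) `^ q) +
    4 / sg * (g1 * fp s + g2 * (q * (1 + s) `^ (q - 1))) ^+ 2 /
      (b2 * (q * (q - 1) * (1 + s) `^ (q - 2))) <= M.
Proof.
move=> Vm0 c00 nu0 sg0; have [N NH] := powR_quarter_bound p1.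
have q1 : 1 < q by have p1' := p1; lra.
have [M M0 MH] := absorb_terms N C0 cs0 C20 Vm0 c00 nu0 sg0 q1.
exists N, M => // th s Vx b1 b2 g1 g2 th01 s0 cV VV b1E b2E g1E g2E.
have v1 : 1 <= 1 + s by rewrite lerDl.
have [Y1 E1 E2 E3 [E4 E5]] := powR_quarter p1 v1.
have [h1 h2 h3] := f_growth s0; have h4 := f_super s0.
rewrite E1 in h2; rewrite E2 in h3 h4.
have := MH th _ _ (f s) (fp s) Vx b1 b2 g1 g2 th01 Y1 v1 (NH _ v1) h1 h2
  (f_ge0 s0) h3 h4 cV VV b1E b2E g1E g2E.
rewrite E3 E4 E5; apply: le_trans; rewrite le_eqVlt; apply/orP; left; apply/eqP.
by congr (_ * (_ + b2 * _) + _ + _ / (b2 * _)); ring.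
Qed.

(** The counterpart of [cutoff_bound] where the cut-off equals 1: there are no gradient errors, so
    [Vx] may be arbitrarily small. *)
Lemma plateau_bound (s Vx Vm : R) : 0 <= s -> 0 <= Vx -> Vx <= Vm ->
  Vx * (- fp s + (q * (1 + s) `^ (q - 1) * f s - fp s * (1 + s) `^ q)) <=
    Vm * (C + C2 * (C2 / cs)).
Proof.
move=> s0 V0 VV.
have v1 : 1 <= 1 + s by rewrite lerDl.
have v0 : 0 < 1 + s by rewrite (lt_le_trans _ v1).
have [Y1 E1 E2 E3 [E4 E5]] := powR_quarter p1 v1.
have [h1 _ _] := f_growth s0; have h4 := f_super s0.
have r0 : 0 <= C2 * (C2 / cs) by rewrite mulr_ge0 // divr_ge0 // ltW.
apply: (@le_trans _ _ (Vx * (C + C2 * (C2 / cs)))); last first.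
  by rewrite ler_wpM2r // addr_ge0.
apply: ler_wpM2l => //; apply: lerD; first by rewrite lerNl.
by rewrite E3 E4; apply: plateau_alg => //; rewrite -E2.
Qed.

End CutoffBound.

(** * Comparison of u_t with f(u) *)

Section Comparison.
Context {R : realType} {n : nat} {T p C cs C2 : R} {Omega : set 'rV[R]_n}
  {V : 'rV[R]_n -> R} {f fp : R -> R} {u : R -> 'rV[R]_n -> R}.
Hypotheses (oO : open Omega) (V_ge0 : forall x, Omega x -> 0 <= V x)
  (f_tangent : forall a b, 0 <= a -> 0 <= b -> f a + fp a * (b - a) <= f b)
  (u_sol : classical_solution T Omega V f u)
  (u_ge0 : forall (t : R) x, 0 < t < T -> Omega x -> 0 <= u t x)
  (ut_ge0 : forall (t : R) x, 0 < t < T -> Omega x -> 0 <= time_deriv u t x)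
  (p1 : 1 < p) (C0 : 0 <= C) (cs0 : 0 < cs) (C20 : 0 <= C2)
  (f_ge0 : forall s, 0 <= s -> 0 <= f s)
  (f_growth : forall s, 0 <= s -> [/\ - C <= fp s,
     `|fp s| <= C * (1 + s) `^ (p - 1) & f s <= C * (1 + s) `^ p])
  (f_super : forall s, 0 <= s ->
     cs * (1 + s) `^ p - C2 <= (1 + s) * fp s - (3 * p + 1) / 4 * f s)
  (f_cont : continuous (fun s : R => f (Num.max s 0))).
Local Notation q := ((3 * p + 1) / 4).

Lemma solution_bound (B : set 'rV[R]_n) (t : R) : compact B -> B `<=` Omega ->
  0 < t < T -> exists2 M : R, 0 <= M & forall x, B x -> u t x <= M.
Proof.
move=> cB BO tT; have [B0|/set0P/negP/negPn/eqP ->] := pselect (B !=set0); last by exists 0.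
have uC : {within B, continuous (u t)}.
  apply: continuous_in_subspaceT => x /set_mem/BO Ox.
  apply: (@continuous_comp _ _ _ (fun x => (t, x)) (fun z : R * 'rV[R]_n => u z.1 z.2)).
    have a1 : (cst t : 'rV[R]_n -> R) @ x --> t by exact: cst_continuous.
    have a2 : (id : 'rV[R]_n -> 'rV[R]_n) @ x --> x by exact: cvg_id.
    exact: (cvg_pair a1 a2).
  exact: (solution_continuous oO u_sol.1).
have [x0 /set_mem Bx0 H] := compact_EVT_max B0 cB uC.
exists (u t x0); first by apply: u_ge0 => //; exact: BO.
by move=> x Bx; apply: H; exact/mem_set.
Qed.

Lemma quot_lower (B : set 'rV[R]_n) (t0 e0 tau t : R) x : 0 < t0 -> B `<=` Omega ->
  (forall t y, t0 <= t -> t < T -> B y -> e0 <= time_deriv u t y) ->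
  0 < tau -> t0 <= t -> t + tau < T -> B x -> e0 <= tquot u tau t x.
Proof.
move=> t00 BO H tau0 t0t tT Bx.
have tpos : 0 < t by exact: lt_le_trans t0t.
have tlt : t < t + tau by rewrite ltrDl.
have [s /andP[s1 s2] E] := solution_mvt u_sol tpos tlt tT (BO _ Bx).
rewrite /tquot E addrAC subrr add0r mulfK ?gt_eqF //.
by apply: H => //; [exact: (le_trans t0t (ltW s1))|exact: lt_trans tT].
Qed.

(* The centre y of the cut-off ranges over D. At a minimum with V x < c0 the point
   x is interior to D, so y = x is admissible and all derivatives of the cut-off
   vanish; elsewhere V x >= c0 and the superlinear term absorbs the cut-off errors. *)
Lemma comparison_step (D B : set 'rV[R]_n) (sg c0 Vm t0 T1 tau e0 eps C' : R) (N : nat) :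
  compact D -> compact B -> B `<=` Omega -> 0 < sg ->
  (forall x y, D y -> esq (x - y) <= sg -> B x) ->
  (forall x, B x -> V x <= Vm) ->
  (forall x, B x -> V x < c0 -> nbhs x D) -> 0 < t0 -> 0 <= Vm ->
  (forall t y, t0 <= t -> t < T -> B y -> e0 <= time_deriv u t y) ->
  0 < eps -> 0 <= C' -> eps * C' <= e0 ->
  (forall x, B x -> eps * (1 + f (u t0 x) + (1 + u t0 x) `^ q + C') <= e0) ->
  (forall th s Vx b1 b2 g1 g2 : R,
    0 < th <= 1 -> 0 <= s -> c0 <= Vx -> Vx <= Vm ->
    b1 = th ^+ (2 * N.+1 + 3) -> b2 = th ^+ (2 * N.+1 + 2) ->
    g1 = (2 * N.+1 + 3)%:R * th ^+ (2 * N.+1 + 2) ->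
    g2 = (2 * N.+1 + 2)%:R * th ^+ (2 * N.+1 + 1) ->
    Vx * (- b1 * fp s + b2 * (q * (1 + s) `^ (q - 1) * f s
        - fp s * (1 + s) `^ q)) +
    2 * n%:R / sg * (g1 * (1 + f s) + g2 * (1 + s) `^ q) +
    4 / sg * (g1 * fp s + g2 * (q * (1 + s) `^ (q - 1))) ^+ 2 /
      (b2 * (q * (q - 1) * (1 + s) `^ (q - 2))) <=
      C' * expR (- (Vm * C + 1) * (T - t0))) ->
  (forall s Vx, 0 <= s -> 0 <= Vx -> Vx <= Vm ->
    Vx * (- fp s + (q * (1 + s) `^ (q - 1) * f s - fp s * (1 + s) `^ q)) <=
    C' * expR (- (Vm * C + 1) * (T - t0))) ->
  t0 <= T1 -> 0 < tau -> T1 + tau < T ->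
  forall t x, t0 <= t -> t <= T1 -> D x ->
  eps * (1 + f (u t x)) <= tquot u tau t x.
Proof.
move=> cD cB BO sg0 DB VVm VD t00 Vm0 ute eps0 C'0 epsC' init bd1 bd2 t0T1 tau0 T1T.
pose K := Vm * C; pose k := (2 * N.+1)%N.
pose E t := expR (- (K + 1) * (t - t0)).
pose th (x y : 'rV[R]_n) := 1 - esq (x - y) / sg.
pose fm s := f (Num.max s 0).
(* Z increases with the cut-off, so minimising over y selects the best centre. The summand with [E]
   has a decay that dominates the bounded errors left by the absorption. *)
pose Z t x y := eps * (th x y ^+ (k + 3) * (1 + fm (u t x)) +
                       th x y ^+ (k + 2) * (1 + u t x) `^ q) + eps * C' * E t.
have T1lt : T1 < T by apply: le_lt_trans T1T; rewrite lerDl ltW.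
have T10 : 0 < T1 by exact: lt_le_trans t0T1.
have [U U0 UB] : exists2 M : R, 0 <= M & forall x, B x -> u T1 x <= M.
  by apply: solution_bound => //; rewrite T10.
(* u is nondecreasing in time, so [U] bounds it up to [T1] and [lam] exceeds V f'(u) there. It
   depends on [T1], but affects only the sign argument for the minimum. *)
pose lam := Vm * (C * (1 + U) `^ (p - 1)) + 1.
have tpos t : t0 <= t -> 0 < t by exact: lt_le_trans.
have tltT t : t <= T1 -> t < T by move=> h; exact: le_lt_trans T1lt.
have tT t : t0 <= t -> t <= T1 -> 0 < t < T by move=> h1 h2; rewrite tpos //= tltT.
have u0 t x : t0 <= t -> t <= T1 -> B x -> 0 <= u t x.
  by move=> h1 h2 /BO Ox; apply: u_ge0 => //; exact: tT.
have fmE t x : t0 <= t -> t <= T1 -> B x -> fm (u t x) = f (u t x).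
  by move=> h1 h2 Bx; rewrite /fm max_l // u0.
have q1 : 1 < q by have p1' := p1; lra.
have thB x y : D y -> 0 <= th x y -> B x.
  by move=> Dy; rewrite /th subr_ge0 ler_pdivrMr // mul1r; exact: DB.
have th_le1 x y : th x y <= 1 by rewrite gerBl divr_ge0 ?esq_ge0 // ltW.
have thxx x : th x x = 1.
  by rewrite /th esq_subrr ?mul0r ?subr0.
pose S : set ((R * 'rV[R]_n) * 'rV[R]_n) :=
  ((`[t0, T1]%classic `*` B) `*` D) `&` [set z | 0 <= th z.1.2 z.2].
pose F (z : (R * 'rV[R]_n) * 'rV[R]_n) :=
  expR (- lam * (z.1.1 - t0)) * (tquot u tau z.1.1 z.1.2 - Z z.1.1 z.1.2 z.2).
have thC (z : (R * 'rV[R]_n) * 'rV[R]_n) :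
    {for z, continuous (fun z : (R * 'rV[R]_n) * 'rV[R]_n => th z.1.2 z.2)}.
  have c1 : {for z, continuous (fun z : (R * 'rV[R]_n) * 'rV[R]_n => z.1.2)}.
    apply: (@continuous_comp _ _ _ fst snd); [exact: cvg_fst|exact: cvg_snd].
  have c2 : {for z, continuous (fun z : (R * 'rV[R]_n) * 'rV[R]_n => z.2)}.
    exact: cvg_snd.
  apply: cvgB; first exact: cvg_cst.
  apply: cvgMl; apply: (@continuous_comp _ _ _
    (fun z : (R * 'rV[R]_n) * 'rV[R]_n => z.1.2 - z.2) (@esq R n)).
    exact: (continuousB c1 c2).
  exact: continuous_esq.
have cS : compact S.
  apply: compact_closedI.
    by apply: compact_setX => //; apply: compact_setX => //; exact: segment_compact.
  apply: (@preimage_closed _ _ (fun z : (R * 'rV[R]_n) * 'rV[R]_n => th z.1.2 z.2)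
    [set y | 0 <= y]).
    by move=> z _; exact: thC.
  exact: closed_ge.
have SP t x y : t0 <= t -> t <= T1 -> D y -> 0 <= th x y -> S ((t, x), y).
  move=> h1 h2 Dy h3; split=> //; split=> //; split=> /=; first by rewrite in_itv /= h1.
  exact: thB h3.
have SO t x y : S ((t, x), y) -> [/\ t0 <= t, t <= T1, B x, D y & 0 <= th x y].
  by move=> [[[/=]]]; rewrite in_itv /= => /andP[h1 h2] h3 h4 h5.
have expC (l : R) : continuous (fun s : R => expR (l * (s - t0))).
  move=> s; have [D0 _] := is_derive1_expR_lin l t0 s.
  exact/differentiable_continuous/derivable1_diffP.
have FC : {within S, continuous F}.
  apply: continuous_in_subspaceT => -[[t x] y] /set_mem/SO[h1 h2 Bx Dy h3].
  pose z0 := ((t, x), y).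
  have uz : {for z0, continuous (fun z : (R * 'rV[R]_n) * 'rV[R]_n => u z.1.1 z.1.2)}.
    apply: (@continuous_comp _ _ _ fst (fun z : R * 'rV[R]_n => u z.1 z.2)).
      exact: cvg_fst.
    by apply: (solution_continuous oO u_sol.1); [exact: tT|exact: BO].
  have ez l : {for z0, continuous (fun z : (R * 'rV[R]_n) * 'rV[R]_n =>
      expR (l * (z.1.1 - t0)))}.
    apply: (@continuous_comp _ _ _ (fun z : (R * 'rV[R]_n) * 'rV[R]_n => z.1.1)
      (fun s : R => expR (l * (s - t0)))); last exact: expC.
    by apply: (@continuous_comp _ _ _ fst fst); [exact: cvg_fst|exact: cvg_fst].
  have tz k' : {for z0, continuous (fun z : (R * 'rV[R]_n) * 'rV[R]_n =>
      th z.1.2 z.2 ^+ k')}.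
    apply: (@continuous_comp _ _ _ (fun z : (R * 'rV[R]_n) * 'rV[R]_n => th z.1.2 z.2)
      (fun s : R => s ^+ k')); first exact: thC.
    exact: exprn_continuous.
  apply: cvgM; first exact: ez.
  apply: cvgB.
    apply: (@continuous_comp _ _ _ fst (fun z : R * 'rV[R]_n => tquot u tau z.1 z.2)).
      exact: cvg_fst.
    apply: (quot_continuous oO u_sol) => //; [exact: tpos| |exact: BO].
    by apply: le_lt_trans T1T; rewrite lerD2r.
  apply: cvgD; last by apply: cvgMr; exact: ez.
  apply: cvgMr; apply: cvgD.
    apply: cvgM; first exact: tz.
    apply: cvgD; first exact: cvg_cst.
    apply: (@continuous_comp _ _ _ (fun z : (R * 'rV[R]_n) * 'rV[R]_n => u z.1.1 z.1.2) fm).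
      exact: uz.
    exact: f_cont.
  apply: cvgM; first exact: tz.
  apply: (@continuous_comp _ _ _ (fun z : (R * 'rV[R]_n) * 'rV[R]_n => u z.1.1 z.1.2)
     (fun s : R => (1 + s) `^ q)); first exact: uz.
  have v0 : 0 < 1 + u t x by rewrite ltr_pwDl // u0.
  have D1 := is_derive1_add (is_derive_cst (1 : R) (u t x) 1) (is_derive_id (u t x) 1).
  have [D0 _] := is_derive1_powR_comp q D1 v0.
  exact/differentiable_continuous/derivable1_diffP.
suff main t x y : t0 <= t -> t <= T1 -> D y -> 0 <= th x y -> Z t x y <= tquot u tau t x.
  move=> t x h1 h2 Dx; have th0 : 0 <= th x x by rewrite thxx.
  apply: le_trans (main t x x h1 h2 Dx th0); have Bx := thB _ _ Dx th0.
  rewrite /Z thxx !expr1n !mul1r fmE // [eps * (_ + _ `^ _)]mulrDr -addrA lerDl.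
  rewrite addr_ge0 // ?mulr_ge0 ?powR_ge0 ?expR_ge0 //; exact: ltW.
move=> h1 h2 Dy h3.
have [|[[ts xs] ys] /set_mem Ss min] := @compact_EVT_min _ _ F S _ cS FC.
  by exists ((t, x), y); exact: SP.
have [a1 a2 Bxs Dys ths] := SO _ _ _ Ss.
pose m := tquot u tau ts xs - Z ts xs ys.
have E0 l s : 0 < expR (l * s) :> R by exact: expR_gt0.
suff m0 : 0 <= m.
  have := min _ (mem_set (SP _ _ _ h1 h2 Dy h3)); rewrite /F /= -/m => H.
  rewrite -subr_ge0 -(pmulr_rge0 _ (E0 (- lam) (t - t0))).
  by apply: le_trans H; rewrite mulr_ge0 // ltW.
(* Undoing the exponential weight of F: if m < 0, the quotient is touched from below by Z plus m
   exp(lam (t' - ts)). *)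
have minm t' x' y' : t0 <= t' -> t' <= T1 -> D y' -> 0 <= th x' y' ->
    m * expR (lam * (t' - ts)) + Z t' x' y' <= tquot u tau t' x'.
  move=> g1 g2 Dy' g3; have := min _ (mem_set (SP _ _ _ g1 g2 Dy' g3)).
  rewrite /F /= -/m -lerBrDr => H.
  rewrite -(ler_pM2l (E0 (- lam) (t' - t0))); apply: le_trans H.
  rewrite mulrC -mulrA -expRD mulrC; rewrite le_eqVlt; apply/orP; left; apply/eqP.
  by congr (expR _ * _); ring.
rewrite leNgt; apply/negP => mneg.
have tqlow : e0 <= tquot u tau ts xs.
  apply: quot_lower a1 _ Bxs => //.
  by apply: le_lt_trans T1T; rewrite lerD2r.
have tqE : tquot u tau ts xs = m + Z ts xs ys by rewrite /m subrK.
have Klo : 0 <= K + 1 by rewrite addr_ge0 // mulr_ge0.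
have E1 t' : t0 <= t' -> E t' <= 1.
  by move=> g1; rewrite -expR0 ler_expR mulNr oppr_le0 mulr_ge0 // subr_ge0.
have Zlt : e0 < Z ts xs ys.
  by apply: (le_lt_trans tqlow); rewrite tqE gtrDr.
(* With vanishing cut-off only eps C' E <= e0 would survive in Z, while a negative minimum forces Z
   > e0. The same contradiction excludes the initial time. *)
have ths0 : 0 < th xs ys.
  rewrite lt_neqAle ths andbT; apply: contraTneq Zlt => e.
  rewrite -leNgt /Z -e !addnS !expr0n /= !mul0r addr0 mulr0 add0r.
  by apply: le_trans epsC'; rewrite ler_piMr ?E1 // mulr_ge0 // ltW.
have us0 : 0 <= u ts xs by exact: u0.
have t0ts : t0 < ts.
  rewrite lt_neqAle a1 andbT; apply: contraTneq Zlt => e.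
  rewrite -leNgt; apply: le_trans (init xs Bxs); rewrite /Z -e fmE //.
  rewrite -mulrA -mulrDr ler_pM2l //.
  have us0' : 0 <= u t0 xs by rewrite e.
  have thn k' : th xs ys ^+ k' <= 1 by exact: exprn_ile1.
  apply: lerD; last by rewrite ler_piMr // E1.
  apply: lerD; last by rewrite ler_piMl ?powR_ge0.
  by rewrite ler_piMl // addr_ge0 // f_ge0.
have Vx0 : 0 <= V xs by apply: V_ge0; exact: BO.
have Vx1 : V xs <= Vm by exact: VVm.
have [fp1 fp2 _] := f_growth us0.
have KV : - K <= V xs * fp (u ts xs).
  apply: (@le_trans _ _ (V xs * (- C))); last by rewrite ler_wpM2l.
  by rewrite mulrN lerN2 ler_wpM2r.
have usU : u ts xs <= U.
  apply: le_trans (UB _ Bxs).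
  by apply: (solution_nondecreasing u_sol ut_ge0) => //; [exact: tpos|exact: BO].
have lamV : V xs * fp (u ts xs) < lam.
  apply: (@le_lt_trans _ _ (Vm * (C * (1 + U) `^ (p - 1)))); last by rewrite ltrDl.
  apply: (@le_trans _ _ (V xs * (C * (1 + U) `^ (p - 1)))); last first.
    by rewrite ler_wpM2r // mulr_ge0 ?powR_ge0.
  rewrite ler_wpM2l //; apply: (le_trans (ler_norm _)); apply: (le_trans fp2).
  rewrite ler_wpM2l //; apply: ge0_ler_powR; rewrite ?nnegrE ?subr_ge0 ?lerD2l //.
  - exact: ltW.
  - by rewrite addr_ge0.
  - by rewrite addr_ge0.
have tstau : ts + tau < T by apply: le_lt_trans T1T; rewrite lerD2r.
have ft s : 0 <= s -> 1 + f (u ts xs) + fp (u ts xs) * (s - u ts xs) <= 1 + fm s.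
  by move=> s0; rewrite -addrA lerD2l /fm max_l // f_tangent.
have Elow : C' * expR (- (Vm * C + 1) * (T - t0)) <= C' * E ts.
  rewrite ler_wpM2l // ler_expR !mulNr lerN2 ler_wpM2l // lerD2r.
  by rewrite ltW // tltT.
have Oxs := BO _ Bxs.
have e0pos : 0 < ts - t0 by rewrite subr_gt0.
have time_ok (B1 B2 : R) y' : D y' -> 0 <= th xs y' -> B1 = th xs y' ^+ (k + 3) ->
    B2 = th xs y' ^+ (k + 2) -> forall s, ts - (ts - t0) < s -> s <= ts ->
    m * expR (lam * (s - ts)) + eps * C' * expR (- (K + 1) * (s - t0)) +
    eps * (B1 * ((1 + f (u ts xs)) + fp (u ts xs) * (u s xs - u ts xs)) +
           B2 * (1 + u s xs) `^ q) <= tquot u tau s xs.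
  move=> Dy' thy -> -> s s1 s2; have t0s : t0 <= s by move: s1; rewrite subKr => /ltW.
  have sT1 := le_trans s2 a2.
  apply: le_trans (minm s xs y' t0s sT1 Dy' thy).
  rewrite -addrA lerD2l [leRHS]addrC lerD2l ler_pM2l // lerD2r.
  by rewrite ler_wpM2l ?exprn_ge0 // ft // u0.
have near_u i : \forall h \near (0 : R), 0 <= u ts (line xs i h).
  have : \forall h \near (0 : R), Omega (line xs i h).
    by apply: near_line; exact: open_nbhs_nbhs.
  by apply: filterS => h Oh; apply: u_ge0 => //; exact: tT.
have [Vc|Vc] := ltP (V xs) c0.
  have nD := VD _ Bxs Vc; have Dxs := nbhs_singleton nD.
  have thx : 0 <= th xs xs by rewrite thxx.
  have one k' : 1 = th xs xs ^+ k' by rewrite thxx expr1n.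
  (* The centre [xs] touches as well: its cut-off value 1 is the largest possible, so Z is at least
     its value for [ys], and minimality gives the reverse inequality. *)
  have H0 : m + eps * C' * E ts +
      eps * (1 * (1 + f (u ts xs)) + 1 * (1 + u ts xs) `^ q) = tquot u tau ts xs.
    have Zxx : Z ts xs xs = eps * (1 * (1 + f (u ts xs)) + 1 * (1 + u ts xs) `^ q)
        + eps * C' * E ts by rewrite /Z !thxx !expr1n fmE.
    rewrite -addrA [_ + eps * (_ + _)]addrC -Zxx; apply/eqP; rewrite eq_le.
    apply/andP; split.
      by have := minm ts xs xs a1 a2 Dxs thx; rewrite subrr mulr0 expR0 mulr1.
    rewrite tqE lerD2l /Z lerD2r ler_pM2l // !thxx !expr1n fmE //.
    have thn k' : th xs ys ^+ k' <= 1 by exact: exprn_ile1.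
    apply: lerD; first by rewrite ler_wpM2r // addr_ge0 // f_ge0.
    by rewrite ler_wpM2r // powR_ge0.
  have H2 i : \forall h \near (0 : R), m + eps * C' * E ts +
      eps * ((1 + (- (2 * 0 * (xs - xs) 0 i / sg)) * h + (- (0 / sg)) * h ^+ 2) *
             ((1 + f (u ts xs)) + fp (u ts xs) * (u ts (line xs i h) - u ts xs)) +
           (1 + (- (2 * 0 * (xs - xs) 0 i / sg)) * h + (- (0 / sg)) * h ^+ 2) *
             (1 + u ts (line xs i h)) `^ q) <= tquot u tau ts (line xs i h).
    (* The centre moves along the line together with the point, so the cut-off stays equal to 1. *)
    have Dh : \forall h \near (0 : R), D (line xs i h) by exact: near_line.
    apply: filterS2 Dh (near_u i) => h Dh uh.
    have thh : 0 <= th (line xs i h) (line xs i h) by rewrite thxx.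
    have := minm ts _ _ a1 a2 Dh thh; rewrite subrr mulr0 expR0 mulr1.
    apply: le_trans; rewrite /Z !thxx !expr1n -[leLHS]addrA lerD2l [leRHS]addrC lerD2l.
    rewrite ler_pM2l // !mulr0 !mul0r oppr0 !mul0r !addr0 !mul1r lerD2r.
    exact: ft.
  have xxsg : esq (xs - xs) <= sg.
    by rewrite esq_subrr ?ltW.
  have := cutoff_touching oO V_ge0 f_tangent u_sol u_ge0 tau0 (tpos _ a1)
    tstau Oxs H0 e0pos (time_ok _ _ xs Dxs thx (one _) (one _)) H2 sg0 xxsg
    ltr01 q1 eps0 C'0 mneg lamV KV.
  rewrite !mul0r !addr0 expr0n /= !mulr0 !mul0r !addr0 mulN1r mul1r subr_gt0.
  rewrite ltNge => /negP; apply; apply: le_trans Elow; exact: bd2.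
set B1 := th xs ys ^+ (k + 3); set B2 := th xs ys ^+ (k + 2).
pose G1 := (k + 3)%:R * th xs ys ^+ (k + 2).
pose G2 := (k + 2)%:R * th xs ys ^+ (k + 1).
have H0 : m + eps * C' * E ts +
    eps * (B1 * (1 + f (u ts xs)) + B2 * (1 + u ts xs) `^ q) = tquot u tau ts xs.
  by rewrite tqE /Z -/B1 -/B2 fmE // -addrA [eps * C' * _ + _]addrC.
have xysg : esq (xs - ys) < sg.
  by move: ths0; rewrite /th subr_gt0 ltr_pdivrMr // mul1r.
have H2 i : \forall h \near (0 : R), m + eps * C' * E ts +
    eps * ((B1 + (- (2 * G1 * (xs - ys) 0 i / sg)) * h + (- (G1 / sg)) * h ^+ 2) *
           ((1 + f (u ts xs)) + fp (u ts xs) * (u ts (line xs i h) - u ts xs)) +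
         (B2 + (- (2 * G2 * (xs - ys) 0 i / sg)) * h + (- (G2 / sg)) * h ^+ 2) *
           (1 + u ts (line xs i h)) `^ q) <= tquot u tau ts (line xs i h).
  have tn : \forall h \near (0 : R), 0 <= th (line xs i h) ys.
    have : \forall h \near (0 : R), esq (line xs i h - ys) < sg.
      by apply: (@near_line R n [set z | esq (z - ys) < sg]); exact: nbhs_esq_ball.
    by apply: filterS => h; rewrite /th subr_ge0 ler_pdivrMr // mul1r; exact: ltW.
  (* The affine minorant of 1 + f(u) must be positive before the power of the cut-off multiplying it
     can be replaced by its quadratic minorant. *)
  have fn : \forall h \near (0 : R),
      0 < (1 + f (u ts xs)) + fp (u ts xs) * (u ts (line xs i h) - u ts xs).
    have D0 := nbhs_singleton (solution_dx oO u_sol.1 i (tT _ a1 a2) Oxs).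
    have Dg := is_derive1_add (is_derive_cst (1 + f (u ts xs)) (0 : R) 1)
      (is_derive1_cmul (fp (u ts xs)) (is_derive1_sub D0 (is_derive_cst (u ts xs) (0 : R) 1))).
    have cg : {for (0 : R), continuous (fun h : R =>
        (1 + f (u ts xs)) + fp (u ts xs) * (u ts (line xs i h) - u ts xs))}.
      by have [Dg0 _] := Dg; exact/differentiable_continuous/derivable1_diffP.
    have /cvgr_gt := cg; apply.
    by rewrite line0 subrr mulr0 addr0 ltr_pwDl // f_ge0.
  apply: filterS3 tn fn (near_u i) => h th_h f_h uh.
  have := minm ts _ _ a1 a2 Dys th_h; rewrite subrr mulr0 expR0 mulr1.
  apply: le_trans; rewrite /Z -[leLHS]addrA lerD2l [leRHS]addrC lerD2l ler_pM2l //.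
  have thE : th (line xs i h) ys - th xs ys = - (2 * (xs - ys) 0 i * h + h ^+ 2) / sg.
    by rewrite /th esq_line; field; rewrite gt_eqF.
  have tan k' : th xs ys ^+ k'.+1 + (- (2 * (k'.+1%:R * th xs ys ^+ k') * (xs - ys) 0 i / sg)) * h
      + (- (k'.+1%:R * th xs ys ^+ k' / sg)) * h ^+ 2 <= th (line xs i h) ys ^+ k'.+1.
    apply: le_trans (tangent_pow k' ths th_h); rewrite thE.
    by rewrite le_eqVlt; apply/orP; left; apply/eqP; field; rewrite gt_eqF.
  have tan3 := tan (k + 2)%N; have tan2 := tan (k + 1)%N.
  rewrite -addnS -/B1 -/G1 in tan3; rewrite -addnS -/B2 -/G2 in tan2.
  apply: lerD; last by rewrite ler_wpM2r // powR_ge0.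
  apply: (@le_trans _ _ (th (line xs i h) ys ^+ (k + 3) *
     ((1 + f (u ts xs)) + fp (u ts xs) * (u ts (line xs i h) - u ts xs)))).
    by rewrite ler_wpM2r // ltW.
  by rewrite ler_wpM2l ?exprn_ge0 // ft.
have := cutoff_touching oO V_ge0 f_tangent u_sol u_ge0 tau0 (tpos _ a1)
  tstau Oxs H0 e0pos (time_ok _ _ ys Dys ths erefl erefl) H2 sg0 (ltW xysg)
  (exprn_gt0 _ ths0) q1 eps0 C'0 mneg lamV KV.
rewrite subr_gt0 ltNge => /negP; apply; apply: le_trans Elow.
apply: bd1 => //.
by rewrite ths0 th_le1.
Qed.

(** The constants are fixed independently of [tau] and of the final time of the comparison, so the
    latter can be taken to be t itself and tau can tend to 0. *)
Lemma time_deriv_ge_nonlinearity (D B : set 'rV[R]_n) (sg c0 Vm e0 : R) :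
  compact D -> compact B -> B `<=` Omega -> 0 < sg ->
  (forall x y, D y -> esq (x - y) <= sg -> B x) -> 0 < c0 -> 0 <= Vm ->
  (forall x, B x -> V x <= Vm) ->
  (forall x, B x -> V x < c0 -> nbhs x D) -> 0 < e0 < T ->
  (forall t y, T - e0 <= t -> t < T -> B y -> e0 <= time_deriv u t y) ->
  exists2 eps : R, 0 < eps & forall t x, T - e0 <= t -> t < T -> D x ->
    eps * (1 + f (u t x)) <= time_deriv u t x.
Proof.
move=> cD cB BO sg0 DB c00 Vm0 VVm VD /andP[e00 e0T] ute.
pose t0 := T - e0; have t00 : 0 < t0 by rewrite subr_gt0.
have t0T : t0 < T by rewrite ltrBlDr ltrDl.
have [N [M M0 MH]] := cutoff_bound p1 C0 cs0 C20 f_ge0 f_growth f_super Vm0 c00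
  (ler0n R n) sg0.
pose M2 := Vm * (C + C2 * (C2 / cs)).
have M20 : 0 <= M2.
  rewrite mulr_ge0 // addr_ge0 // mulr_ge0 // divr_ge0 //; exact: ltW.
(* The exponential compensates the decay up to T, so the correction term still dominates both error
   bounds at the end. *)
pose C' := (M + M2) * expR ((Vm * C + 1) * (T - t0)).
have C'0 : 0 <= C' by rewrite mulr_ge0 ?expR_ge0 // addr_ge0.
have C'E : C' * expR (- (Vm * C + 1) * (T - t0)) = M + M2.
  by rewrite /C' -mulrA -expRD mulNr subrr expR0 mulr1.
have [U U0 UB] : exists2 U : R, 0 <= U & forall x, B x -> u t0 x <= U.
  by apply: solution_bound => //; rewrite t00.
pose Mx := 1 + C * (1 + U) `^ p + (1 + U) `^ q + C'.
have Mx0 : 0 < Mx.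
  rewrite /Mx -!addrA ltr_pwDl // !addr_ge0 ?powR_ge0 //.
  by rewrite mulr_ge0 // powR_ge0.
pose eps := e0 / Mx; have eps0 : 0 < eps by rewrite divr_gt0.
have epsMx : eps * Mx = e0 by rewrite divfK // gt_eqF.
have C'Mx : C' <= Mx.
  rewrite /Mx lerDr !addr_ge0 ?powR_ge0 //.
  by rewrite mulr_ge0 // powR_ge0.
exists eps => // t x h1 h2 Dx.
have BD : B x by apply: (DB x x Dx); rewrite esq_subrr ?ltW.
apply: (@time_deriv_ge_quot R n T Omega V f u u_sol t x _ (T - t)).
- by rewrite h2 (lt_le_trans t00).
- exact: BO.
- by rewrite subr_gt0.
move=> tau tau0 tauT.
apply: (@comparison_step D B sg c0 Vm t0 t tau e0 eps C' N) => //.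
- by rewrite -epsMx ler_pM2l.
- move=> y By; rewrite -epsMx ler_pM2l // /Mx lerD2r.
  have uy0 : 0 <= u t0 y by apply: u_ge0; [rewrite t00|exact: BO].
  have uyU := UB y By; have p0 : 0 <= p by apply: ltW; apply: lt_trans p1.
  have vU : 1 + u t0 y <= 1 + U by rewrite lerD2l.
  have vp r : 0 <= r -> (1 + u t0 y) `^ r <= (1 + U) `^ r.
    by move=> r0; apply: ge0_ler_powR => //; rewrite nnegrE addr_ge0.
  have [_ _ fC] := f_growth uy0.
  apply: lerD; last by apply: vp; rewrite divr_ge0 // addr_ge0 // mulr_ge0.
  rewrite lerD2l; apply: (le_trans fC); rewrite ler_wpM2l //; exact: vp.
- move=> th s Vx b1 b2 g1 g2 g3 g4 g5 g6 g7 g8 g9 g10; rewrite C'E.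
  apply: (le_trans (MH th s Vx b1 b2 g1 g2 g3 g4 g5 g6 g7 g8 g9 g10)).
  by rewrite lerDl.
- move=> s Vx g1 g2 g3; rewrite C'E.
  apply: (le_trans (plateau_bound p1 C0 cs0 C20 f_growth f_super g1 g2 g3)).
  by rewrite lerDr.
- by rewrite addrC -ltrBrDr.
Qed.

End Comparison.

(** * The Keller-Osserman estimate *)

(** The hypothesis bounds U^(p-1) ga^2; as ga <= 1 and k (p-1) >= 2, it also bounds the power p-1 of
    U ga^k. *)
Lemma power_ball_bound (R : realType) (p c C1 ga U : R) (k : nat) : 1 < p ->
  0 < c -> 0 <= C1 -> 0 < ga <= 1 -> 0 < U -> 2 <= k%:R * (p - 1) ->
  c * U `^ p <= U * (C1 / ga ^+ 2) ->
  U * ga ^+ k <= (C1 / c) `^ (p - 1)^-1.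
Proof.
move=> p1 c0 C10 /andP[g0 g1] U0 kp H.
have p10 : 0 < p - 1 by rewrite subr_gt0.
have U0' := ltW U0; have g0' := ltW g0; have p0 : 0 < p by exact: lt_trans p1.
have H1 : U `^ (p - 1) * ga ^+ 2 <= C1 / c.
  rewrite ler_pdivlMr // mulrAC -ler_pdivlMr ?exprn_gt0 //.
  by rewrite -(ler_pM2l U0) mulrA mulr_powRB1 // mulrC.
have X0 : 0 <= U * ga ^+ k by rewrite mulr_ge0 ?exprn_ge0.
have -> : U * ga ^+ k = ((U * ga ^+ k) `^ (p - 1)) `^ (p - 1)^-1.
  by rewrite -powRrM mulfV ?powRr1 // gt_eqF.
apply: ge0_ler_powR; rewrite ?nnegrE ?powR_ge0 //.
- by rewrite invr_ge0 ltW.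
- by rewrite divr_ge0 // ltW.
apply: le_trans H1; rewrite powRM ?exprn_ge0 //.
rewrite ler_wpM2l ?powR_ge0 // -!powR_mulrn // -powRrM.
by apply: ger_powR => //; rewrite g0.
Qed.

Section KellerOsserman.
Context {R : realType} {n : nat} {T p : R} {Omega : set 'rV[R]_n}
  {u : R -> 'rV[R]_n -> R}.
Hypotheses (oO : open Omega) (uC : C12 T Omega u) (p1 : 1 < p)
  (u_ge0 : forall (t : R) x, 0 < t < T -> Omega x -> 0 <= u t x).

(* Only the second-derivative test at the maximum of u (r - |x - x0|^2)^k is
   used, so the bound does not depend on t. *)
Lemma keller_osserman (x0 : 'rV[R]_n) (r c S t1 : R) : 0 < r <= 1 -> 0 < c ->
  0 < S -> 0 < t1 ->
  (forall x, esq (x - x0) <= r -> Omega x) ->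
  (forall t x, t1 <= t -> t < T -> esq (x - x0) <= r -> S <= u t x ->
     c * u t x `^ p <= laplacian (u t) x) ->
  exists M : R, forall t x, t1 <= t -> t < T -> esq (x - x0) <= r / 2 ->
    u t x <= M.
Proof.
move=> /andP[r0 r1] c0 S0 t10 rO lapH.
have p10 : 0 < p - 1 by rewrite subr_gt0.
have [k kp] : exists k : nat, 2 <= k.+1%:R * (p - 1).
  exists (Num.bound (2 / (p - 1))).
  have b0 : 0 <= 2 / (p - 1) by rewrite divr_ge0 // ltW.
  have := archi_boundP b0; rewrite ltr_pdivrMr // => /ltW/le_trans; apply.
  by rewrite ler_pM2r // ler_nat.
pose ka : R := k.+1%:R; have ka0 : 0 < ka by rewrite ltr0n.
(* At the maximum, Lap u <= u (8 ka^2 |x - x0|^2 / g^2 + 2 n ka / g); with r <= 1 this is at most u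
   C1 / g^2. *)
pose C1 := 8 * ka ^+ 2 + 2 * n%:R * ka.
have C10 : 0 <= C1.
  apply: addr_ge0; first by apply: mulr_ge0 => //; exact: sqr_ge0.
  by rewrite mulr_ge0 ?mulr_ge0 // ltW.
pose M0 := S + (C1 / c) `^ (p - 1)^-1.
have M00 : 0 < M0 by rewrite ltr_wpDr // powR_ge0.
pose g (x : 'rV[R]_n) := r - esq (x - x0).
suff main t x : t1 <= t -> t < T -> esq (x - x0) <= r -> u t x * g x ^+ k.+1 <= M0.
  exists (M0 / (r / 2) ^+ k.+1) => t x h1 h2 h3.
  have r20 : 0 < r / 2 by rewrite divr_gt0.
  rewrite ler_pdivlMr ?exprn_gt0 //.
  have xr : esq (x - x0) <= r by apply: (le_trans h3); rewrite ler_pdivrMr // ler_pMr // ler1n.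
  apply: le_trans (main t x h1 h2 xr); rewrite ler_wpM2l //.
    by apply: u_ge0; [rewrite h2 (lt_le_trans t10)|exact: rO].
  rewrite lerXn2r ?nnegrE //; first exact: ltW.
    by rewrite subr_ge0.
  by rewrite /g; move: h3; lra.
move=> h1 h2 h3; have tT : 0 < t < T by rewrite h2 (lt_le_trans t10).
pose phi x := u t x * g x ^+ k.+1.
have gC x' : {for x', continuous g}.
  have c1 : {for x', continuous (cst r : 'rV[R]_n -> R)} by exact: cst_continuous.
  exact: (continuousB c1 (@continuous_esq_sub R n x0 x')).
have phiC : {within [set y | esq (y - x0) <= r], continuous phi}.
  apply: continuous_in_subspaceT => x' /set_mem/= x'r.
  have cu : {for x', continuous (u t)}.
    apply: (@continuous_comp _ _ _ (fun x => (t, x)) (fun z : R * 'rV[R]_n => u z.1 z.2)).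
      have a1 : (cst t : 'rV[R]_n -> R) @ x' --> t by exact: cst_continuous.
      have a2 : (id : 'rV[R]_n -> 'rV[R]_n) @ x' --> x' by exact: cvg_id.
      exact: (cvg_pair a1 a2).
    by apply: (solution_continuous oO uC) => //; exact: rO.
  have cg : {for x', continuous (fun y => g y ^+ k.+1)}.
    apply: (@continuous_comp _ _ _ g (fun s : R => s ^+ k.+1)); first exact: gC.
    exact: exprn_continuous.
  exact: (continuousM cu cg).
have [|xs /set_mem/= xsr max] := @compact_EVT_max _ _ phi _ _ (@compact_esq_ball R n x0 r) phiC.
  by exists x.
apply: (le_trans (max x (mem_set h3))).
have Oxs := rO _ xsr.
have us0 : 0 <= u t xs by exact: u_ge0.
have gs0 : 0 <= g xs by rewrite subr_ge0.
have gs1 : g xs <= 1 by apply: le_trans r1; rewrite gerBl esq_ge0.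
have gk1 : g xs ^+ k.+1 <= 1 by exact: exprn_ile1.
have R0 : 0 <= (C1 / c) `^ (p - 1)^-1 by exact: powR_ge0.
have [gE|gn0] := eqVneq (g xs) 0.
  by rewrite /phi gE expr0n mulr0 ltW.
have [uS|Su] := ltP (u t xs) S.
  apply: (@le_trans _ _ (u t xs)); first by rewrite ler_piMr.
  by apply: (le_trans (ltW uS)); rewrite lerDl.
have gpos : 0 < g xs by rewrite lt_neqAle eq_sym gn0.
apply: (@le_trans _ _ ((C1 / c) `^ (p - 1)^-1)); last by rewrite lerDr ltW.
have Upos : 0 < u t xs by exact: lt_le_trans Su.
apply: power_ball_bound => //; first by rewrite gpos.
apply: (le_trans (lapH t xs h1 h2 xsr Su)).
pose ga := g xs; pose xi i := (xs - x0) 0 i.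
have uii i : partial i (partial i (u t)) xs <=
    u t xs * (8 * ka ^+ 2 * xi i ^+ 2 / ga ^+ 2 + 2 * ka / ga).
  pose A := ga ^+ k.+1; pose B := ka * ga ^+ k.
  have B0 : 0 < B by rewrite mulr_gt0 // exprn_gt0.
  have DU := solution_dx oO uC i tT Oxs; have DU1 := solution_dxx uC i tT Oxs.
  (* The tangent minorant of the weight g^(k+1) in the variable g; its product with u is still
     maximal at h = 0. *)
  pose tg h : R := A + (- (2 * B * xi i)) * h + (- B) * h ^+ 2.
  pose dtg h : R := - (2 * B * xi i) + 2 * (- B) * h.
  have Dtg (h : R) : is_derive h 1 tg (dtg h) by exact: is_derive1_quad.
  have Ddtg : is_derive (0 : R) 1 dtg (2 * (- B)).
    have D := is_derive1_quad (- (2 * B * xi i)) (2 * (- B)) 0 0.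
    rewrite (_ : dtg = fun s => - (2 * B * xi i) + 2 * (- B) * s + 0 * s ^+ 2).
      by apply: (is_derive_eq D); rewrite mulr0 addr0.
    by apply/funext => y; rewrite mul0r addr0.
  have [|||E1 E2] := @second_derive_min R
    (fun h => 0 - u t (line xs i h) * tg h)
    (fun h => 0 - (partial i (u t) (line xs i h) * tg h + u t (line xs i h) * dtg h))
    (0 - ((partial i (partial i (u t)) xs * tg 0 +
           partial i (u t) (line xs i 0) * dtg 0) +
      (partial i (u t) (line xs i 0) * dtg 0 + u t (line xs i 0) * (2 * (- B))))).
  - apply: filterS DU => h D; apply: is_derive1_sub (is_derive_cst (0 : R) h 1) _.
    exact: is_derive1_mul.
  - apply: is_derive1_sub (is_derive_cst (0 : R) (0 : R) 1) _.
    have D0 := nbhs_singleton DU.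
    by apply: is_derive1_add; exact: is_derive1_mul.
  - have : \forall h \near (0 : R), esq (line xs i h - x0) < r.
      apply: (@near_line R n [set z | esq (z - x0) < r]); apply: nbhs_esq_ball.
      by rewrite -subr_gt0.
    apply: filterS => h hr; rewrite !sub0r lerN2 line0.
    have -> : tg 0 = A by rewrite /tg !mulr0 expr0n /= mulr0 !addr0.
    apply: le_trans (max _ (mem_set (ltW hr))).
    rewrite /phi; apply: ler_wpM2l.
      by apply: u_ge0 => //; apply/rO/ltW.
    have gh0 : 0 <= g (line xs i h) by rewrite subr_ge0 ltW.
    apply: le_trans (tangent_pow k gs0 gh0).
    rewrite le_eqVlt; apply/orP; left; apply/eqP.
    by rewrite /tg /A /B /ga /ka /g esq_line /xi; ring.
  move: E1 E2; rewrite line0.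
  have -> : tg 0 = ga * ga ^+ k by rewrite /tg !mulr0 expr0n /= mulr0 !addr0 /A exprS.
  have -> : dtg 0 = - (2 * B * xi i) by rewrite /dtg mulr0 addr0.
  rewrite /B; move: (partial i (u t) xs) (partial i (partial i (u t)) xs) => U1 U2 E1 E2.
  have gk0 : 0 < ga ^+ k by exact: exprn_gt0.
  have E3 : ga * U1 = 2 * ka * xi i * u t xs.
    have gkn : ga ^+ k != 0 by rewrite gt_eqF.
    by apply: (mulIf gkn); rewrite -[LHS]addr0 -E1; ring.
  have E4 : ga * U2 <= 4 * ka * xi i * U1 + 2 * ka * u t xs.
    rewrite -(ler_pM2r gk0) -subr_ge0; move: E2; congr (0 <= _); ring.
  have -> : u t xs * (8 * ka ^+ 2 * xi i ^+ 2 / ga ^+ 2 + 2 * ka / ga) =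
     (4 * ka * xi i * (2 * ka * xi i * u t xs) + 2 * ka * u t xs * ga) / ga ^+ 2.
    by field; rewrite gt_eqF.
  rewrite -E3 ler_pdivlMr ?exprn_gt0 // expr2 mulrA -subr_ge0.
  have := ler_wpM2r gs0 E4; rewrite -subr_ge0 -/ga; congr (0 <= _); ring.
rewrite /laplacian; apply: (le_trans (ler_sum _ (fun i _ => uii i))).
rewrite -mulr_sumr ler_pM2l // big_split /= sumr_const card_ord.
rewrite -mulr_suml -mulr_sumr -/(esq (xs - x0)).
rewrite /C1 [leRHS]mulrDl; apply: lerD.
  rewrite ler_pM2r ?invr_gt0 ?exprn_gt0 // ler_piMr ?mulr_ge0 ?sqr_ge0 //.
  exact: le_trans r1.
have -> : 2 * n%:R * ka / g xs ^+ 2 = (2 * ka / ga *+ n) / ga.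
  by rewrite -[_ *+ n]mulr_natr /ga; field; rewrite gt_eqF.
rewrite ler_peMr ?mulrn_wge0 //; first by rewrite divr_ge0 // ?mulr_ge0 // ltW.
by rewrite invf_ge1.
Qed.

End KellerOsserman.

(** * Blowup points, the potential and its isolated zeros *)

Lemma bounded_not_blowup (R : realType) (n : nat) (T : R) (Omega : set 'rV[R]_n)
    (u : R -> 'rV[R]_n -> R) (x0 : 'rV[R]_n) (t1 r M : R) : t1 < T -> 0 < r ->
  (forall t x, t1 <= t -> t < T -> esq (x - x0) <= r -> Omega x -> u t x <= M) ->
  ~ blowup_point T Omega u x0.
Proof.
move=> t1T r0 H; rewrite /blowup_point => E.
have : (limf_esup (fun z : R * 'rV[R]_n => (u z.1 z.2)%:E)
    (filter_prod T^'- (within Omega (nbhs x0))) <= M%:E)%E.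
  apply: ge_ereal_inf.
  exists (ereal_sup ((fun z : R * 'rV[R]_n => (u z.1 z.2)%:E) @`
     ([set t | t1 <= t /\ t < T] `*` [set x | esq (x - x0) <= r /\ Omega x]))).
    exists ([set t | t1 <= t /\ t < T] `*` [set x | esq (x - x0) <= r /\ Omega x]) => //.
    exists ([set t | t1 <= t /\ t < T], [set x | esq (x - x0) <= r /\ Omega x]) => //.
    split=> /=.
      by near=> t; split; [near: t; exact: nbhs_left_ge|near: t; exact: nbhs_left_lt].
    rewrite /within /=.
    have : esq (x0 - x0) < r by rewrite esq_subrr.
    by move=> /nbhs_esq_ball; apply: filterS => x /= /ltW.
  apply: ge_ereal_sup => _ [[t x] [[/= h1 h2] [h3 h4]] <-].
  by rewrite lee_fin; exact: H.
by rewrite E.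
Unshelve. all: by end_near. Qed.

Section HolderPotential.
Context {R : realType} {n : nat} {A : set 'rV[R]_n} {V : 'rV[R]_n -> R}.
Hypothesis V_holder : holder_continuous_on A V.

Lemma holder_near x (e : R) : A x -> 0 < e ->
  \forall y \near x, A y -> `|V x - V y| <= e.
Proof.
move=> Ax e0; have [al [K [al0 al1 H]]] := V_holder.
(* The Hölder constant has no prescribed sign, so a positive majorant is used to define the
   radius. *)
pose K' := `|K| + 1; have K'0 : 0 < K' by rewrite ltr_wpDl.
pose d := (e / K') `^ al^-1.
have d0 : 0 < d by rewrite powR_gt0 // divr_gt0.
have dal : d `^ al = e / K'.
  by rewrite /d -powRrM mulVf ?gt_eqF // powRr1 // divr_ge0 // ltW.
have : esq (x - x) < d ^+ 2.
  by rewrite esq_subrr ?exprn_gt0.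
move=> /nbhs_esq_ball; apply: filterS => y /= yd Ay.
apply: (le_trans (H x y Ax Ay)).
have n0 : 0 <= enorm (x - y) by exact: sqrtr_ge0.
have nd : enorm (x - y) <= d.
  rewrite /enorm -/(esq (x - y)) esq_opp -[leRHS]ger0_norm; last exact: ltW.
  by rewrite -sqrtr_sqr; apply: ler_wsqrtr; exact: ltW.
have -> : e = K' * d `^ al by rewrite dal mulrC divfK // gt_eqF.
apply: (@le_trans _ _ (K' * enorm (x - y) `^ al)).
  by rewrite ler_wpM2r ?powR_ge0 // /K'; have := ler_norm K; lra.
rewrite ler_wpM2l ?(ltW K'0) //; apply: ge0_ler_powR; rewrite ?nnegrE //; exact: ltW.
Qed.

Lemma holder_zero_closed : closed A -> closed [set x | A x /\ V x = 0].
Proof.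
move=> cA x clx; have Ax : A x.
  by apply: cA => O /clx[y [[Ay _] Oy]]; exists y.
split=> //; apply/eqP; rewrite -normr_le0; apply/ler_addgt0Pr => e e0.
have [y [[Ay Vy0] /(_ Ay)]] := clx _ (holder_near Ax e0).
by rewrite Vy0 subr0 add0r.
Qed.

Lemma holder_bounded : compact A -> exists2 M : R, 0 <= M &
  forall x, A x -> V x <= M.
Proof.
move=> /compact_near_coveringP cA.
have : \forall M \near (+oo : set_system R), A `<=` (fun x => A x -> V x <= M).
  apply: (cA _ _ (fun M x => A x -> V x <= M)) => x Ax.
  exists ([set y | A y -> `|V x - V y| <= 1], [set M | V x + 1 <= M]) => /=.
    by split; [exact: holder_near|apply: nbhs_pinfty_ge; exact: num_real].
  move=> [y M] [/= yA VM Ay]; have := yA Ay; rewrite ler_norml => /andP[h1 h2].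
  lra.
move=> [M [_ H]]; exists (`|M| + 1) => // x Ax.
by apply: (H (`|M| + 1)) => //; have := ler_norm M; lra.
Qed.

End HolderPotential.

(** The bound [e] is a squared radius. For compact [K] the set is the image of a product of compact
    sets under addition, hence compact. *)
Definition thick (R : realType) (n : nat) (K : set 'rV[R]_n) (e : R) :=
  [set x | exists2 y, K y & esq (x - y) <= e].

Lemma thick_compact (R : realType) (n : nat) (K : set 'rV[R]_n) (e : R) :
  compact K -> compact (thick K e).
Proof.
move=> cK; pose g (z : 'rV[R]_n * 'rV[R]_n) : 'rV[R]_n := z.1 + z.2.
have -> : thick K e = g @` (K `*` [set z : 'rV[R]_n | esq (z - 0) <= e]).
  apply/seteqP; split=> [x [y Ky xy]|x [[y z] [/= Ky ze] <-]].
    by exists (y, x - y); [split=> //=; rewrite subr0|rewrite /g /= addrC subrK].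
  by exists y => //; rewrite /g /= addrC addKr -[z]subr0.
apply: continuous_compact.
  apply: continuous_subspaceT => z.
  by apply: (@cvgD R _ _ (nbhs z) _ fst snd); [exact: cvg_fst|exact: cvg_snd].
by apply: compact_setX => //; exact: compact_esq_ball.
Qed.

Lemma thick_sub_open (R : realType) (n : nat) (K O : set 'rV[R]_n) :
  compact K -> open O -> K `<=` O -> exists2 e : R, 0 < e & thick K e `<=` O.
Proof.
move=> /compact_near_coveringP cK oO KO.
have : \forall e \near (0 : R)^'+,
    K `<=` (fun y => forall x, esq (x - y) <= e -> O x).
  apply: (cK _ _ (fun e y => forall x, esq (x - y) <= e -> O x)) => y Ky.
  have [b b0 bO] := nbhs_esqP (open_nbhs_nbhs (conj oO (KO y Ky))).
  exists ([set y' | esq (y' - y) < b / 4], [set e | e < b / 4]) => /=.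
    split; last by apply: nbhs_right_lt; rewrite divr_gt0.
    by apply: nbhs_esq_ball; rewrite esq_subrr ?divr_gt0.
  move=> [y' e] [/= y'b eb x xy']; apply: bO.
  by have := esq_triangle x y' y; lra.
move=> H; have [e [He e0]] := @filter_ex R (0^'+) _ _ (filterI H (@nbhs_right_gt R 0)).
by exists e => // x [y Ky xy]; exact: He xy.
Qed.

(** [K] is a relatively clopen part of the zero set inside [Omega], and [B] avoids all other zeros.
    On the compact set [B] minus the interior of [D], V is therefore positive and bounded below by
    some c. *)
Lemma isolating_sets (R : realType) (n : nat) (Omega : set 'rV[R]_n)
    (V : 'rV[R]_n -> R) (x0 : 'rV[R]_n) :
  open Omega -> compact (closure Omega) ->
  (forall x, closure Omega x -> 0 <= V x) ->
  holder_continuous_on (closure Omega) V -> Omega x0 -> V x0 = 0 ->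
  connected_component [set x | closure Omega x /\ V x = 0] x0
    `&` boundary Omega = set0 ->
  exists (D B : set 'rV[R]_n) (sg c0 : R),
  [/\ compact D, compact B, B `<=` Omega, nbhs x0 D &
   [/\ 0 < sg, forall x y, D y -> esq (x - y) <= sg -> B x, 0 < c0 &
     forall x, B x -> V x < c0 -> nbhs x D]].
Proof.
move=> oO cO V_ge0 Vh Ox0 Vx0 comp; set Z := [set x | _] in comp.
have clZ : closed Z by apply: holder_zero_closed => //; exact: closed_closure.
have cZ : compact Z by apply: (subclosed_compact clZ cO) => x [].
have clD : closed (boundary Omega).
  apply: closedI; first exact: closed_closure.
  exact/open_closedC/open_interior.
have Zx0 : Z x0 by split=> //; exact: subset_closure.
have [K [clK clZK KZ Kx0] KD] := component_relclopen cZ clZ clD Zx0 comp.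
have KO : K `<=` Omega `&` ~` (Z `\` K).
  move=> y Ky; split; last by move=> [].
  apply: contrapT => nOy; have : (K `&` boundary Omega) y.
    by split=> //; split; [case: (KZ y Ky)|move=> /interior_subset].
  by rewrite KD.
have cK : compact K := subclosed_compact clK cZ KZ.
have oK : open (Omega `&` ~` (Z `\` K)) by apply: openI => //; exact: closed_openC.
have [e e0 BO] := thick_sub_open cK oK KO.
have e40 : 0 < e / 4 by rewrite divr_gt0.
have nD x : K x -> nbhs x (thick K (e / 4)).
  move=> Kx; have : esq (x - x) < e / 4 by rewrite esq_subrr.
  by move=> /nbhs_esq_ball; apply: filterS => y /= /ltW xy; exists x.
have cD := @thick_compact R n K (e / 4) cK.
have cB := @thick_compact R n K e cK.
pose F := thick K e `&` ~` (thick K (e / 4))°.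
have clF : closed F.
  apply: closedI; last exact/open_closedC/open_interior.
  by apply: compact_closed => //; exact: norm_hausdorff.
have /compact_near_coveringP cF : compact F.
  by apply: (subclosed_compact clF cB) => x [].
have : \forall c \near (0 : R)^'+,
    F `<=` (fun x => closure Omega x -> c <= V x).
  apply: (cF _ _ (fun c x => closure Omega x -> c <= V x)) => x [Bx nDx].
  have [Ox ZKx] := BO x Bx; have clx := subset_closure Ox.
  have Vx : 0 < V x.
    rewrite lt_neqAle V_ge0 // andbT eq_sym; apply/eqP => Vx; apply: nDx.
    by apply: nD; apply: contrapT => nKx; apply: ZKx; split.
  have Vx2 : 0 < V x / 2 by rewrite divr_gt0.
  exists ([set y | closure Omega y -> `|V x - V y| <= V x / 2], [set c | c < V x / 2]) => /=.
    by split; [exact: holder_near|exact: nbhs_right_lt].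
  move=> [y c] [/= yA cV Ay]; have := yA Ay; rewrite ler_norml => /andP[h1 h2].
  lra.
move=> H; have [c [Hc c0]] := @filter_ex R (0^'+) _ _ (filterI H (@nbhs_right_gt R 0)).
(* Two steps of squared length e/4 have total squared length at most 2 e/4 + 2 e/4 = e. *)
exists (thick K (e / 4)), (thick K e), (e / 4), c; split=> //.
- by move=> x /BO[].
- exact: nD.
split=> //.
  move=> x y [z Kz yz] xy; exists z => //.
  by have := esq_triangle x y z; lra.
move=> x Bx Vx; apply: contrapT => nDx.
have [Ox _] := BO x Bx.
have := Hc x (conj Bx nDx) (subset_closure Ox); lra.
Qed.

Lemma bounded_closure_compact (R : realType) (n : nat) (A : set 'rV[R]_n) :
  bounded_set A -> compact (closure A).
Proof.
move=> [M [_ MA]]; pose M' : R := `|M| + 1.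
have AM x : A x -> `|x| <= M' by apply: MA; rewrite /M'; have := ler_norm M; lra.
apply: (@subclosed_compact _ _ [set x | esq (x - 0) <= n%:R * M' ^+ 2]).
- exact: closed_closure.
- exact: compact_esq_ball.
set E := [set x | _].
have clE : closed E.
  by apply: compact_closed; [exact: norm_hausdorff|exact: compact_esq_ball].
rewrite ((closure_id E).1 clE).
apply: closure_subset => x /AM xM; rewrite /E /= subr0.
apply: (le_trans (esq_le_norm _)); rewrite ler_wpM2l // lerXn2r ?nnegrE //.
by rewrite addr_ge0.
Qed.

(** * Assembly of the estimates *)

Lemma no_blowup (R : realType) (n : nat) (Omega : set 'rV[R]_n) (T p : R)
    (f : R -> R) (V : 'rV[R]_n -> R) (x0 : 'rV[R]_n) (u : R -> 'rV[R]_n -> R) :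
  open Omega -> connected Omega -> bounded_set Omega -> 0 < T -> 1 < p ->
  (forall s : R, 0 <= s -> 0 <= f s) ->
  (forall s : R, 0 <= s -> derivable_nneg f s) ->
  @convex_function R R^o `[0, +oo[%classic f ->
  s `^ (- p) * f s @[s --> +oo] --> (1 : R) ->
  (exists C : R, 0 < C /\
     forall s : R, 0 <= s -> `|derive_nneg f s| <= C * (1 + s `^ (p - 1))) ->
  (forall x : 'rV[R]_n, closure Omega x -> 0 <= V x) ->
  holder_continuous_on (closure Omega) V -> Omega x0 -> V x0 = 0 ->
  connected_component [set x | closure Omega x /\ V x = 0] x0
    `&` boundary Omega = set0 ->
  classical_solution T Omega V f u ->
  (forall (t : R) x, 0 < t < T -> Omega x -> 0 <= u t x) ->
  (forall (t : R) x, 0 < t < T -> Omega x -> 0 <= time_deriv u t x) ->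
  ~ blowup_point T Omega u x0.
Proof.
move=> oO conO bO T0 p1 f_ge0 fD f_convex f_asymp f'_growth V_ge0' Vh Ox0 Vx0 comp.
move=> u_sol u_ge0 ut_ge0; have uC := u_sol.1.
have V_ge0 x : Omega x -> 0 <= V x by move=> /subset_closure; exact: V_ge0'.
have cO := bounded_closure_compact bO.
have [b b0 bOm] := nbhs_esqP (open_nbhs_nbhs (conj oO Ox0)).
have T2 : 0 < T / 2 < T by apply/andP; split; lra.
have [[t1 [x1 [t1T Ox1 ut1]]]|nut] := pselect (exists t1 x1,
    [/\ 0 < t1 < T, Omega x1 & 0 < time_deriv u t1 x1]); last first.
  have ut0 t x : 0 < t < T -> Omega x -> time_deriv u t x = 0.
    move=> tT Ox; apply/eqP; rewrite eq_le ut_ge0 // andbT leNgt.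
    by apply/negP => ut; apply: nut; exists t, x.
  have [M _ MH] := solution_bound oO u_sol u_ge0 (@compact_esq_ball R n x0 b) bOm T2.
  case/andP: T2 => T20 T2T.
  apply: (@bounded_not_blowup R n T Omega u x0 (T / 2) b M) => // t x t2 tT xb Ox.
  by rewrite -(solution_stationary u_sol ut0 T20 t2 tT Ox); exact: MH.
have [D [B [sg [c0 [cD cB BO nD [sg0 DB c00 VD]]]]]] :=
  isolating_sets oO cO V_ge0' Vh Ox0 Vx0 comp.
have [C C0 f_growth] := nonlinearity_growth p1 f_ge0 fD f_convex f'_growth.
have q0p : 0 < (3 * p + 1) / 4 < p by apply/andP; split; lra.
have [cs [C2 [cs0 C20 f_super]]] :=
  nonlinearity_superlinear p1 f_ge0 fD f_convex f_asymp f'_growth q0p.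
have f_tangent a c := @tangent_le R f fD f_convex a c.
have f_cont := nonlinearity_continuous p1 f_ge0 fD f_convex f'_growth.
have [Vm Vm0 VVm] := holder_bounded Vh cO.
have VK x s : Omega x -> 0 <= s -> - (Vm * C) <= V x * derive_nneg f s.
  move=> Ox s0; have [fs _ _] := f_growth s s0.
  apply: (@le_trans _ _ (V x * (- C))); last by rewrite ler_wpM2l // V_ge0.
  by rewrite mulrN lerN2 ler_wpM2r ?(ltW C0) //; apply: VVm; exact: subset_closure.
have VmC0 : 0 <= Vm * C by rewrite mulr_ge0 // ltW.
have [e0 e0T ute] := time_deriv_pos_compact oO conO V_ge0 f_tangent VmC0 VK u_sol
  u_ge0 ut_ge0 t1T Ox1 ut1 cB BO.
have VB x : B x -> V x <= Vm by move=> /BO Ox; apply: VVm; exact: subset_closure.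
have [eps eps0 epsH] := time_deriv_ge_nonlinearity oO V_ge0 f_tangent u_sol u_ge0
  ut_ge0 p1 (ltW C0) cs0 C20 f_ge0 f_growth f_super f_cont cD cB BO sg0 DB c00 Vm0 VB
  VD e0T ute.
have [S S1 SH] := @nonlinearity_asymp R p f f_asymp (1 / 2) ltac:(lra).
have eps20 : 0 < eps / 2 by rewrite divr_gt0.
have nV := holder_near Vh (subset_closure Ox0) eps20.
have [r r0 rH] := nbhs_esqP (filterI nD nV).
case/andP: e0T => e00 e0T.
pose r' := Num.min (Num.min r b) 1.
have r'r : r' <= r by rewrite /r' !ge_min lexx.
have r'b : r' <= b by rewrite /r' !ge_min lexx orbT.
have r'01 : 0 < r' <= 1 by rewrite /r' !lt_min r0 b0 ge_min lexx orbT ltr01.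
have t00 : 0 < T - e0 by rewrite subr_gt0.
(* Close to x0, Lap u >= eps f - (eps/2) f = (eps/2) f, and f(s) >= s^p / 2 for s >= S: hence the
   constant eps/4. *)
have eps40 : 0 < eps / 4 by rewrite divr_gt0.
have [||M MH] := @keller_osserman R n T p Omega u oO uC p1 u_ge0 x0 r' (eps / 4) S
  (T - e0) r'01 eps40 (lt_le_trans ltr01 S1) t00.
- by move=> x xr; apply: bOm; exact: le_trans r'b.
- move=> t x tt tT xr Su.
  have tT' : 0 < t < T by rewrite tT andbT (lt_le_trans t00).
  have Ox : Omega x by apply: bOm; exact: le_trans r'b.
  have [Dx /(_ (subset_closure Ox))] := rH x (le_trans xr r'r).
  rewrite Vx0 sub0r normrN ger0_norm ?V_ge0 // => Vx.
  have := u_sol.2 t x tT' Ox; have := epsH t x tt tT Dx.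
  have /andP[h1 _] := SH _ Su.
  have fu := f_ge0 _ (u_ge0 t x tT' Ox).
  have := ler_wpM2r fu Vx.
  move: h1 eps0; set a := _ `^ p; set F := f _; set L := laplacian _ _; set v := V x.
  by clear; nra.
apply: (@bounded_not_blowup R n T Omega u x0 (T - e0) (r' / 2) M) => //.
- by rewrite ltrBlDr ltrDl.
- by rewrite divr_gt0 //; case/andP: r'01.
- by move=> t x tt tT xr _; exact: MH.
Qed.

Theorem theorem1p1 (R : realType) (n : nat) (Omega : set 'rV[R]_n) (T p : R)
    (f : R -> R) (V : 'rV[R]_n -> R) (x0 : 'rV[R]_n)
    (n_gt0 : (0 < n)%N)
    (Omega_domain : domain Omega) (Omega_bounded : bounded_set Omega)
    (T_gt0 : 0 < T) (p_gt1 : 1 < p)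
    (f_ge0 : forall s : R, 0 <= s -> 0 <= f s)
    (f_C2 : C2_nneg f)
    (f_convex : @convex_function R R^o `[0, +oo[%classic f)
    (f_asymp : s `^ (- p) * f s @[s --> +oo] --> (1 : R))
    (f'_growth : exists C : R, 0 < C /\
       forall s : R, 0 <= s -> `|derive_nneg f s| <= C * (1 + s `^ (p - 1)))
    (V_ge0 : forall x : 'rV[R]_n, closure Omega x -> 0 <= V x)
    (V_holder : holder_continuous_on (closure Omega) V)
    (x0_Omega : Omega x0) (V_x0 : V x0 = 0)
    (V0_component :
       connected_component [set x | closure Omega x /\ V x = 0] x0
         `&` boundary Omega = set0) :
  ((p%:E < pS R n)%E ->
   forall u : R -> 'rV[R]_n -> R,
     classical_solution T Omega V f u ->
     (forall (t : R) x, 0 < t < T -> Omega x -> 0 <= u t x) ->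
     (forall (t : R) x, 0 < t < T -> Omega x -> 0 <= time_deriv u t x) ->
     ~ blowup_point T Omega u x0) /\
  (forall rho : R, 0 < rho -> Omega = eball rho ->
   radial_on (closure Omega) V ->
   forall u : R -> 'rV[R]_n -> R,
     classical_solution T Omega V f u ->
     (forall (t : R) x, 0 < t < T -> Omega x -> 0 <= u t x) ->
     (forall (t : R) x, 0 < t < T -> Omega x -> 0 <= time_deriv u t x) ->
     (forall t : R, 0 < t < T -> radial_on Omega (u t)) ->
     ~ blowup_point T Omega u x0).
Proof.
have [oO conO _] := Omega_domain; have [fD _ _] := f_C2.
have H u := @no_blowup R n Omega T p f V x0 u oO conO Omega_bounded T_gt0 p_gt1
  f_ge0 fD f_convex f_asymp f'_growth V_ge0 V_holder x0_Omega V_x0 V0_component.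
by split=> [_ u|rho _ _ _ u] u_sol u_ge0 ut_ge0; [|move=> _]; exact: H.
Qed.
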